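(* Let $r>\frac12$ and suppose that the exact solution $u$ of the periodic RLW problem $$u_t+au_x-\sigma u_{xxt}+\big(\tfrac{\gamma}{2}u^2\big)_x=0,\quad u(x,0)=u_0(x),\quad u(x,t)=u(x+L,t),\quad t\in[0,T],$$ satisfies $u\in C^3(0,T;H^{r+1}_p(\Omega))$. Let $\mathbf{U}^0,\dots,\mathbf{U}^{N_t}\in\mathbb{R}^N$ be the numerical solution of the LCN-MP scheme $$(\mathbb{I}-\sigma\mathbb{D}_2)\,\delta_t^+\mathbf{U}^n+\mathbb{D}\big(\widehat{\mathbf{U}}^{n+\frac12}\big)\mathbf{U}^{n+\frac12}=0\ (n\ge1),\qquad (\mathbb{I}-\sigma\mathbb{D}_2)\,\delta_t^+\mathbf{U}^0+\mathbb{D}\big(\mathbf{U}^{\frac12}\big)\mathbf{U}^{\frac12}=0,$$ with $U_j^0=u_0(x_j)$. Then, without any restriction on the grid ratio between $\tau$ and $h$, $\mathbf{U}^n$ converges to $u$ with order $\mathcal{O}(\tau^2+N^{-r})$ in the discrete $L^\infty$ norm: there is a constant $C>0$ independent of $N$, $\tau$ and $n$ such that $$\|u^n-\mathbf{U}^n\|_{\infty,h}\le C(\tau^2+N^{-r}),\qquad 0\le n\le N_t,$$ where $u^n=(u(x_j,t_n))_{j=0}^{N-1}$.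
   Context: Constants: $a,\sigma,\gamma>0$, $T>0$. $\Omega=[x_L,x_R]$, $L=x_R-x_L$, $\mu=2\pi/L$. $H^s_p(\Omega)$ is the closure in $H^s(\Omega)$ of the smooth $L$-periodic functions (the $L$-periodic Sobolev space of order $s$). $C^3(0,T;X)$ denotes three times continuously differentiable functions of $t\in[0,T]$ with values in $X$. The solution $u$ is real-valued. $N$ is a positive even integer, $h=L/N$, $x_j=x_L+jh$ for $0\le j\le N-1$. Time step $\tau=T/N_t$ with $N_t$ a positive integer, $t_n=n\tau$. Grid functions are vectors $\mathbf{U}=(U_0,\dots,U_{N-1})$, with $\|\mathbf{U}\|_{\infty,h}=\max_{0\le j\le N-1}|U_j|$. Fourier differentiation matrices: $g_j(x)=\frac1N\sum_{k=-N/2}^{N/2}\frac1{c_k}e^{ik\mu(x-x_j)}$ with $c_k=1$ for $|k|\ne N/2$ and $c_{\pm N/2}=2$; $(\mathbb{D}_k)_{jl}=\frac{d^k g_l}{dx^k}(x_j)$, $0\le j,l\le N-1$. $\mathbb{I}$ is the identity matrix. $\mathbb{D}(\mathbf{U})=a\mathbb{D}_1+\frac{\gamma}{3}\big(\mathrm{diag}(\mathbf{U})\mathbb{D}_1+\mathbb{D}_1\mathrm{diag}(\mathbf{U})\big)$. Time notation: $\delta_t^+\mathbf{U}^n=\frac{\mathbf{U}^{n+1}-\mathbf{U}^n}{\tau}$, $\widehat{\mathbf{U}}^{n+\frac12}=\frac{3\mathbf{U}^n-\mathbf{U}^{n-1}}{2}$, $\mathbf{U}^{n+\frac12}=\frac{\mathbf{U}^{n+1}+\mathbf{U}^n}{2}$.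 *)

(* Defs.v *)
From HB Require Import structures.
From mathcomp Require Import all_boot all_order all_algebra.
From mathcomp Require Import complex.
From mathcomp Require Import all_classical all_reals all_analysis.
From mathcomp Require Import ring lra zify.

Set Implicit Arguments.
Unset Strict Implicit.
Unset Printing Implicit Defensive.

Import Order.TTheory GRing.Theory Num.Theory.
Import numFieldNormedType.Exports.

Local Open Scope classical_set_scope.
Local Open Scope ring_scope.
Local Open Scope complex_scope.

Definition expi (R : realType) (theta : R) : R[i] := cos theta +i* sin theta.

Definition wavenumber (R : realType) (xL xR : R) : R := pi *+ 2 / (xR - xL).

Definition smooth_periodic (R : realType) (L : R) (phi : R -> R) : Prop :=
  periodic phi L /\ forall (n : nat) (x : R), derivable (phi^`(n))%classic x 1.

(* (1/L) \int_xL^xR f(x) e^(-i k mu x) dx *)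
Definition fourier_coef (R : realType) (xL xR : R) (f : R -> R) (k : int) :
    R[i] :=
  let mu := wavenumber xL xR in
  ((xR - xL)^-1 *
     (\int[lebesgue_measure]_(x in `[xL, xR]) (f x * cos (k%:~R * mu * x)))%R)
  -i*
  ((xR - xL)^-1 *
     (\int[lebesgue_measure]_(x in `[xL, xR]) (f x * sin (k%:~R * mu * x)))%R).

(* Square of the periodic Sobolev norm of (real) order s:
   \sum_k (1 + (k mu)^2)^s |f^_k|^2. *)
Definition Hs_sqnorm (R : realType) (xL xR s : R) (f : R -> R) : \bar R :=
  \esum_(k in [set: int])
    ((1 + (k%:~R * wavenumber xL xR) ^+ 2) `^ s *
     (complex.Re (fourier_coef xL xR f k) ^+ 2 + complex.Im (fourier_coef xL xR f k) ^+ 2))%:E.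

(* The closure, in the norm of order s, of the smooth L-periodic functions.
   Only orders s > 1/2 are used; there every class has a unique continuous
   periodic representative, and this is the function f. *)
Definition Hsp (R : realType) (xL xR s : R) (f : R -> R) : Prop :=
  [/\ continuous f,
      periodic f (xR - xL) &
      forall e : R, 0 < e -> exists2 phi : R -> R,
        smooth_periodic (xR - xL) phi &
        (Hs_sqnorm xL xR s (f \- phi)%R < e%:E)%E].

(* For w : t |-> w t, with values in H^s_p: d is the derivative of w at t, as a
   limit in H^s over times in [0, T] (one-sided at the end points). *)
Definition is_Hs_derive (R : realType) (xL xR s T : R) (w : R -> R -> R)
    (t : R) (d : R -> R) : Prop :=
  (fun t' : R =>
     Hs_sqnorm xL xR s (fun x => (t' - t)^-1 * (w t' x - w t x) - d x))
  @ within `[0, T] (t^') --> 0%E.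

Definition Hs_continuous_at (R : realType) (xL xR s T : R) (w : R -> R -> R)
    (t : R) : Prop :=
  (fun t' : R => Hs_sqnorm xL xR s (w t' \- w t))
  @ within `[0, T] (nbhs t) --> 0%E.

(* w \in C^m(0, T; H^s_p) *)
Fixpoint Cm_Hsp (R : realType) (xL xR s T : R) (m : nat) (w : R -> R -> R) :
    Prop :=
  (forall t, t \in `[0, T] -> Hsp xL xR s (w t)) /\
  match m with
  | 0 => forall t, t \in `[0, T] -> Hs_continuous_at xL xR s T w t
  | m'.+1 => exists2 w' : R -> R -> R,
      (forall t, t \in `[0, T] -> is_Hs_derive xL xR s T w t (w' t)) &
      Cm_Hsp xL xR s T m' w'
  end.

(* u x t solves the L-periodic problem
     u_t + a u_x - sigma u_xxt + (gamma/2 u^2)_x = 0,  u(x, 0) = u0(x)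
   on [0, T]. The time derivative is the one of the H^s_p-valued function
   t |-> u(., t). For s = r + 1 with r > 1/2, u_xxt only lies in H^(r-1), hence
   for each t the equation is one between L-periodic distributions. *)
Definition RLW_solution (R : realType) (xL xR a sigma gamma T s : R)
    (u0 : R -> R) (u : R -> R -> R) : Prop :=
  [/\ forall x, u x 0 = u0 x,
      forall x t, t \in `[0, T] -> u (x + (xR - xL)) t = u x t &
      forall t, t \in `[0, T] -> exists ut : R -> R,
        [/\ Hsp xL xR s ut,
            is_Hs_derive xL xR s T (fun t' x => u x t') t ut &
            forall phi : R -> R, smooth_periodic (xR - xL) phi ->
              (\int[lebesgue_measure]_(x in `[xL, xR])
                 (ut x * phi x - a * u x t * (phi^`())%classic x
                  - sigma * ut x * (phi^`(2))%classic x
                  - gamma / 2 * u x t ^+ 2 * (phi^`())%classic x))%R = 0 :> R]].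

Definition grid (R : realType) (xL xR : R) (N j : nat) : R :=
  xL + j%:R * ((xR - xL) / N%:R).

Definition nyquist_weight (R : realType) (N : nat) (k : int) : R :=
  if (absz k == N./2)%N then 2 else 1.

(* k = m - N/2 runs over -N/2, ..., N/2 *)
Definition trig_cardinal (R : realType) (xL xR : R) (N j : nat) (x : R) :
    R[i] :=
  (N%:R^-1)%:C *
  \sum_(0 <= m < N.+1)
    let k : int := m%:Z - (N./2)%:Z in
    ((nyquist_weight R N k)^-1)%:C *
    expi (k%:~R * wavenumber xL xR * (x - grid xL xR N j)).

(* The cardinal functions are real-valued, so that taking the real part in
   [fourier_diff] loses nothing. *)
Lemma Im_trig_cardinal (R : realType) (xL xR : R) (N j : nat) (x : R) :
  ~~ odd N -> complex.Im (trig_cardinal xL xR N j x) = 0.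
Proof.
move=> /negbTE evenN.
have ImM (c : R) (z : R[i]) : complex.Im (c%:C * z) = c * complex.Im z.
  by case: z => p q /=; rewrite mul0r addr0.
have ImD (y z : R[i]) : complex.Im (y + z) = complex.Im y + complex.Im z.
  by case: y z => [? ?] [? ?].
rewrite /trig_cardinal ImM (big_morph _ ImD (erefl : complex.Im 0 = 0)).
set S := \sum_(0 <= m < _) _; suff S0 : S = 0 by rewrite S0 mulr0.
suff : S = - S by lra.
rewrite {1}/S big_nat_rev /S -sumrN big_nat [RHS]big_nat.
apply: eq_bigr => m /andP[_ ltmN].
rewrite add0n subSS !ImM /expi /=.
have -> : (N - m)%N%:Z - (N./2)%:Z = - (m%:Z - (N./2)%:Z).
  have := odd_double_half N; rewrite evenN add0n => /esym; lia.
by rewrite /nyquist_weight abszN mulrNz !mulNr sinN mulrN.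
Qed.

Definition fourier_diff (R : realType) (xL xR : R) (N k : nat) : 'M[R]_N :=
  \matrix_(j < N, l < N)
    ((fun x => complex.Re (trig_cardinal xL xR N l x))^`(k))%classic (grid xL xR N j).

Definition DU (R : realType) (xL xR a gamma : R) (N : nat) (U : 'cV[R]_N) :
    'M[R]_N :=
  let D1 := fourier_diff xL xR N 1 in
  a *: D1 + (gamma / 3) *: (diag_mx U^T *m D1 + D1 *m diag_mx U^T).

Definition delta_t (R : realType) (N : nat) (tau : R) (U : nat -> 'cV[R]_N)
    (n : nat) : 'cV[R]_N := tau^-1 *: (U n.+1 - U n).

Definition midpoint (R : realType) (N : nat) (U : nat -> 'cV[R]_N) (n : nat) :
    'cV[R]_N := 2^-1 *: (U n.+1 + U n).

(* (3 U^n - U^(n-1)) / 2, meant for n >= 1 *)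
Definition extrapolation (R : realType) (N : nat) (U : nat -> 'cV[R]_N)
    (n : nat) : 'cV[R]_N := 2^-1 *: (3 *: U n - U n.-1).

(* Only the values U 0, ..., U Nt matter. *)
Definition LCN_MP (R : realType) (xL xR a sigma gamma T : R) (N Nt : nat)
    (u0 : R -> R) (U : nat -> 'cV[R]_N) : Prop :=
  let tau := T / Nt%:R in
  let A := 1%:M - sigma *: fourier_diff xL xR N 2 in
  [/\ U 0%N = \col_(j < N) u0 (grid xL xR N j),
      A *m delta_t tau U 0 + DU xL xR a gamma (midpoint U 0) *m midpoint U 0 = 0
    & forall n, (1 <= n < Nt)%N ->
      A *m delta_t tau U n
      + DU xL xR a gamma (extrapolation U n) *m midpoint U n = 0].

Definition norm_inf_h (R : realType) (N : nat) (U : 'cV[R]_N) : R :=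
  \big[Num.max/0]_(j < N) `|U j 0|.

(* Main.v *)
Require Import Defs.
From HB Require Import structures.
From mathcomp Require Import all_boot all_order all_algebra.
From mathcomp Require Import complex.
From mathcomp Require Import all_classical all_reals all_analysis.
From mathcomp Require Import ring lra zify.

Set Implicit Arguments.
Unset Strict Implicit.
Unset Printing Implicit Defensive.

Import Order.TTheory GRing.Theory Num.Theory.
Import numFieldNormedType.Exports.

Local Open Scope classical_set_scope.
Local Open Scope ring_scope.

(** The scheme is a Crank-Nicolson step for the RLW equation, whose discrete
    energy, the analogue of the mean of [u ^ 2 + sigma * u_x ^ 2], is
    conserved because the transport matrix is skew-symmetric. The energy norm
    controls the supremum norm with a constant independent of [N] ([sup_emb])
    and bounds the transport term as a trilinear form ([trilinear_le]):
    stability therefore needs neither a bound on the numerical solution nor a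
    relation between the steps in time and in space.

    The error is measured against the values on the grid of the Fourier series
    of [u] truncated at frequency [M], with [M] about [N / 4]. With this
    choice the square of the truncated solution is resolved by the grid, so
    the product rule and the quadrature are exact, and the discrete residual
    tested with a vector [psi] equals the weak equation tested with the
    trigonometric interpolant of [psi], up to tails of Fourier series. In the
    dual of the energy norm these tails are of order [N ^ (- r)] when [u] and
    its time derivative are bounded in the Sobolev space of order [r + 1]: one
    derivative is spent on the norm ([residual_le]). Taylor expansions in time
    of bounded linear functionals of the solution give the defect of the
    trapezoidal rule and of the extrapolation, of order [tau ^ 2] in the same
    dual norm ([consistency]).

    Testing the equation for the error with its own midpoint gives a recursion
    for the energy norm of the error ([step_error]), and a discrete Gronwall
    inequality concludes ([gronwall_two_step]). Two points need an argument.
    The initial values are sampled and not truncated: their distance to the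
    truncation gains a power of [N] in the mean square, by duality and a count
    of aliased frequencies ([l2_sub_trunc]), and this power compensates for
    the inverse inequality ([initial_error]). The first step is implicit: when
    it is too long to absorb its own error, the conservation of energy
    replaces the estimate ([error1]).

    Fourier analysis is carried out on cosine and sine coefficients. Instead
    of the convergence of Fourier series, Fejer means are used to pass from
    coefficients to point values ([point_values_le]). *)

(** * Sums over symmetric ranges of integers *)

(** The frequencies are enumerated by a sequence, symmetric about zero, so
    that Fourier sums over ranges of varying size are ordinary indexed sums. *)
Definition zs (n : nat) : seq int := [seq m%:Z - n%:Z | m <- iota 0 n.*2.+1].

Lemma zs_uniq n : uniq (zs n).
Proof. by rewrite map_inj_uniq ?iota_uniq// => i j; lia. Qed.

Lemma mem_zs n k : (k \in zs n) = (`|k| <= n)%N.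
Proof.
apply/mapP/idP => [[m]|hk]; first by rewrite mem_iota => ? ->; lia.
by exists `|(k + n%:Z)%R|%N; [rewrite mem_iota; lia | lia].
Qed.

Section SumsZs.
Variable (R : realFieldType).
Implicit Types (F G : int -> R).

Lemma eq_ler (x y : R) : x = y -> x <= y. Proof. by move=> ->. Qed.

Lemma sum_zs_nat n F :
  \sum_(k <- zs n) F k = \sum_(0 <= m < n.*2.+1) F (m%:Z - n%:Z).
Proof. by rewrite big_map /index_iota subn0. Qed.

Lemma sum_zs0 F : \sum_(k <- zs 0) F k = F 0.
Proof. by rewrite /zs /= big_seq1. Qed.

Lemma sum_zsS n F :
  \sum_(k <- zs n.+1) F k = \sum_(k <- zs n) F k + (F n.+1%:Z + F (- n.+1%:Z)).
Proof.
rewrite !sum_zs_nat doubleS big_nat_recr//= big_nat_recl//=.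
have -> : (n.*2.+2%:Z - n.+1%:Z) = n.+1%:Z by lia.
have -> : \sum_(0 <= i < n.*2.+1) F (i.+1%:Z - n.+1%:Z) =
          \sum_(0 <= m < n.*2.+1) F (m%:Z - n%:Z).
  by apply: eq_bigr => i _; congr F; lia.
by rewrite sub0r; ring.
Qed.

Lemma sum_zs_ge0 n F : (forall k, 0 <= F k) -> 0 <= \sum_(k <- zs n) F k.
Proof. by move=> h; apply: sumr_ge0. Qed.

Lemma sum_zs_restrict m n F : (m <= n)%N ->
  (forall k, (m < `|k|)%N -> F k = 0) ->
  \sum_(k <- zs n) F k = \sum_(k <- zs m) F k.
Proof.
move=> mn h; rewrite -(subnKC mn).
elim: (n - m)%N => [|p IH]; first by rewrite addn0.
by rewrite addnS sum_zsS IH !h ?addr0//; lia.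
Qed.

Lemma sum_zs_le_mono m n F : (m <= n)%N -> (forall k, 0 <= F k) ->
  \sum_(k <- zs m) F k <= \sum_(k <- zs n) F k.
Proof.
move=> mn h; rewrite -(subnKC mn).
elim: (n - m)%N => [|p IH]; first by rewrite addn0.
rewrite addnS sum_zsS (le_trans IH)//.
by have := h (m + p).+1%:Z; have := h (- (m + p).+1%:Z); lra.
Qed.

Lemma sum_zs_pick n (k0 : int) F : (`|k0| <= n)%N ->
  \sum_(k <- zs n) (if k == k0 then F k else 0) = F k0.
Proof.
move=> h; rewrite (bigD1_seq k0) ?mem_zs ?zs_uniq//= eqxx big1 ?addr0//.
by move=> k /negbTE ->.
Qed.

(** Cauchy-Schwarz for pairs of real numbers, with nonnegative weights: the
    form in which it is applied to the cosine and sine coefficients. *)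
Lemma cauchy_schwarz_sum (I : Type) (s : seq I) (c x y x' y' : I -> R) :
  (forall i, 0 <= c i) ->
  (\sum_(i <- s) c i * (x i * x' i + y i * y' i)) ^+ 2 <=
  (\sum_(i <- s) c i * (x i ^+ 2 + y i ^+ 2)) *
  (\sum_(i <- s) c i * (x' i ^+ 2 + y' i ^+ 2)).
Proof.
move=> c0.
set C := \sum_(i <- s) c i * (x i * x' i + y i * y' i).
set A := \sum_(i <- s) c i * (x i ^+ 2 + y i ^+ 2).
set B := \sum_(i <- s) c i * (x' i ^+ 2 + y' i ^+ 2).
have key t u : 0 <= t ^+ 2 * A - 2 * t * u * C + u ^+ 2 * B.
  have -> : t ^+ 2 * A - 2 * t * u * C + u ^+ 2 * B =
     \sum_(i <- s) c i * ((t * x i - u * x' i) ^+ 2 + (t * y i - u * y' i) ^+ 2).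
    rewrite /A /B /C !mulr_sumr -sumrB -big_split/=.
    by apply: eq_bigr => i _; ring.
  by apply: sumr_ge0 => i _; rewrite mulr_ge0// addr_ge0 ?sqr_ge0.
have A0 : 0 <= A.
  by apply: sumr_ge0 => i _; rewrite mulr_ge0// addr_ge0 ?sqr_ge0.
have B0 : 0 <= B.
  by apply: sumr_ge0 => i _; rewrite mulr_ge0// addr_ge0 ?sqr_ge0.
have [BE|Bneq] := eqVneq B 0.
  have h := key 1 ((A + 1) / C).
  have [->|Cn] := eqVneq C 0; first by rewrite expr0n/= mulr_ge0.
  move: h; rewrite BE mulr0 addr0.
  have -> : 1 ^+ 2 * A - 2 * 1 * ((A + 1) / C) * C = - A - 2 by field.
  by lra.
have Bp : 0 < B by rewrite lt_neqAle eq_sym Bneq.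
have := key B C.
have -> : B ^+ 2 * A - 2 * B * C * C + C ^+ 2 * B = B * (A * B - C ^+ 2) by ring.
by rewrite pmulr_rge0// subr_ge0.
Qed.

(** Telescoping: the partial sum stays below two minus the inverse of the
    number of terms. *)
Lemma sum_inv_sqr_le n : \sum_(0 <= k < n) (k.+1%:R ^+ 2)^-1 <= 2 :> R.
Proof.
have h : \sum_(0 <= k < n.+1) (k.+1%:R ^+ 2)^-1 <= 2 - n.+1%:R^-1 :> R.
  elim: n => [|n IH]; first by rewrite big_nat1 expr1n invr1; lra.
  rewrite big_nat_recr//= (le_trans (lerD IH (lexx _)))//.
  rewrite -subr_ge0.
  have n1 : n.+1%:R != 0 :> R by rewrite pnatr_eq0.
  have n2 : n.+2%:R != 0 :> R by rewrite pnatr_eq0.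
  have e : n.+2%:R = n.+1%:R + 1 :> R by rewrite -natr1.
  have -> : 2 - n.+2%:R^-1 - (2 - n.+1%:R^-1 + (n.+2%:R ^+ 2)^-1) =
     (n.+1%:R * n.+2%:R ^+ 2)^-1 :> R.
    move: n1 n2; rewrite e; move: (n.+1%:R) => y n1 n2.
    by field; rewrite n1 n2.
  by rewrite invr_ge0 mulr_ge0 ?exprn_ge0 ?ler0n.
rewrite (le_trans _ (le_trans h _))//.
  by rewrite big_nat_recr//= lerDl invr_ge0 exprn_ge0 ?ler0n.
by rewrite lerBlDr lerDl invr_ge0 ler0n.
Qed.

(** This sum is the constant of the Sobolev embedding in dimension one, for
    continuous functions as well as for grid vectors. *)
Lemma sum_zs_inv_le (m : R) n : 0 < m ->
  \sum_(k <- zs n) (1 + (k%:~R * m) ^+ 2)^-1 <= 1 + 4 / m ^+ 2.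
Proof.
move=> m0; pose F (k : int) := (1 + (k%:~R * m) ^+ 2)^-1.
have FN k : F (- k) = F k by rewrite /F mulrNz mulNr sqrrN.
rewrite -/(F _).
have h : \sum_(k <- zs n) F k <=
    1 + 2 / m ^+ 2 * \sum_(0 <= k < n) (k.+1%:R ^+ 2)^-1.
  elim: n => [|n IH].
    by rewrite sum_zs0 big_geq// /F mulr0 mul0r expr0n/= !addr0 invr1.
  rewrite big_nat_recr//= sum_zsS FN mulrDr [leRHS]addrA lerD//.
  have n0 : 0 < n.+1%:R :> R by rewrite ltr0n.
  have : F n.+1%:Z <= (m ^+ 2)^-1 * (n.+1%:R ^+ 2)^-1.
    by rewrite /F -pmulrn -invfM lef_pV2 ?posrE ?addr_gt0 ?mulr_gt0 ?exprn_gt0 ?mulr_gt0// exprMn mulrC lerDr.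
  move=> h; have -> : 2 / m ^+ 2 / n.+1%:R ^+ 2 =
    m ^- 2 / n.+1%:R ^+ 2 + m ^- 2 / n.+1%:R ^+ 2 by ring.
  exact: lerD.
rewrite (le_trans h)// lerD2l.
have -> : 4 / m ^+ 2 = 2 / m ^+ 2 * 2 by lra.
by rewrite ler_wpM2l ?sum_inv_sqr_le// divr_ge0// exprn_ge0// ltW.
Qed.

End SumsZs.

(** * Continuity of pointwise operations *)

Section ContinuousFunctions.
Variable (R : realType).
Implicit Types (f g : R -> R).

Lemma continuous_scale c f : continuous f -> continuous (fun x => c * f x).
Proof. by move=> cf x; apply: continuousM; [exact: cst_continuous|exact: cf]. Qed.

Lemma continuous_add f g : continuous f -> continuous g ->
  continuous (fun x => f x + g x).
Proof. by move=> cf cg x; apply: continuousD; [exact: cf|exact: cg]. Qed.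

Lemma continuous_sub f g : continuous f -> continuous g ->
  continuous (fun x => f x - g x).
Proof. by move=> cf cg x; apply: continuousB; [exact: cf|exact: cg]. Qed.

Lemma continuous_mul f g : continuous f -> continuous g ->
  continuous (fun x => f x * g x).
Proof. by move=> cf cg x; apply: continuousM; [exact: cf|exact: cg]. Qed.

Lemma continuous_sqr f : continuous f -> continuous (fun x => f x ^+ 2).
Proof. by move=> cf; under eq_fun do rewrite expr2; exact: continuous_mul. Qed.

End ContinuousFunctions.

(** * Mean values of continuous functions over a period *)

Section Mean.
Variables (R : realType) (xL xR : R).
Hypothesis hx : xL < xR.
Implicit Types (f g : R -> R).

Local Notation mu := (wavenumber xL xR).
Local Notation L := (xR - xL).
Local Notation leb := lebesgue_measure.

Definition mean f : R := L^-1 * (\int[leb]_(x in `[xL, xR]) f x)%R.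

Lemma period_gt0 : 0 < L. Proof. by rewrite subr_gt0. Qed.

Lemma period_neq0 : L != 0. Proof. by rewrite gt_eqF// period_gt0. Qed.

Lemma wavenumber_gt0 : 0 < mu.
Proof. by rewrite /wavenumber divr_gt0 ?period_gt0// mulrn_wgt0// pi_gt0. Qed.

Lemma wavenumber_neq0 : mu != 0. Proof. by rewrite gt_eqF// wavenumber_gt0. Qed.

Lemma wavenumber_period : mu * L = pi *+ 2.
Proof. by rewrite /wavenumber divfK// period_neq0. Qed.

Lemma integrable_continuous f : continuous f ->
  leb.-integrable `[xL, xR] (EFin \o f).
Proof.
move=> cf; apply: continuous_compact_integrable; first exact: segment_compact.
exact/continuous_subspaceT.
Qed.

Let mI : measurable (`[xL, xR]%classic : set R).
Proof. exact: measurable_itv. Qed.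

Lemma meanD f g : continuous f -> continuous g ->
  mean (fun x => f x + g x) = mean f + mean g.
Proof.
by move=> cf cg; rewrite /mean RintegralD ?mulrDr//; exact: integrable_continuous.
Qed.

Lemma meanZ c f : continuous f -> mean (fun x => c * f x) = c * mean f.
Proof.
move=> cf; rewrite /mean RintegralZl//; first by rewrite mulrCA.
exact: integrable_continuous.
Qed.

Lemma meanB f g : continuous f -> continuous g ->
  mean (fun x => f x - g x) = mean f - mean g.
Proof.
by move=> cf cg; rewrite /mean RintegralB ?mulrBr//; exact: integrable_continuous.
Qed.

Lemma mean_cst c : mean (fun=> c) = c.
Proof.
rewrite /mean Rintegral_cst//= lebesgue_measure_itv/= lte_fin hx.
by rewrite -EFinB/= mulrCA mulVf ?period_neq0 ?mulr1.
Qed.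

Lemma mean_sum (I : Type) (s : seq I) (F : I -> R -> R) :
  (forall i, continuous (F i)) ->
  continuous (fun x => \sum_(i <- s) F i x) /\
  mean (fun x => \sum_(i <- s) F i x) = \sum_(i <- s) mean (F i).
Proof.
move=> cF; elim: s => [|i s [c IH]].
  under [X in mean X]eq_fun do rewrite big_nil.
  rewrite big_nil mean_cst; split => //.
  by under eq_fun do rewrite big_nil; exact: cst_continuous.
under [X in mean X]eq_fun do rewrite big_cons.
rewrite big_cons -IH meanD//; split => //.
by under eq_fun do rewrite big_cons; move=> x; exact: continuousD (cF i x) (c x).
Qed.

Lemma ler_mean f g : continuous f -> continuous g ->
  (forall x, xL <= x <= xR -> f x <= g x) -> mean f <= mean g.
Proof.
move=> cf cg fg; rewrite /mean ler_pM2l ?invr_gt0 ?period_gt0//.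
apply: le_Rintegral ; [exact: mI|exact: integrable_continuous|exact: integrable_continuous|].
by move=> x /=; rewrite in_itv/=; exact: fg.
Qed.

Lemma mean_norm_le f c : continuous f ->
  (forall x, xL <= x <= xR -> `|f x| <= c) -> `|mean f| <= c.
Proof.
move=> cf fc; rewrite ler_norml; apply/andP; split.
  rewrite -[X in X <= _]mean_cst; apply: ler_mean => //; first exact: cst_continuous.
  by move=> x /fc; rewrite ler_norml => /andP[].
rewrite -[X in _ <= X]mean_cst; apply: ler_mean => //; first exact: cst_continuous.
by move=> x /fc; rewrite ler_norml => /andP[].
Qed.

(** The fundamental theorem of calculus, in the normalization of the Fourier
    coefficients. *)
Lemma mean_derive (F f : R -> R) : continuous f ->
  (forall x : R, is_derive x 1 F (f x)) -> mean f = L^-1 * (F xR - F xL).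
Proof.
move=> cf dF; rewrite /mean /Rintegral; congr (_ * _).
have cF : continuous F.
  by move=> x; apply/differentiable_continuous/derivable1_diffP; have [] := dF x.
rewrite (@continuous_FTC2 R f F xL xR)//.
- exact/continuous_subspaceT.
- split.
  + by move=> x _; have [] := dF x.
  + exact/cvg_at_right_filter/cF.
  + exact/cvg_at_left_filter/cF.
- by move=> x _; rewrite derive1E; have [_ ->] := dF x.
Qed.

(** ** Trigonometric functions *)

Lemma cosD2pin (x : R) (n : nat) : cos (x + n%:R * (pi *+ 2)) = cos x.
Proof.
elim: n x => [|n IH] x; first by rewrite mul0r addr0.
by rewrite -natr1 mulrDl mul1r addrA cosD2pi.
Qed.

Lemma sinD2pin (x : R) (n : nat) : sin (x + n%:R * (pi *+ 2)) = sin x.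
Proof.
elim: n x => [|n IH] x; first by rewrite mul0r addr0.
by rewrite -natr1 mulrDl mul1r addrA sinD2pi.
Qed.

Lemma cosD2piz (x : R) (k : int) : cos (x + k%:~R * (pi *+ 2)) = cos x.
Proof.
case: (intP k) => [|n|n]; first by rewrite mul0r addr0.
  exact: cosD2pin.
by rewrite -[LHS](cosD2pin _ n.+1) mulrNz mulNr subrK.
Qed.

Lemma sinD2piz (x : R) (k : int) : sin (x + k%:~R * (pi *+ 2)) = sin x.
Proof.
case: (intP k) => [|n|n]; first by rewrite mul0r addr0.
  exact: sinD2pin.
by rewrite -[LHS](sinD2pin _ n.+1) mulrNz mulNr subrK.
Qed.

Definition cosk (k : int) (x : R) : R := cos (k%:~R * mu * x).
Definition sink (k : int) (x : R) : R := sin (k%:~R * mu * x).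

Lemma continuous_lin (c d : R) : continuous (fun x : R => c * x + d).
Proof.
move=> x; apply: continuousD; last exact: cst_continuous.
by apply: continuousM; [exact: cst_continuous | exact: cvg_id].
Qed.

Lemma continuous_cos_lin (c d : R) : continuous (fun x : R => cos (c * x + d)).
Proof. by move=> x; apply: continuous_comp; [exact: continuous_lin | exact: continuous_cos]. Qed.

Lemma continuous_sin_lin (c d : R) : continuous (fun x : R => sin (c * x + d)).
Proof. by move=> x; apply: continuous_comp; [exact: continuous_lin | exact: continuous_sin]. Qed.

Lemma cosk_period k x : cosk k (x + L) = cosk k x.
Proof.
by rewrite /cosk mulrDr -[X in _ + X]mulrA wavenumber_period cosD2piz.
Qed.

Lemma sink_period k x : sink k (x + L) = sink k x.
Proof.
by rewrite /sink mulrDr -[X in _ + X]mulrA wavenumber_period sinD2piz.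
Qed.

Lemma coskN k x : cosk (- k) x = cosk k x.
Proof. by rewrite /cosk mulrNz !mulNr cosN. Qed.

Lemma sinkN k x : sink (- k) x = - sink k x.
Proof. by rewrite /sink mulrNz !mulNr sinN. Qed.

Lemma cosk2Dsink2 k x : cosk k x ^+ 2 + sink k x ^+ 2 = 1.
Proof. exact: cos2Dsin2. Qed.

Lemma cosk_sub k x y :
  cos (k%:~R * mu * (x - y)) = cosk k y * cosk k x + sink k y * sink k x.
Proof. by rewrite mulrBr cosB mulrC [sin _ * _]mulrC. Qed.

Lemma coskD j k x : cosk (j + k) x = cosk j x * cosk k x - sink j x * sink k x.
Proof. by rewrite /cosk intrD !mulrDl cosD. Qed.

Lemma sinkD j k x : sink (j + k) x = sink j x * cosk k x + cosk j x * sink k x.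
Proof. by rewrite /sink intrD !mulrDl sinD. Qed.

Lemma coskMcosk j k x :
  cosk j x * cosk k x = 2^-1 * cosk (j + k) x + 2^-1 * cosk (j - k) x.
Proof. by rewrite !coskD coskN sinkN; field. Qed.

Lemma sinkMsink j k x :
  sink j x * sink k x = 2^-1 * cosk (j - k) x - 2^-1 * cosk (j + k) x.
Proof. by rewrite !coskD coskN sinkN; field. Qed.

Lemma sinkMcosk j k x :
  sink j x * cosk k x = 2^-1 * sink (j + k) x + 2^-1 * sink (j - k) x.
Proof. by rewrite !sinkD coskN sinkN; field. Qed.

Lemma continuous_cosk k : continuous (cosk k).
Proof.
have -> : cosk k = (fun x => cos (k%:~R * mu * x + 0)).
  by apply/funext => x; rewrite addr0.
exact: continuous_cos_lin.
Qed.

Lemma continuous_sink k : continuous (sink k).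
Proof.
have -> : sink k = (fun x => sin (k%:~R * mu * x + 0)).
  by apply/funext => x; rewrite addr0.
exact: continuous_sin_lin.
Qed.

Lemma is_derive_cos_lin (c d x : R) :
  is_derive x 1 (fun x => cos (c * x + d)) (- c * sin (c * x + d)).
Proof.
by apply: is_derive_eq; rewrite /GRing.scale/= !(addr0, add0r, mulr0, mulr1); ring.
Qed.

Lemma is_derive_sin_lin (c d x : R) :
  is_derive x 1 (fun x => sin (c * x + d)) (c * cos (c * x + d)).
Proof.
by apply: is_derive_eq; rewrite /GRing.scale/= !(addr0, add0r, mulr0, mulr1); ring.
Qed.

(** The phase form covers cosines and sines at once. *)
Lemma mean_cos (k : int) (th : R) :
  mean (fun x => cos (k%:~R * mu * x + th)) = if k == 0 then cos th else 0.
Proof.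
case: eqVneq => [->|k0].
  rewrite -[RHS]mean_cst; congr mean; apply/funext => x.
  by rewrite !mul0r add0r.
have km0 : k%:~R * mu != 0 by rewrite mulf_neq0 ?intr_eq0 ?wavenumber_neq0.
rewrite -[LHS](mulKf km0) -meanZ; last exact: continuous_cos_lin.
suff -> : mean (fun x => k%:~R * mu * cos (k%:~R * mu * x + th)) =
    L^-1 * (sin (k%:~R * mu * xR + th) - sin (k%:~R * mu * xL + th)).
  have -> : k%:~R * mu * xR + th = k%:~R * mu * xL + th + k%:~R * (pi *+ 2).
    by rewrite -wavenumber_period; ring.
  by rewrite sinD2piz subrr !mulr0.
apply: (@mean_derive (fun x => sin (k%:~R * mu * x + th))).
  by apply: continuous_scale; exact: continuous_cos_lin.
by move=> x; exact: is_derive_sin_lin.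
Qed.

Lemma mean_cosk k : mean (cosk k) = (k == 0)%:R.
Proof.
have := mean_cos k 0; rewrite cos0.
have -> : (fun x => cos (k%:~R * mu * x + 0)) = cosk k.
  by apply/funext => x; rewrite addr0.
by move=> ->; case: ifP.
Qed.

Lemma mean_sink k : mean (sink k) = 0.
Proof.
have := mean_cos k (- (pi / 2)); rewrite cosN cos_pihalf if_same => <-.
by congr mean; apply/funext => x; rewrite cosBpihalf.
Qed.

(** The two trigonometric moments of [f], that is, the real part and minus the
    imaginary part of its Fourier coefficient. *)
Definition ccoef f (k : int) : R := mean (fun x => f x * cosk k x).
Definition scoef f (k : int) : R := mean (fun x => f x * sink k x).

Lemma continuousMcosk f k : continuous f -> continuous (fun x => f x * cosk k x).
Proof. by move=> cf x; apply: continuousM; [exact: cf|exact: continuous_cosk]. Qed.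

Lemma continuousMsink f k : continuous f -> continuous (fun x => f x * sink k x).
Proof. by move=> cf x; apply: continuousM; [exact: cf|exact: continuous_sink]. Qed.

Lemma ccoefD f g k : continuous f -> continuous g ->
  ccoef (fun x => f x + g x) k = ccoef f k + ccoef g k.
Proof.
move=> cf cg; rewrite /ccoef -meanD; try exact: continuousMcosk.
by congr mean; apply/funext => x; rewrite mulrDl.
Qed.

Lemma scoefD f g k : continuous f -> continuous g ->
  scoef (fun x => f x + g x) k = scoef f k + scoef g k.
Proof.
move=> cf cg; rewrite /scoef -meanD; try exact: continuousMsink.
by congr mean; apply/funext => x; rewrite mulrDl.
Qed.

Lemma ccoefZ c f k : continuous f -> ccoef (fun x => c * f x) k = c * ccoef f k.
Proof.
move=> cf; rewrite /ccoef -meanZ; last exact: continuousMcosk.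
by congr mean; apply/funext => x; rewrite mulrA.
Qed.

Lemma scoefZ c f k : continuous f -> scoef (fun x => c * f x) k = c * scoef f k.
Proof.
move=> cf; rewrite /scoef -meanZ; last exact: continuousMsink.
by congr mean; apply/funext => x; rewrite mulrA.
Qed.

Lemma ccoefB f g k : continuous f -> continuous g ->
  ccoef (fun x => f x - g x) k = ccoef f k - ccoef g k.
Proof.
move=> cf cg; rewrite -[- ccoef g k]mulN1r -ccoefZ// -ccoefD//.
  by congr (ccoef _ k); apply/funext => x; rewrite mulN1r.
exact: continuous_scale.
Qed.

Lemma scoefB f g k : continuous f -> continuous g ->
  scoef (fun x => f x - g x) k = scoef f k - scoef g k.
Proof.
move=> cf cg; rewrite -[- scoef g k]mulN1r -scoefZ// -scoefD//.
  by congr (scoef _ k); apply/funext => x; rewrite mulN1r.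
exact: continuous_scale.
Qed.

Lemma ccoefN f (k : int) : ccoef f (- k) = ccoef f k.
Proof. by congr mean; apply/funext => x; rewrite coskN. Qed.

Lemma scoefN f (k : int) : continuous f -> scoef f (- k) = - scoef f k.
Proof.
move=> cf; rewrite -[RHS]mulN1r /scoef -meanZ; last exact: continuousMsink.
by congr mean; apply/funext => x; rewrite sinkN; ring.
Qed.

End Mean.

(** * Trigonometric polynomials and the grid *)

Section TrigSums.
Variable (R : realType).
Implicit Types (th al x : R).

(** Multiplying by twice the sine of half the step makes the sum telescope. *)
Lemma sum_cos_arith th al n :
  2 * sin (al / 2) * (\sum_(0 <= j < n) cos (th + j%:R * al)) =
  sin (th + n%:R * al - al / 2) - sin (th - al / 2).
Proof.
elim: n => [|n IH]; first by rewrite big_geq// mulr0 mul0r addr0 subrr.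
rewrite big_nat_recr//= mulrDr IH.
have -> : th + n.+1%:R * al - al / 2 = (th + n%:R * al) + al / 2.
  by rewrite -natr1; lra.
by move: (th + _) => be; rewrite [sin (be - _)]sinB [sin (be + _)]sinD; ring.
Qed.

Lemma sum_sin_arith th al n :
  2 * sin (al / 2) * (\sum_(0 <= j < n) sin (th + j%:R * al)) =
  cos (th - al / 2) - cos (th + n%:R * al - al / 2).
Proof.
under eq_bigr do rewrite -cosBpihalf addrAC.
rewrite sum_cos_arith.
have -> : th - pi / 2 + n%:R * al - al / 2 = th + n%:R * al - al / 2 - pi / 2 by ring.
have -> : th - pi / 2 - al / 2 = th - al / 2 - pi / 2 by ring.
by rewrite !sinBpihalf; ring.
Qed.

(** Over a full turn the telescoped sum closes up; the frequency is not a
    multiple of [N], so the factor that was multiplied in does not vanish. *)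
Lemma sum_cos_root (N : nat) (m : int) th : (0 < `|m| < N)%N ->
  \sum_(0 <= j < N) cos (th + j%:R * (m%:~R * (pi *+ 2 / N%:R))) = 0.
Proof.
move=> /andP[m0 mN].
have N0 : N%:R != 0 :> R by rewrite pnatr_eq0; lia.
set al := m%:~R * _.
have al2 : al / 2 = m%:~R * (pi / N%:R) by rewrite /al; field.
have s0 : sin (al / 2) != 0.
  have hp : 0 < sin (`|m|%N%:R * (pi / N%:R)) :> R.
    apply: sin_gt0_pi; rewrite mulr_gt0 ?divr_gt0 ?pi_gt0 ?ltr0n//=; last lia.
    rewrite mulrCA gtr_pMr ?pi_gt0// ltr_pdivrMr ?mul1r ?ltr_nat// ltr0n; lia.
  rewrite al2; case: (intP m) m0 hp => [//|p|p] _; rewrite ?abszN absz_nat => hp.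
    by rewrite gt_eqF.
  by rewrite mulrNz mulNr sinN oppr_eq0 gt_eqF.
have := sum_cos_arith th al N.
have -> : th + N%:R * al - al / 2 = th - al / 2 + m%:~R * (pi *+ 2).
  by rewrite /al; field.
rewrite sinD2piz subrr => /eqP; rewrite mulf_eq0 mulf_eq0 (negbTE s0) pnatr_eq0/=.
by move=> /eqP.
Qed.

Lemma cosMcos (x y : R) : cos x * cos y = 2^-1 * cos (x + y) + 2^-1 * cos (x - y).
Proof. by rewrite cosD cosB; field. Qed.

End TrigSums.

Section TrigPolynomials.
Variables (R : realType) (xL xR : R).
Hypothesis hx : xL < xR.

Local Notation mu := (wavenumber xL xR).
Local Notation L := (xR - xL).
Local Notation mean := (mean xL xR).
Local Notation cosk := (cosk xL xR).
Local Notation sink := (sink xL xR).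

(** Trigonometric polynomials of degree at most [d], in a phase form: a
    product of two cosines is a sum of two cosines, so products stay in this
    form without separating cosines from sines. *)
Inductive trigdeg (d : nat) : (R -> R) -> Prop :=
| trigdeg_zero : trigdeg d (fun=> 0)
| trigdeg_cons c k th f : (`|k| <= d)%N -> trigdeg d f ->
    trigdeg d (fun x => c * cos (k%:~R * mu * x + th) + f x).

Lemma trigdeg_cos d k th : (`|k| <= d)%N ->
  trigdeg d (fun x => cos (k%:~R * mu * x + th)).
Proof.
move=> kd; have := trigdeg_cons 1 th kd (trigdeg_zero d).
by congr trigdeg; apply/funext => x; rewrite mul1r addr0.
Qed.

Lemma trigdegD d f g : trigdeg d f -> trigdeg d g -> trigdeg d (fun x => f x + g x).
Proof.
move=> + tg; elim => [|c k th h kd _ IH].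
  by move: tg; congr trigdeg; apply/funext => x; rewrite add0r.
have := trigdeg_cons c th kd IH; congr trigdeg.
by apply/funext => x; rewrite addrA.
Qed.

Lemma trigdegZ d c f : trigdeg d f -> trigdeg d (fun x => c * f x).
Proof.
elim => [|b k th h kd _ IH].
  by have := trigdeg_zero d; congr trigdeg; apply/funext => x; rewrite mulr0.
have := trigdeg_cons (c * b) th kd IH; congr trigdeg.
by apply/funext => x; rewrite mulrDr mulrA.
Qed.

Lemma trigdeg_sum d (I : Type) (s : seq I) (P : pred I) (F : I -> R -> R) :
  (forall i, P i -> trigdeg d (F i)) -> trigdeg d (fun x => \sum_(i <- s | P i) F i x).
Proof.
move=> h; elim: s => [|i s IH].
  by have := trigdeg_zero d; congr trigdeg; apply/funext => x; rewrite big_nil.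
case Pi : (P i).
  have := trigdegD (h _ Pi) IH; congr trigdeg.
  by apply/funext => x; rewrite big_cons Pi.
by move: IH; congr trigdeg; apply/funext => x; rewrite big_cons Pi.
Qed.

Lemma trigdegM d e f g : trigdeg d f -> trigdeg e g ->
  trigdeg (d + e) (fun x => f x * g x).
Proof.
move=> + tg; elim => [|c k th h kd _ IH].
  have := trigdeg_zero (d + e); congr trigdeg.
  by apply/funext => x; rewrite mul0r.
under eq_fun do rewrite mulrDl; apply: trigdegD => //.
under eq_fun do rewrite -mulrA; apply: trigdegZ.
elim: tg => [|b l ph j le _ IHg].
  have := trigdeg_zero (d + e); congr trigdeg.
  by apply/funext => x; rewrite mulr0.
under eq_fun do rewrite mulrDr; apply: trigdegD => //.
have kl1 : (`|(k + l)%R| <= d + e)%N by move: kd le; clear; lia.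
have kl2 : (`|(k - l)%R| <= d + e)%N by move: kd le; clear; lia.
have := trigdegZ b (trigdegD
  (trigdegZ 2^-1 (trigdeg_cos (th + ph) kl1))
  (trigdegZ 2^-1 (trigdeg_cos (th - ph) kl2))); congr trigdeg.
apply/funext => x; rewrite [RHS]mulrCA cosMcos; congr (_ * (_ * cos _ + _ * cos _)).
  by rewrite intrD; ring.
by rewrite intrB; ring.
Qed.

Lemma continuous_trigdeg d f : trigdeg d f -> continuous f.
Proof.
elim => [|c k th g kd _ IH]; first exact: cst_continuous.
move=> x; apply: continuousD (IH x); apply: continuousM; first exact: cst_continuous.
exact: continuous_cos_lin.
Qed.

Lemma coskE k x : cosk k x = cos (k%:~R * mu * x + 0).
Proof. by rewrite addr0. Qed.

Lemma sinkE k x : sink k x = cos (k%:~R * mu * x + - (pi / 2)).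
Proof. by rewrite cosBpihalf. Qed.

Lemma trigdeg_cosk d k : (`|k| <= d)%N -> trigdeg d (cosk k).
Proof.
by move=> /(trigdeg_cos 0); congr trigdeg; apply/funext => x; rewrite coskE.
Qed.

Lemma trigdeg_sink d k : (`|k| <= d)%N -> trigdeg d (sink k).
Proof.
by move=> /(trigdeg_cos (- (pi / 2))); congr trigdeg; apply/funext => x; rewrite sinkE.
Qed.

(** Positive and negative frequencies are both listed, as in the complex
    Fourier series. The coefficients of a real function are then even
    (cosines) and odd (sines) in the frequency. *)
Definition trig (n : nat) (p q : int -> R) (x : R) : R :=
  \sum_(k <- zs n) (p k * cosk k x + q k * sink k x).

Lemma trigdeg_trig n p q : trigdeg n (trig n p q).
Proof.
have -> : trig n p q =
    (fun x => \sum_(k <- zs n | (`|k| <= n)%N) (p k * cosk k x + q k * sink k x)).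
  apply/funext => x; rewrite /trig big_seq [RHS]big_seq_cond; apply: eq_bigl => k.
  by rewrite mem_zs andbb.
apply: trigdeg_sum => k kn.
by apply: trigdegD; apply: trigdegZ; [exact: trigdeg_cosk|exact: trigdeg_sink].
Qed.

Lemma continuous_trig n p q : continuous (trig n p q).
Proof. exact/continuous_trigdeg/trigdeg_trig. Qed.

Lemma is_derive_trig n p q (x : R) :
  is_derive x 1 (trig n p q)
    (trig n (fun k => k%:~R * mu * q k) (fun k => - (k%:~R * mu * p k)) x).
Proof.
rewrite /trig; elim: (zs n) => [|k s IH].
  rewrite big_nil; have -> : (fun x => \sum_(k <- [::]) (p k * cosk k x + q k * sink k x)) = cst 0.
    by apply/funext => y; rewrite big_nil.
  exact: is_derive_cst.
rewrite big_cons.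
have -> : (fun x => \sum_(k <- k :: s) (p k * cosk k x + q k * sink k x)) =
   (p k *: cosk k + q k *: sink k) + (fun x => \sum_(k <- s) (p k * cosk k x + q k * sink k x)).
  by apply/funext => y; rewrite big_cons.
have dc : is_derive x 1 (cosk k) (- (k%:~R * mu) * sink k x).
  have -> : cosk k = (fun y => cos (k%:~R * mu * y + 0)).
    by apply/funext => y; rewrite addr0.
  have -> : sink k x = sin (k%:~R * mu * x + 0) by rewrite addr0.
  exact: is_derive_cos_lin.
have ds : is_derive x 1 (sink k) (k%:~R * mu * cosk k x).
  have -> : sink k = (fun y => sin (k%:~R * mu * y + 0)).
    by apply/funext => y; rewrite addr0.
  have -> : cosk k x = cos (k%:~R * mu * x + 0) by rewrite addr0.
  exact: is_derive_sin_lin.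
apply: (is_derive_eq (is_deriveD (is_deriveD (is_deriveZ (p k) dc) (is_deriveZ (q k) ds)) IH)).
by congr (_ + _); rewrite /GRing.scale/=; ring.
Qed.

Lemma derive1_trig n p q :
  ((trig n p q)^`())%classic = trig n (fun k => k%:~R * mu * q k) (fun k => - (k%:~R * mu * p k)).
Proof.
apply/funext => x; rewrite derive1E.
by have [_ ->] := is_derive_trig n p q x.
Qed.

Lemma derive2_trig n p q :
  ((trig n p q)^`(2))%classic =
  trig n (fun k => - ((k%:~R * mu) ^+ 2 * p k)) (fun k => - ((k%:~R * mu) ^+ 2 * q k)).
Proof.
rewrite derive1nS derive1n1 !derive1_trig; apply/funext => x.
by apply: eq_bigr => k _; congr (_ * _ + _ * _); ring.
Qed.

Lemma trig_period n p q x : trig n p q (x + L) = trig n p q x.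
Proof. by apply: eq_bigr => k _; rewrite (cosk_period hx) (sink_period hx). Qed.

Lemma smooth_periodic_trig n p q : smooth_periodic L (trig n p q).
Proof.
split=> [x|m x]; first exact: trig_period.
have [p' [q' ->]] : exists p' q', ((trig n p q)^`(m))%classic = trig n p' q'.
  elim: m => [|m [p' [q' IH]]]; first by exists p, q.
  by rewrite derive1nS IH derive1_trig; eexists; eexists; reflexivity.
by have [] := is_derive_trig n p' q' x.
Qed.

Lemma mean_trigM (m : nat) p q (f : R -> R) : continuous f ->
  mean (fun x => f x * trig m p q x) =
  \sum_(k <- zs m) (p k * ccoef xL xR f k + q k * scoef xL xR f k).
Proof.
move=> cf.
have cc k : continuous (fun x => p k * (f x * cosk k x)).
  by apply: continuous_scale; exact: continuousMcosk.
have cs k : continuous (fun x => q k * (f x * sink k x)).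
  by apply: continuous_scale; exact: continuousMsink.
have c k : continuous (fun x => p k * (f x * cosk k x) + q k * (f x * sink k x)).
  exact: (continuous_add (cc k) (cs k)).
have -> : (fun x => f x * trig m p q x) =
   (fun x => \sum_(k <- zs m) (p k * (f x * cosk k x) + q k * (f x * sink k x))).
  apply/funext => x; rewrite /trig mulr_sumr; apply: eq_bigr => k _.
  by rewrite mulrDr; congr (_ + _); ring.
have [_ ->] := mean_sum hx (zs m) c.
apply: eq_bigr => k _; rewrite meanD// !meanZ//; first exact: continuousMsink.
exact: continuousMcosk.
Qed.

(** The frequencies [k] and [- k] both contribute half of the coefficient,
    hence the parity assumption. *)
Lemma ccoef_trig (m : nat) p q k : (forall k : int, p (- k) = p k) ->
  ccoef xL xR (trig m p q) k = if (`|k| <= m)%N then p k else 0.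
Proof.
move=> pN; rewrite /ccoef.
have -> : (fun x => trig m p q x * cosk k x) = (fun x => cosk k x * trig m p q x).
  by apply/funext => x; rewrite mulrC.
rewrite mean_trigM; last exact: continuous_cosk.
have h (j : int) : p j * ccoef xL xR (cosk k) j + q j * scoef xL xR (cosk k) j =
   (if j == k then 2^-1 * p j else 0) + (if j == - k then 2^-1 * p j else 0).
  rewrite /ccoef /scoef.
  have -> : (fun x => cosk k x * cosk j x) = (fun x => 2^-1 * cosk (k + j) x + 2^-1 * cosk (k - j) x).
    by apply/funext => x; rewrite coskMcosk.
  have -> : (fun x => cosk k x * sink j x) = (fun x => 2^-1 * sink (j + k) x + 2^-1 * sink (j - k) x).
    by apply/funext => x; rewrite mulrC sinkMcosk.
  rewrite !meanD ?meanZ ?mean_cosk ?mean_sink//; try exact: continuous_cosk;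
    try exact: continuous_sink; try exact: (continuous_scale (@continuous_cosk _ _ _ _));
    try exact: (continuous_scale (@continuous_sink _ _ _ _)).
  have -> : (k + j == 0) = (j == - k) by rewrite addrC addr_eq0.
  have -> : (k - j == 0) = (j == k) by rewrite subr_eq0 eq_sym.
  by do 2 case: ifP => _; rewrite ?mulr1n ?mulr0n; ring.
under eq_bigr do rewrite h.
rewrite big_split/=; case: ifP => km.
  rewrite !(sum_zs_pick (fun k => 2^-1 * p k))//; last lia.
  by rewrite pN; field.
rewrite !big_seq !big1 ?addr0// => j; rewrite mem_zs => jm; case: eqP => // jk; lia.
Qed.

Lemma scoef_trig (m : nat) p q k : (forall k : int, q (- k) = - q k) ->
  scoef xL xR (trig m p q) k = if (`|k| <= m)%N then q k else 0.
Proof.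
move=> qN; rewrite /scoef.
have -> : (fun x => trig m p q x * sink k x) = (fun x => sink k x * trig m p q x).
  by apply/funext => x; rewrite mulrC.
rewrite mean_trigM; last exact: continuous_sink.
have h (j : int) : p j * ccoef xL xR (sink k) j + q j * scoef xL xR (sink k) j =
   (if j == k then 2^-1 * q j else 0) + (if j == - k then - 2^-1 * q j else 0).
  rewrite /ccoef /scoef.
  have -> : (fun x => sink k x * cosk j x) = (fun x => 2^-1 * sink (k + j) x + 2^-1 * sink (k - j) x).
    by apply/funext => x; rewrite sinkMcosk.
  have -> : (fun x => sink k x * sink j x) = (fun x => 2^-1 * cosk (k - j) x - 2^-1 * cosk (k + j) x).
    by apply/funext => x; rewrite sinkMsink.
  rewrite meanD ?meanB ?meanZ ?mean_cosk ?mean_sink//; try exact: continuous_cosk;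
    try exact: continuous_sink; try exact: (continuous_scale (@continuous_cosk _ _ _ _));
    try exact: (continuous_scale (@continuous_sink _ _ _ _)).
  have -> : (k + j == 0) = (j == - k) by rewrite addrC addr_eq0.
  have -> : (k - j == 0) = (j == k) by rewrite subr_eq0 eq_sym.
  by do 2 case: ifP => _; rewrite ?mulr1n ?mulr0n; ring.
under eq_bigr do rewrite h.
rewrite big_split/=; case: ifP => km.
  rewrite (sum_zs_pick (fun k => 2^-1 * q k))// (sum_zs_pick (fun k => - 2^-1 * q k))//; last lia.
  by rewrite qN; field.
rewrite !big_seq !big1 ?addr0// => j; rewrite mem_zs => jm; case: eqP => // jk; lia.
Qed.

(** ** Quadrature on the grid *)

Variables (N n : nat).
Hypotheses (hN : N = n.*2) (hn : (0 < n)%N).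

Local Notation xg := (grid xL xR N).

Lemma natr_N_neq0 : N%:R != 0 :> R.
Proof. by rewrite pnatr_eq0 -lt0n hN double_gt0. Qed.

Lemma natr_N_gt0 : 0 < N%:R :> R.
Proof. by rewrite ltr0n hN double_gt0. Qed.

Lemma phase_grid (k : int) (j : nat) :
  k%:~R * mu * xg j = k%:~R * mu * xL + j%:R * (k%:~R * (pi *+ 2 / N%:R)).
Proof.
rewrite /grid mulrDr -(wavenumber_period hx); congr (_ + _).
by have := natr_N_neq0 => ?; field.
Qed.

Definition gmean (f : R -> R) : R := N%:R^-1 * \sum_(j < N) f (xg j).

Lemma gmean_cos (k : int) th : (`|k| < N)%N ->
  gmean (fun x => cos (k%:~R * mu * x + th)) = if k == 0 then cos th else 0.
Proof.
move=> kN; rewrite /gmean; case: eqVneq => [->|k0].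
  under eq_bigr do rewrite !mul0r add0r.
  by rewrite sumr_const card_ord -[cos th *+ _]mulr_natr mulrCA mulVf ?mulr1 ?natr_N_neq0.
under eq_bigr do rewrite phase_grid addrAC.
rewrite -(big_mkord xpredT (fun j => cos (k%:~R * mu * xL + th + j%:R * (k%:~R * (pi *+ 2 / N%:R))))).
by rewrite sum_cos_root ?mulr0//; lia.
Qed.

(** The trapezoidal quadrature is exact below frequency [N]: a nonzero
    frequency is then not a multiple of [N], and the roots of unity sum to
    zero. *)
Lemma gmean_trigdeg d f : (d < N)%N -> trigdeg d f -> gmean f = mean f.
Proof.
move=> dN; elim => [|c k th g kd tg IH].
  by rewrite mean_cst// /gmean big1// mulr0.
rewrite meanD//; last 2 first.
- move=> x; apply: continuousM; first exact: cst_continuous.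
  exact: continuous_cos_lin.
- exact: continuous_trigdeg tg.
rewrite -IH meanZ//; last exact: continuous_cos_lin.
rewrite mean_cos// -(@gmean_cos k th); last lia.
by rewrite /gmean big_split mulrDr -mulr_sumr mulrCA.
Qed.

End TrigPolynomials.

(** * Grid vectors and the differentiation matrices *)

Section GridVectors.
Variables (R : realType) (xL xR : R).
Hypothesis hx : xL < xR.
Variables (N n : nat).
Hypotheses (hN : N = n.*2) (hn : (0 < n)%N).

Local Notation mu := (wavenumber xL xR).
Local Notation cosk := (cosk xL xR).
Local Notation sink := (sink xL xR).
Local Notation trig := (trig xL xR).
Local Notation trigdeg := (trigdeg xL xR).
Local Notation xg := (grid xL xR N).
Local Notation gmean := (gmean xL xR N).
Local Notation D1 := (fourier_diff xL xR N 1).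
Local Notation D2 := (fourier_diff xL xR N 2).
Implicit Types (U V W : 'cV[R]_N).

Definition gvec (f : R -> R) : 'cV[R]_N := \col_(j < N) f (xg j).
Definition dot U V : R := N%:R^-1 * \sum_(j < N) U j 0 * V j 0.
Definition gcos U (k : int) : R := N%:R^-1 * \sum_(j < N) U j 0 * cosk k (xg j).
Definition gsin U (k : int) : R := N%:R^-1 * \sum_(j < N) U j 0 * sink k (xg j).
(** The weights one half at the two frequencies [N / 2] and [- N / 2], which
    are indistinguishable on the grid. *)
Definition cw (k : int) : R := (nyquist_weight R N k)^-1.

Lemma half_N : N./2 = n.
Proof. by rewrite hN doubleK. Qed.

Lemma cw_gt0 k : 0 < cw k.
Proof. by rewrite /cw /nyquist_weight invr_gt0; case: ifP; lra. Qed.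

Lemma cw_ge0 k : 0 <= cw k. Proof. exact: ltW (cw_gt0 k). Qed.

Lemma cw_le1 k : cw k <= 1.
Proof.
rewrite /cw /nyquist_weight; case: ifP => _; last by rewrite invr1.
by rewrite invf_le1; lra.
Qed.

Lemma cw_eq1 k : (`|k| < n)%N -> cw k = 1.
Proof.
rewrite /cw /nyquist_weight half_N => kn; case: eqP => [kE|_]; last by rewrite invr1.
by rewrite kE ltnn in kn.
Qed.

Lemma cwN (k : int) : cw (- k) = cw k.
Proof. by rewrite /cw /nyquist_weight abszN. Qed.

Lemma gcosN U (k : int) : gcos U (- k) = gcos U k.
Proof. by congr (_ * _); apply: eq_bigr => j _; rewrite coskN. Qed.

Lemma gsinN U (k : int) : gsin U (- k) = - gsin U k.
Proof.
rewrite /gsin -mulrN -sumrN; congr (_ * _); apply: eq_bigr => j _.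
by rewrite sinkN mulrN.
Qed.

Lemma dotC U V : dot U V = dot V U.
Proof. by congr (_ * _); apply: eq_bigr => j _; rewrite mulrC. Qed.

Lemma dotDl U V W : dot (U + V) W = dot U W + dot V W.
Proof.
rewrite /dot -mulrDr -big_split/=; congr (_ * _); apply: eq_bigr => j _.
by rewrite mxE mulrDl.
Qed.

Lemma dotZl c U V : dot (c *: U) V = c * dot U V.
Proof.
rewrite /dot [RHS]mulrCA [in RHS]mulr_sumr; congr (_ * _); apply: eq_bigr => j _.
by rewrite mxE mulrA.
Qed.

Lemma dotDr U V W : dot U (V + W) = dot U V + dot U W.
Proof. by rewrite dotC dotDl !(dotC _ U). Qed.

Lemma dotZr c U V : dot U (c *: V) = c * dot U V.
Proof. by rewrite dotC dotZl dotC. Qed.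

Lemma dotNr U V : dot U (- V) = - dot U V.
Proof. by rewrite -scaleN1r dotZr mulN1r. Qed.

Lemma dotBr U V W : dot U (V - W) = dot U V - dot U W.
Proof. by rewrite dotDr dotNr. Qed.

Lemma dotNl U V : dot (- U) V = - dot U V.
Proof. by rewrite dotC dotNr dotC. Qed.

Lemma dotBl U V W : dot (U - V) W = dot U W - dot V W.
Proof. by rewrite dotDl dotNl. Qed.

Lemma dot0r U : dot U 0 = 0.
Proof. by rewrite -(scale0r 0) dotZr mul0r. Qed.

Lemma gcosD U V k : gcos (U + V) k = gcos U k + gcos V k.
Proof.
rewrite /gcos -mulrDr -big_split/=; congr (_ * _); apply: eq_bigr => j _.
by rewrite mxE mulrDl.
Qed.

Lemma gsinD U V k : gsin (U + V) k = gsin U k + gsin V k.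
Proof.
rewrite /gsin -mulrDr -big_split/=; congr (_ * _); apply: eq_bigr => j _.
by rewrite mxE mulrDl.
Qed.

Lemma gcosZ c U k : gcos (c *: U) k = c * gcos U k.
Proof.
rewrite /gcos [RHS]mulrCA [in RHS]mulr_sumr; congr (_ * _); apply: eq_bigr => j _.
by rewrite mxE mulrA.
Qed.

Lemma gsinZ c U k : gsin (c *: U) k = c * gsin U k.
Proof.
rewrite /gsin [RHS]mulrCA [in RHS]mulr_sumr; congr (_ * _); apply: eq_bigr => j _.
by rewrite mxE mulrA.
Qed.

Lemma dot_ge0 U : 0 <= dot U U.
Proof.
rewrite /dot mulr_ge0 ?invr_ge0 ?ler0n//; apply: sumr_ge0 => j _.
by rewrite -expr2 sqr_ge0.
Qed.

Lemma dot_gvec_trig U m p q :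
  dot U (gvec (trig m p q)) = \sum_(k <- zs m) (p k * gcos U k + q k * gsin U k).
Proof.
rewrite /dot; under eq_bigr do rewrite mxE /trig mulr_sumr.
rewrite exchange_big/= mulr_sumr; apply: eq_bigr => k _.
rewrite /gcos /gsin [p k * _]mulrCA [q k * _]mulrCA -mulrDr; congr (_ * _).
rewrite !mulr_sumr -big_split/=; apply: eq_bigr => j _.
by ring.
Qed.

(** ** The cardinal functions *)

(** The real form of the cardinal functions, from which the differentiation
    matrices become explicit Fourier multipliers. *)
Lemma Re_trig_cardinal l :
  (fun x => complex.Re (trig_cardinal xL xR N l x)) =
  trig n (fun k => cw k * (N%:R^-1 * cosk k (xg l)))
         (fun k => cw k * (N%:R^-1 * sink k (xg l))).
Proof.
have ReM (c : R) (z : R[i]) : complex.Re (c%:C * z)%C = c * complex.Re z.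
  by case: z => p q /=; rewrite mul0r subr0.
have ReD (y z : R[i]) : complex.Re (y + z) = complex.Re y + complex.Re z.
  by case: y z => [? ?] [? ?].
apply/funext => x; rewrite /trig_cardinal ReM (big_morph _ ReD (erefl : complex.Re 0 = 0)).
rewrite /trig sum_zs_nat mulr_sumr half_N -hN.
apply: eq_bigr => m _; rewrite ReM /expi/= -/(cw _) cosk_sub.
by ring.
Qed.

Definition interp U : R -> R :=
  trig n (fun k => cw k * gcos U k) (fun k => cw k * gsin U k).

Lemma mul_D1 U j : (D1 *m U) j 0 =
  trig n (fun k => cw k * (k%:~R * mu * gsin U k))
         (fun k => cw k * (- (k%:~R * mu * gcos U k))) (xg j).
Proof.
rewrite mxE; under eq_bigr do rewrite mxE derive1n1 Re_trig_cardinal derive1_trig.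
rewrite /trig; under eq_bigr do rewrite mulr_suml.
rewrite exchange_big/=; apply: eq_bigr => k _.
rewrite /gcos /gsin.
rewrite (eq_bigr (fun i : 'I_N => (cw k * (k%:~R * mu) * N%:R^-1 * cosk k (xg j)) * (U i 0 * sink k (xg i)) +
    (- (cw k * (k%:~R * mu) * N%:R^-1 * sink k (xg j))) * (U i 0 * cosk k (xg i)))).
  by rewrite big_split/= -!mulr_sumr; ring.
by move=> i _; ring.
Qed.

Lemma mul_D2 U j : (D2 *m U) j 0 =
  trig n (fun k => cw k * (- ((k%:~R * mu) ^+ 2 * gcos U k)))
         (fun k => cw k * (- ((k%:~R * mu) ^+ 2 * gsin U k))) (xg j).
Proof.
rewrite mxE; under eq_bigr do rewrite mxE Re_trig_cardinal derive2_trig.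
rewrite /trig; under eq_bigr do rewrite mulr_suml.
rewrite exchange_big/=; apply: eq_bigr => k _.
rewrite /gcos /gsin.
rewrite (eq_bigr (fun i : 'I_N => (- (cw k * (k%:~R * mu) ^+ 2 * N%:R^-1 * cosk k (xg j))) * (U i 0 * cosk k (xg i)) +
    (- (cw k * (k%:~R * mu) ^+ 2 * N%:R^-1 * sink k (xg j))) * (U i 0 * sink k (xg i)))).
  by rewrite big_split/= -!mulr_sumr; ring.
by move=> i _; ring.
Qed.

(** The weight one half at both end frequencies turns the symmetric sum into a
    sum over one full period of frequencies. *)
Lemma sum_cw (F : int -> R) : F (- n%:Z) = F n%:Z ->
  \sum_(k <- zs n) cw k * F k = \sum_(0 <= m < N) F (m%:Z - n%:Z).
Proof.
case: n hN hn => [//|p] hNp _ Fn.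
have cw1 (k : int) : (`|k| <= p)%N -> cw k = 1.
  by move=> kp; rewrite /cw /nyquist_weight hNp doubleK; case: eqP => [|_]; rewrite ?invr1//; lia.
have cwp (k : int) : `|k|%N = p.+1 -> cw k = 2^-1.
  by move=> kp; rewrite /cw /nyquist_weight hNp doubleK kp eqxx.
rewrite sum_zsS !cwp ?abszN// Fn.
rewrite hNp doubleS big_nat_recl//= sub0r Fn.
rewrite (_ : \sum_(k <- zs p) _ = \sum_(0 <= i < p.*2.+1) F (i.+1%:Z - p.+1%:Z)).
  by field.
rewrite big_seq (eq_bigr (fun k => F k)); last first.
  by move=> k; rewrite mem_zs => /cw1 ->; rewrite mul1r.
rewrite -big_seq sum_zs_nat; apply: eq_bigr => i _; congr F; lia.
Qed.

(** Orthogonality in the dual variable: any [N] consecutive frequencies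
    separate the grid points. The free offset [k0] is what aliasing needs. *)
Lemma sum_cos_grid_delta (j l : 'I_N) (k0 : int) :
  \sum_(0 <= m < N) cos ((m%:Z + k0)%:~R * mu * (xg j - xg l)) = if j == l then N%:R else 0.
Proof.
case: eqVneq => [->|jl].
  under eq_bigr do rewrite subrr mulr0 cos0.
  by rewrite big_const_nat subn0 iter_addr_0.
have N0 := natr_N_neq0 R hN hn.
have e (m : nat) : (m%:Z + k0)%:~R * mu * (xg j - xg l) =
    k0%:~R * ((j%:Z - l%:Z)%:~R * (pi *+ 2 / N%:R)) + m%:R * ((j%:Z - l%:Z)%:~R * (pi *+ 2 / N%:R)).
  have L0 := period_neq0 hx.
  by rewrite /grid /wavenumber intrD intrB -!pmulrn; field; rewrite N0 L0.
under eq_bigr do rewrite e.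
rewrite sum_cos_root//; have := ltn_ord j; have := ltn_ord l.
move: jl; rewrite -val_eqE/=; lia.
Qed.

Lemma sum_cw_delta (j l : 'I_N) :
  \sum_(k <- zs n) cw k * cos (k%:~R * mu * (xg j - xg l)) = if j == l then N%:R else 0.
Proof.
rewrite sum_cw; last by rewrite mulrNz !mulNr cosN.
by rewrite (sum_cos_grid_delta j l (- n%:Z)).
Qed.

Lemma interp_grid U (j : 'I_N) : interp U (xg j) = U j 0.
Proof.
have N0 := natr_N_neq0 R hN hn.
rewrite /interp /trig /gcos /gsin.
transitivity (\sum_(l < N) U l 0 * (N%:R^-1 *
    \sum_(k <- zs n) cw k * cos (k%:~R * mu * (xg j - xg l)))).
  under [RHS]eq_bigr do rewrite mulr_sumr mulr_sumr.
  rewrite exchange_big/=; apply: eq_bigr => k _.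
  rewrite !mulr_sumr !mulr_suml -big_split/=; apply: eq_bigr => l _.
  by rewrite cosk_sub; ring.
rewrite (bigD1 j)//= sum_cw_delta eqxx mulVf// mulr1 big1 ?addr0// => l lj.
by rewrite sum_cw_delta eq_sym (negbTE lj) !mulr0.
Qed.

Lemma gvec_interp U : gvec (interp U) = U.
Proof. by apply/matrixP => j l; rewrite mxE interp_grid (ord1 l). Qed.

(** Pair [U] with the interpolant of [V], which takes the values [V] on the
    grid. *)
Lemma parseval U V :
  dot U V = \sum_(k <- zs n) cw k * (gcos U k * gcos V k + gsin U k * gsin V k).
Proof.
rewrite -{1}(gvec_interp V) dot_gvec_trig; apply: eq_bigr => k _; ring.
Qed.

Lemma dot_D1 U V : dot U (D1 *m V) =
  \sum_(k <- zs n) cw k * (k%:~R * mu * (gcos U k * gsin V k - gsin U k * gcos V k)).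
Proof.
have -> : D1 *m V = gvec (trig n (fun k => cw k * (k%:~R * mu * gsin V k))
         (fun k => cw k * (- (k%:~R * mu * gcos V k)))).
  by apply/matrixP => j l; rewrite (ord1 l) mul_D1 mxE.
rewrite dot_gvec_trig; apply: eq_bigr => k _; ring.
Qed.

Lemma dot_D2 U V : dot U (D2 *m V) =
  - \sum_(k <- zs n) cw k * ((k%:~R * mu) ^+ 2 * (gcos U k * gcos V k + gsin U k * gsin V k)).
Proof.
have -> : D2 *m V = gvec (trig n (fun k => cw k * (- ((k%:~R * mu) ^+ 2 * gcos V k)))
         (fun k => cw k * (- ((k%:~R * mu) ^+ 2 * gsin V k)))).
  by apply/matrixP => j l; rewrite (ord1 l) mul_D2 mxE.
rewrite dot_gvec_trig -sumrN; apply: eq_bigr => k _; ring.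
Qed.

(** The Fourier multiplier of the first derivative is odd, so the discrete
    integration by parts has no boundary term. *)
Lemma dot_D1_skew U V : dot (D1 *m U) V = - dot U (D1 *m V).
Proof.
rewrite dotC !dot_D1 -sumrN; apply: eq_bigr => k _; ring.
Qed.

(** Below the Nyquist frequency no two frequencies are confused on the grid,
    so interpolation reproduces the polynomial. *)
Lemma interp_trigdeg d f : (d < n)%N -> trigdeg d f -> interp (gvec f) = f.
Proof.
move=> dn; elim => [|c k th g kd tg IH]; apply/funext => x.
  rewrite /interp /trig big1// => k _.
  rewrite /gcos /gsin !big1; last 2 first.
  - by move=> j _; rewrite mxE mul0r.
  - by move=> j _; rewrite mxE mul0r.
  by rewrite !(mulr0, mul0r) addr0.
have -> : gvec (fun x => c * cos (k%:~R * mu * x + th) + g x) =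
    c *: gvec (fun x => cos (k%:~R * mu * x + th)) + gvec g.
  by apply/matrixP => j l; rewrite !mxE.
rewrite -{2}IH.
have lin : interp (c *: gvec (fun x => cos (k%:~R * mu * x + th)) + gvec g) x =
   c * interp (gvec (fun x => cos (k%:~R * mu * x + th))) x + interp (gvec g) x.
  rewrite /interp /trig mulr_sumr -big_split/=; apply: eq_bigr => j _.
  by rewrite gcosD gsinD gcosZ gsinZ; ring.
rewrite lin; congr (_ * _ + _).
set f0 := fun x => cos _.
have gc (j : int) : (`|j| <= n)%N -> gcos (gvec f0) j =
    (if j == k then 2^-1 * cos th else 0) + (if j == - k then 2^-1 * cos th else 0).
  move=> jn; rewrite /gcos.
  have -> : N%:R^-1 * \sum_(i < N) gvec f0 i 0 * cosk j (xg i) =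
     2^-1 * gmean (fun x => cos ((k + j)%:~R * mu * x + th)) +
     2^-1 * gmean (fun x => cos ((k - j)%:~R * mu * x + th)).
    rewrite /gmean !(mulrCA 2^-1) -mulrDr; congr (_ * _).
    rewrite !mulr_sumr -big_split/=; apply: eq_bigr => i _.
    rewrite mxE /f0 coskE cosMcos; congr (_ * cos _ + _ * cos _).
      by rewrite intrD; ring.
    by rewrite intrB; ring.
  rewrite !(gmean_cos hx hN hn); try lia.
  have -> : (k + j == 0) = (j == - k) by rewrite addrC addr_eq0.
  have -> : (k - j == 0) = (j == k) by rewrite subr_eq0 eq_sym.
  by do 2 case: ifP => _; ring.
have gs (j : int) : (`|j| <= n)%N -> gsin (gvec f0) j =
    (if j == k then - 2^-1 * sin th else 0) + (if j == - k then 2^-1 * sin th else 0).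
  move=> jn; rewrite /gsin.
  have -> : N%:R^-1 * \sum_(i < N) gvec f0 i 0 * sink j (xg i) =
     2^-1 * gmean (fun x => cos ((k + j)%:~R * mu * x + (th - pi / 2))) +
     2^-1 * gmean (fun x => cos ((k - j)%:~R * mu * x + (th + pi / 2))).
    rewrite /gmean !(mulrCA 2^-1) -mulrDr; congr (_ * _).
    rewrite !mulr_sumr -big_split/=; apply: eq_bigr => i _.
    rewrite mxE /f0 sinkE cosMcos; congr (_ * cos _ + _ * cos _).
      by rewrite intrD; ring.
    by rewrite intrB; ring.
  rewrite !(gmean_cos hx hN hn); try lia.
  have -> : (k + j == 0) = (j == - k) by rewrite addrC addr_eq0.
  have -> : (k - j == 0) = (j == k) by rewrite subr_eq0 eq_sym.
  by rewrite cosBpihalf cosDpihalf; do 2 case: ifP => _; ring.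
rewrite /interp /trig big_seq.
rewrite (eq_bigr (fun j =>
   (if j == k then cw j * (2^-1 * cos th * cosk j x - 2^-1 * sin th * sink j x) else 0) +
   (if j == - k then cw j * (2^-1 * cos th * cosk j x + 2^-1 * sin th * sink j x) else 0))).
  rewrite -big_seq big_split/=.
  rewrite (sum_zs_pick (fun j => cw j * (2^-1 * cos th * cosk j x - 2^-1 * sin th * sink j x))); last lia.
  rewrite (sum_zs_pick (fun j => cw j * (2^-1 * cos th * cosk j x + 2^-1 * sin th * sink j x))); last lia.
  rewrite cwN coskN sinkN cw_eq1; last lia.
  by rewrite /f0 cosD -/(cosk k x) -/(sink k x); field.
move=> j; rewrite mem_zs => jn; rewrite gc// gs//.
by do 2 case: ifP => _; ring.
Qed.

(** Spectral differentiation is exact on the polynomials that interpolation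
    reproduces. *)
Lemma D1_gvec d f df : (d < n)%N -> trigdeg d f ->
  (forall x : R, is_derive x 1 f (df x)) -> D1 *m gvec f = gvec df.
Proof.
move=> dn tf f'; apply/matrixP => j l; rewrite (ord1 l) mul_D1 mxE.
have E := interp_trigdeg dn tf.
have h1 := f' (xg j); rewrite -{1}E in h1.
have h2 := is_derive_trig xL xR n (fun k => cw k * gcos (gvec f) k) (fun k => cw k * gsin (gvec f) k) (xg j).
have := @derive_val _ _ _ _ _ _ _ h1; have := @derive_val _ _ _ _ _ _ _ h2.
rewrite -/(interp (gvec f)) => -> <-.
by apply: eq_bigr => k _; congr (_ * _ + _ * _); ring.
Qed.

End GridVectors.

(** * Aliasing *)

Section Aliasing.
Variables (R : realType) (xL xR : R).
Hypothesis hx : xL < xR.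
Variables (N n : nat).
Hypotheses (hN : N = n.*2) (hn : (0 < n)%N).

Local Notation mu := (wavenumber xL xR).
Local Notation xg := (grid xL xR N).
Local Notation gcos := (gcos xL xR).
Local Notation gsin := (gsin xL xR).
Implicit Types (U : 'cV[R]_N).

(** Parseval over one period: a block of [N] consecutive frequencies carries
    the whole mass of [U], wherever the block starts. *)
Lemma gsq_block U (k0 : int) :
  \sum_(0 <= m < N) (gcos U (m%:Z + k0) ^+ 2 + gsin U (m%:Z + k0) ^+ 2) = dot U U.
Proof.
have N0 := natr_N_neq0 R hN hn.
have e (k : int) : gcos U k ^+ 2 + gsin U k ^+ 2 = N%:R^-1 ^+ 2 *
    \sum_(j < N) \sum_(l < N) U j 0 * U l 0 * cos (k%:~R * mu * (xg j - xg l)).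
  rewrite /gcos /gsin !exprMn -mulrDr; congr (_ * _).
  rewrite !expr2 !mulr_suml -big_split/=; apply: eq_bigr => j _.
  rewrite !mulr_sumr -big_split/=; apply: eq_bigr => l _.
  by rewrite cosk_sub; ring.
under eq_bigr do rewrite e.
rewrite -mulr_sumr exchange_big/=.
rewrite (eq_bigr (fun j => N%:R * (U j 0 * U j 0))) ?/dot.
  by rewrite -mulr_sumr; field.
move=> j _; rewrite exchange_big/= (bigD1 j)//= -mulr_sumr (sum_cos_grid_delta hx hN hn) eqxx.
rewrite big1 ?addr0; first by rewrite mulrC.
by move=> l lj; rewrite -mulr_sumr (sum_cos_grid_delta hx hN hn) eq_sym (negbTE lj) mulr0.
Qed.

(** Each block of [N] consecutive frequencies carries the mass of [U] once,
    and on the block number [i], counted from zero, the denominator is of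
    order [(mu * N * (i + 1)) ^ 2]. The sum over the blocks converges, and the
    two powers of [N] are gained because the sum starts at a frequency
    comparable to [N]. *)
Lemma aliasing_le U (M n' : nat) : (N <= 4 * M.+1)%N ->
  \sum_(k <- zs n') (if (M < `|k|)%N then
     (gcos U k ^+ 2 + gsin U k ^+ 2) / (1 + (k%:~R * mu) ^+ 2) else 0)
  <= 100 / (mu * N%:R) ^+ 2 * dot U U.
Proof.
move=> NM.
have m0 := wavenumber_gt0 hx.
have N0 := natr_N_gt0 R hN hn.
pose D (k : int) := gcos U k ^+ 2 + gsin U k ^+ 2.
have D0 k : 0 <= D k by rewrite addr_ge0 ?sqr_ge0.
pose G (k : int) := if (M < `|k|)%N then D k / (1 + (k%:~R * mu) ^+ 2) else 0.
have GN k : G (- k) = G k.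
  by rewrite /G /D abszN gcosN gsinN mulrNz mulNr !sqrrN.
rewrite -/(G _).
have -> : \sum_(k <- zs n') G k = 2 * \sum_(0 <= m < n') G m.+1%:Z.
  elim: n' => [|p IH]; first by rewrite sum_zs0 big_geq// mulr0.
  by rewrite sum_zsS big_nat_recr//= IH GN; ring.
(* Since [N <= 4 * m], the frequency [m] is at least a fifth of [N + m],
   which puts the first block away from zero. *)
have GH (m : nat) : G m%:Z <= 25 / mu ^+ 2 * (D m%:Z / (N + m)%:R ^+ 2).
  rewrite /G; case: ifP => mM; last first.
    by rewrite mulr_ge0 ?divr_ge0 ?exprn_ge0 ?ler0n// ltW.
  rewrite [leRHS]mulrCA ler_wpM2l//.
  have mp : (0 < m)%N by lia.
  have mR : 0 < m%:R :> R by rewrite ltr0n.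
  have h5 : (N + m)%:R <= 5 * m%:R :> R by rewrite -natrM ler_nat; lia.
  have Nm : 0 < (N + m)%:R :> R by rewrite ltr0n; lia.
  rewrite -pmulrn -[leRHS]invrK lef_pV2 ?posrE ?invr_gt0 ?mulr_gt0 ?invr_gt0 ?exprn_gt0//; last first.
    by rewrite addr_gt0// exprn_gt0// mulr_gt0.
  apply: (@le_trans _ _ ((m%:R * mu) ^+ 2)); last by rewrite lerDr.
  rewrite !invfM !invrK exprMn.
  rewrite (_ : 25^-1 * mu ^+ 2 * _ = mu ^+ 2 * ((N + m)%:R ^+ 2 / 25)); last by ring.
  rewrite [leRHS]mulrC ler_wpM2l ?sqr_ge0// ler_pdivrMr//.
  rewrite (_ : m%:R ^+ 2 * 25 = (5 * m%:R) ^+ 2); last by ring.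
  by rewrite lerXn2r ?nnegrE// ltW// mulr_gt0.
(* In block number [i] the shifted frequency [N + m] is at least [N * (i +
   1)]. *)
have blocks q : \sum_(0 <= m < q * N) D m%:Z / (N + m)%:R ^+ 2 <=
    dot U U / N%:R ^+ 2 * \sum_(0 <= i < q) (i.+1%:R ^+ 2)^-1.
  elim: q => [|q IH]; first by rewrite mul0n !big_geq// mulr0.
  rewrite (@big_cat_nat _ _ _ (q * N)) ?leq_mul//=.
  rewrite big_nat_recr//= mulrDr lerD//.
  rewrite -{1}[(q * N)%N]add0n big_addn (_ : (q.+1 * N - q * N = N)%N); last lia.
  apply: (@le_trans _ _ (\sum_(0 <= m < N) D (m%:Z + (q * N)%N%:Z) / (N * q.+1)%:R ^+ 2)).
    apply: ler_sum => m _; rewrite -PoszD ler_wpM2l//.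
    rewrite lef_pV2 ?posrE ?exprn_gt0 ?ltr0n ?lerXn2r ?nnegrE ?ler0n ?ler_nat//; lia.
  rewrite -mulr_suml gsq_block natrM exprMn invfM mulrA//.
have sub : \sum_(0 <= m < n') G m.+1%:Z <= \sum_(0 <= m < n'.+1 * N) 25 / mu ^+ 2 * (D m%:Z / (N + m)%:R ^+ 2).
  apply: (@le_trans _ _ (\sum_(0 <= m < n'.+1) 25 / mu ^+ 2 * (D m%:Z / (N + m)%:R ^+ 2))).
    rewrite big_nat_recl//= -[leLHS]add0r lerD//.
      by rewrite mulr_ge0 ?divr_ge0 ?sqr_ge0 ?exprn_ge0 ?ler0n.
    by apply: ler_sum => m _; exact: GH.
  rewrite (@big_cat_nat _ _ _ n'.+1 0 (n'.+1 * N))//=; last by rewrite leq_pmulr//; lia.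
  by rewrite lerDl; apply: sumr_ge0 => m _; rewrite mulr_ge0 ?divr_ge0 ?sqr_ge0 ?exprn_ge0 ?ler0n.
rewrite -mulr_sumr in sub.
have S2 : \sum_(0 <= m < n'.+1 * N) D m%:Z / (N + m)%:R ^+ 2 <= 2 * (dot U U / N%:R ^+ 2).
  rewrite (le_trans (blocks _))// mulrC ler_wpM2r ?sum_inv_sqr_le//.
  by rewrite divr_ge0 ?dot_ge0 ?exprn_ge0 ?ler0n.
have c0 : 0 <= 25 / mu ^+ 2 by rewrite divr_ge0// sqr_ge0.
have := ler_wpM2l c0 S2.
move=> h; have h1 := le_trans sub h.
apply: (le_trans (ler_wpM2l (ler0n R 2) h1)).
apply: eq_ler.
have m1 : mu != 0 by rewrite gt_eqF.
by move: mu m1 => m m1; field; rewrite m1 (natr_N_neq0 R hN hn).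
Qed.

End Aliasing.

(** * The discrete energy norm *)

Section EnergyNorm.
Variables (R : realType) (xL xR : R).
Hypothesis hx : xL < xR.
Variables (N n : nat).
Hypotheses (hN : N = n.*2) (hn : (0 < n)%N).
Variable sigma : R.
Hypothesis hs : 0 < sigma.

Local Notation mu := (wavenumber xL xR).
Local Notation cosk := (cosk xL xR).
Local Notation sink := (sink xL xR).
Local Notation xg := (grid xL xR N).
Local Notation D1 := (fourier_diff xL xR N 1).
Local Notation D2 := (fourier_diff xL xR N 2).
Local Notation gcos := (gcos xL xR).
Local Notation gsin := (gsin xL xR).
Local Notation cw := (cw R N).
Implicit Types (U V W : 'cV[R]_N).

(** Its quadratic form is the discrete counterpart of the energy of the
    equation, the mean of [v ^ 2 + sigma * v_x ^ 2]. *)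
Definition en_mx : 'M[R]_N := 1%:M - sigma *: D2.
Definition ip U V : R := dot U (en_mx *m V).
(** The Fourier multiplier of [en_mx]. *)
Definition ew (k : int) : R := 1 + sigma * (k%:~R * mu) ^+ 2.

Lemma ew_ge1 k : 1 <= ew k.
Proof. by rewrite /ew lerDl mulr_ge0 ?sqr_ge0// ltW. Qed.

Lemma ew_gt0 k : 0 < ew k.
Proof. exact: lt_le_trans ltr01 (ew_ge1 k). Qed.

Lemma ipE U V :
  ip U V = \sum_(k <- zs n) cw k * ew k * (gcos U k * gcos V k + gsin U k * gsin V k).
Proof.
rewrite /ip /en_mx mulmxBl mul1mx dotBr -scalemxAl dotZr.
rewrite (dot_D2 _ _ hN) (parseval hx hN hn) mulrN opprK mulr_sumr -big_split/=.
by apply: eq_bigr => k _; rewrite /ew; ring.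
Qed.

Lemma ipC U V : ip U V = ip V U.
Proof. by rewrite !ipE; apply: eq_bigr => k _; ring. Qed.

Lemma ipDl U V W : ip (U + V) W = ip U W + ip V W.
Proof. exact: dotDl. Qed.

Lemma ipZl c U V : ip (c *: U) V = c * ip U V.
Proof. exact: dotZl. Qed.

Lemma ipDr U V W : ip U (V + W) = ip U V + ip U W.
Proof. by rewrite ipC ipDl !(ipC _ U). Qed.

Lemma ipZr c U V : ip U (c *: V) = c * ip U V.
Proof. by rewrite ipC ipZl ipC. Qed.

Lemma ipBr U V W : ip U (V - W) = ip U V - ip U W.
Proof. by rewrite ipDr -scaleN1r ipZr mulN1r. Qed.

Lemma ipBl U V W : ip (U - V) W = ip U W - ip V W.
Proof. by rewrite ipC ipBr !(ipC W). Qed.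

Lemma ip_ge0 U : 0 <= ip U U.
Proof.
rewrite ipE; apply: sumr_ge0 => k _.
apply: mulr_ge0; first by rewrite mulr_ge0 ?cw_ge0// ltW ?ew_gt0.
by rewrite -!expr2 addr_ge0 ?sqr_ge0.
Qed.

Definition nrm U : R := Num.sqrt (ip U U).
Definition l2 U : R := Num.sqrt (dot U U).

Lemma nrm_ge0 U : 0 <= nrm U. Proof. exact: sqrtr_ge0. Qed.
Lemma l2_ge0 U : 0 <= l2 U. Proof. exact: sqrtr_ge0. Qed.

Lemma nrm_sq U : nrm U ^+ 2 = ip U U.
Proof. by rewrite sqr_sqrtr ?ip_ge0. Qed.

Lemma l2_sq U : l2 U ^+ 2 = dot U U.
Proof. by rewrite sqr_sqrtr ?dot_ge0. Qed.

Lemma ler_of_sqr (x y : R) : 0 <= y -> x ^+ 2 <= y ^+ 2 -> `|x| <= y.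
Proof. by move=> y0 xy; rewrite -(ler_pXn2r (n := 2))// ?nnegrE// real_normK// num_real. Qed.

Lemma ip_cs U V : `|ip U V| <= nrm U * nrm V.
Proof.
apply: ler_of_sqr; first by rewrite mulr_ge0 ?nrm_ge0.
rewrite [in leRHS]exprMn !nrm_sq !ipE.
apply: (le_trans (cauchy_schwarz_sum _ _ _ _ _ _)).
  by move=> k; rewrite mulr_ge0 ?cw_ge0// ltW ?ew_gt0.
by under [in leRHS]eq_bigr do rewrite -!expr2.
Qed.

Lemma dot_cs U V : `|dot U V| <= l2 U * l2 V.
Proof.
apply: ler_of_sqr; first by rewrite mulr_ge0 ?l2_ge0.
rewrite [in leRHS]exprMn !l2_sq !(parseval hx hN hn).
apply: (le_trans (cauchy_schwarz_sum _ _ _ _ _ _)); first exact: cw_ge0.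
by under [in leRHS]eq_bigr do rewrite -!expr2.
Qed.

Lemma nrmZ c U : nrm (c *: U) = `|c| * nrm U.
Proof. by rewrite /nrm ipZl ipZr mulrA -expr2 sqrtrM ?sqr_ge0// sqrtr_sqr. Qed.

Lemma nrmN U : nrm (- U) = nrm U.
Proof. by rewrite -scaleN1r nrmZ normrN1 mul1r. Qed.

Lemma nrmD U V : nrm (U + V) <= nrm U + nrm V.
Proof.
rewrite -[leLHS]ger0_norm ?nrm_ge0//; apply: ler_of_sqr.
  by rewrite addr_ge0 ?nrm_ge0.
rewrite nrm_sq ipDl !ipDr (ipC V U) sqrrD !nrm_sq.
by have := ip_cs U V; have := ler_norm (ip U V); lra.
Qed.

Lemma nrmB U V : nrm (U - V) <= nrm U + nrm V.
Proof. by rewrite -(nrmN V) nrmD. Qed.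

(** Pair the vector with itself: residuals and truncation errors are only
    known as functionals, and this turns bounds on functionals into bounds in
    norm. *)
Lemma nrm_dual U c : 0 <= c -> (forall V, ip U V <= c * nrm V) -> nrm U <= c.
Proof.
move=> c0 /(_ U); rewrite -nrm_sq expr2 => h.
have [->//|U0] := eqVneq (nrm U) 0.
by move: h; rewrite ler_pM2r// lt_neqAle eq_sym U0 nrm_ge0.
Qed.

Lemma l2_le_nrm U : l2 U <= nrm U.
Proof.
rewrite ler_wsqrtr// ipE (parseval hx hN hn); apply: ler_sum => k _.
rewrite -[X in X <= _]mulr1 -[X in _ <= X]mulrAC ler_wpM2l ?ew_ge1//.
by rewrite -!expr2 mulr_ge0 ?cw_ge0 ?addr_ge0 ?sqr_ge0.
Qed.

(** Pair [D1 *m U] with itself and use Cauchy-Schwarz with the Nyquist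
    weights: the squared multiplier of the first derivative is that of minus
    the second. *)
Lemma l2_D1_le U : l2 (D1 *m U) <= Num.sqrt sigma^-1 * nrm U.
Proof.
set V := D1 *m U.
suff h : l2 V ^+ 2 <= Num.sqrt sigma^-1 * nrm U * l2 V.
  have [->|V0] := eqVneq (l2 V) 0; first by rewrite mulr_ge0 ?sqrtr_ge0 ?nrm_ge0.
  by move: h; rewrite expr2 ler_pM2r// lt_neqAle eq_sym V0 l2_ge0.
rewrite l2_sq {2}/V (dot_D1 _ _ hN); apply: (le_trans (ler_norm _)).
apply: ler_of_sqr; first by rewrite !mulr_ge0 ?sqrtr_ge0.
rewrite (_ : \sum_(k <- zs n) _ = \sum_(k <- zs n) cw k *
  (gcos V k * (k%:~R * mu * gsin U k) + gsin V k * (- (k%:~R * mu * gcos U k)))); last first.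
  by apply: eq_bigr => k _; ring.
apply: (le_trans (cauchy_schwarz_sum _ _ _ _ _ _)); first exact: cw_ge0.
rewrite !exprMn l2_sq (parseval hx hN hn) nrm_sq mulrC ler_wpM2r//.
  by apply: sumr_ge0 => k _; rewrite mulr_ge0 ?cw_ge0 ?addr_ge0 ?sqr_ge0.
rewrite sqr_sqrtr ?invr_ge0 ?(ltW hs)// ipE mulr_sumr; apply: ler_sum => k _.
rewrite /ew; move: (k%:~R * mu) (cw_ge0 R N k) => q c0.
move: (gcos U k) (gsin U k) => x y.
have s1 : sigma^-1 * sigma = 1 by rewrite mulVf// gt_eqF.
have -> : sigma^-1 * (cw k * (1 + sigma * q ^+ 2) * (x * x + y * y)) =
    sigma^-1 * (cw k * (x ^+ 2 + y ^+ 2)) +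
    sigma^-1 * sigma * (cw k * (q ^+ 2 * (x ^+ 2 + y ^+ 2))) by ring.
have : 0 <= sigma^-1 * (cw k * (x ^+ 2 + y ^+ 2)).
  by apply: mulr_ge0; [rewrite invr_ge0 ltW | apply: mulr_ge0 => //; rewrite addr_ge0 ?sqr_ge0].
by rewrite s1; lra.
Qed.

(** One constant, at least one, serves for the three embeddings of the energy
    norm: into the mean square of the values, into that of the derivative, and
    into the supremum. *)
Definition emb : R := 1 + Num.sqrt sigma^-1 + Num.sqrt ((1 + 4 / mu ^+ 2) * (1 + sigma^-1)).

Lemma emb_ge1 : 1 <= emb.
Proof. by rewrite /emb -addrA lerDl addr_ge0 ?sqrtr_ge0. Qed.

Lemma emb_ge0 : 0 <= emb.
Proof. exact: le_trans ler01 emb_ge1. Qed.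

Lemma l2_emb U : l2 U <= emb * nrm U.
Proof.
by rewrite (le_trans (l2_le_nrm U))// ler_peMl ?nrm_ge0 ?emb_ge1.
Qed.

Lemma l2_D1_emb U : l2 (D1 *m U) <= emb * nrm U.
Proof.
rewrite (le_trans (l2_D1_le U))// ler_wpM2r ?nrm_ge0// /emb.
have := sqrtr_ge0 ((1 + 4 / mu ^+ 2) * (1 + sigma^-1)); lra.
Qed.

(** The discrete Sobolev embedding in dimension one: write the value at a grid
    point as the Fourier sum of the interpolant and apply Cauchy-Schwarz with
    the weights of the energy norm. *)
Lemma sup_emb U j : `|U j 0| <= emb * nrm U.
Proof.
apply: (@le_trans _ _ (Num.sqrt ((1 + 4 / mu ^+ 2) * (1 + sigma^-1)) * nrm U)); last first.
  rewrite ler_wpM2r ?nrm_ge0// /emb.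
  by have := sqrtr_ge0 sigma^-1; lra.
have m0 := wavenumber_gt0 hx.
have W0 : 0 <= 1 + 4 / mu ^+ 2 by rewrite addr_ge0// divr_ge0// sqr_ge0.
have s0 : 0 <= 1 + sigma^-1 by rewrite addr_ge0// invr_ge0 ltW.
apply: ler_of_sqr; first by rewrite mulr_ge0 ?sqrtr_ge0.
rewrite exprMn nrm_sq sqr_sqrtr ?mulr_ge0//.
rewrite -(interp_grid hx hN hn) /interp /trig.
pose w k : R := 1 + (k%:~R * mu) ^+ 2.
have w0 k : 0 < w k.
  by rewrite /w (lt_le_trans ltr01)// lerDl sqr_ge0.
rewrite (_ : \sum_(k <- zs n) _ = \sum_(k <- zs n) (cw k * w k) *
  (gcos U k * (cosk k (xg j) / w k) + gsin U k * (sink k (xg j) / w k))); last first.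
  by apply: eq_bigr => k _; field; rewrite gt_eqF.
apply: (le_trans (cauchy_schwarz_sum _ _ _ _ _ _)).
  by move=> k; rewrite mulr_ge0 ?cw_ge0// ltW.
rewrite mulrC -mulrA; apply: ler_pM.
- by apply: sumr_ge0 => k _; rewrite !mulr_ge0 ?cw_ge0 ?addr_ge0 ?sqr_ge0// ltW.
- by apply: sumr_ge0 => k _; rewrite !mulr_ge0 ?cw_ge0 ?addr_ge0 ?sqr_ge0// ltW.
- apply: le_trans (sum_zs_inv_le n m0); apply: ler_sum => k _.
  rewrite -/(w k) !exprMn -mulrDl (cosk2Dsink2 xL xR) mul1r.
  have -> : cw k * w k * (w k)^-1 ^+ 2 = cw k / w k by field; rewrite gt_eqF.
  by rewrite ler_piMl ?invr_ge0 ?cw_le1// ltW.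
- rewrite ipE mulr_sumr; apply: ler_sum => k _.
  rewrite -!expr2 mulrA ler_wpM2r ?addr_ge0 ?sqr_ge0//.
  rewrite mulrCA ler_wpM2l ?cw_ge0// /w /ew.
  have q0 := sqr_ge0 (k%:~R * mu); set q := _ ^+ 2 in q0 *.
  have si : sigma^-1 * sigma = 1 by rewrite mulVf// gt_eqF.
  have : 0 <= sigma^-1 by rewrite invr_ge0 ltW.
  have := mulr_ge0 (ltW hs) q0.
  have -> : (1 + sigma^-1) * (1 + sigma * q) = 1 + sigma * q + sigma^-1 + (sigma^-1 * sigma) * q by ring.
  by rewrite si; lra.
Qed.

(** ** The trilinear form *)

Definition had U V : 'cV[R]_N := diag_mx U^T *m V.

Lemma hadE U V j : had U V j 0 = U j 0 * V j 0.
Proof. by rewrite /had mul_diag_mx !mxE. Qed.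

Lemma dot_had U V W : dot (had U V) W = dot V (had U W).
Proof. by congr (_ * _); apply: eq_bigr => j _; rewrite !hadE; ring. Qed.

Lemma l2_had U V : l2 (had U V) <= emb * nrm U * l2 V.
Proof.
have e0 : 0 <= emb * nrm U by rewrite mulr_ge0 ?emb_ge0 ?nrm_ge0.
rewrite -[leLHS]ger0_norm ?l2_ge0//; apply: ler_of_sqr.
  by rewrite mulr_ge0// l2_ge0.
rewrite exprMn !l2_sq /dot mulrCA ler_wpM2l ?invr_ge0 ?ler0n// mulr_sumr.
apply: ler_sum => j _; rewrite hadE -!expr2 exprMn ler_wpM2r ?sqr_ge0//.
by rewrite -[X in X <= _]real_normK ?num_real// lerXn2r ?nnegrE// sup_emb.
Qed.

(** Twice the skew-symmetric form of the transport term [u v_x]; the sum of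
    both products is what makes it conservative. *)
Definition bil U V : 'cV[R]_N := had U (D1 *m V) + D1 *m had U V.

Lemma DU_mul a gamma U V :
  DU xL xR a gamma U *m V = a *: (D1 *m V) + (gamma / 3) *: bil U V.
Proof.
by rewrite /DU mulmxDl -!scalemxAl mulmxDl /bil /had -!mulmxA.
Qed.

Lemma hadDl U V W : had (U + V) W = had U W + had V W.
Proof. by apply/matrixP => j l; rewrite (ord1 l) [RHS]mxE !hadE mxE mulrDl. Qed.
Lemma hadDr U V W : had U (V + W) = had U V + had U W.
Proof. by apply/matrixP => j l; rewrite (ord1 l) [RHS]mxE !hadE mxE mulrDr. Qed.
Lemma hadZl c V W : had (c *: V) W = c *: had V W.
Proof. by apply/matrixP => j l; rewrite (ord1 l) [RHS]mxE !hadE mxE mulrA. Qed.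
Lemma hadZr c V W : had V (c *: W) = c *: had V W.
Proof. by apply/matrixP => j l; rewrite (ord1 l) [RHS]mxE !hadE mxE mulrCA. Qed.

Lemma bilDl U V W : bil (U + V) W = bil U W + bil V W.
Proof. by rewrite /bil !hadDl mulmxDr addrACA. Qed.
Lemma bilDr U V W : bil U (V + W) = bil U V + bil U W.
Proof. by rewrite /bil mulmxDr !hadDr mulmxDr addrACA. Qed.
Lemma bilZl c V W : bil (c *: V) W = c *: bil V W.
Proof. by rewrite /bil !hadZl -scalemxAr scalerDr. Qed.
Lemma bilZr c V W : bil V (c *: W) = c *: bil V W.
Proof. by rewrite /bil -scalemxAr !hadZr -scalemxAr scalerDr. Qed.

Lemma dot_bil U V W : dot (bil U V) W = dot (D1 *m V) (had U W) - dot (had U V) (D1 *m W).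
Proof. by rewrite /bil dotDl dot_had; congr (_ + _); rewrite (dot_D1_skew _ _ hN). Qed.

(** The skew-symmetric form transports without changing the energy, whatever
    the velocity [U]. *)
Lemma dot_bil_diag U V : dot (bil U V) V = 0.
Proof. by rewrite dot_bil dotC subrr. Qed.

Lemma dot_D1_diag V : dot (D1 *m V) V = 0.
Proof.
have := dot_D1_skew xL xR hN V V.
by rewrite (dotC V) => h; move: (dot _ _) h => d h; lra.
Qed.

(** The derivative always falls on a factor other than the velocity [U], after
    a discrete integration by parts; the velocity is taken in the supremum. *)
Lemma trilinear_le U V W :
  `|dot (bil U V) W| <= 2 * emb ^+ 3 * (nrm U * nrm V * nrm W).
Proof.
have e0 := emb_ge0.
have h1 : `|dot (D1 *m V) (had U W)| <= emb ^+ 3 * (nrm U * nrm V * nrm W).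
  rewrite (le_trans (dot_cs _ _))//.
  apply: (le_trans (ler_pM (l2_ge0 _) (l2_ge0 _) (l2_D1_emb V)
    (le_trans (l2_had U W) (ler_wpM2l _ (l2_emb W))))).
    by rewrite mulr_ge0 ?nrm_ge0.
  by apply: eq_ler; ring.
have h2 : `|dot (had U V) (D1 *m W)| <= emb ^+ 3 * (nrm U * nrm V * nrm W).
  rewrite (le_trans (dot_cs _ _))//.
  apply: (le_trans (ler_pM (l2_ge0 _) (l2_ge0 _)
    (le_trans (l2_had U V) (ler_wpM2l _ (l2_emb V))) (l2_D1_emb W))).
    by rewrite mulr_ge0 ?nrm_ge0.
  by apply: eq_ler; ring.
rewrite dot_bil (le_trans (ler_normB _ _))//; lra.
Qed.

(** The frequencies on the grid are at most [n]. *)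
Lemma inverse_ineq U : ip U U <= (1 + sigma * (n%:R * mu) ^+ 2) * dot U U.
Proof.
rewrite ipE (parseval hx hN hn) mulr_sumr big_seq [leRHS]big_seq.
apply: ler_sum => k; rewrite mem_zs => kn.
rewrite -!expr2 [leRHS]mulrA ler_wpM2r ?addr_ge0 ?sqr_ge0//.
rewrite mulrC ler_wpM2r ?cw_ge0// /ew lerD2l ler_wpM2l ?(ltW hs)//.
have m0 := ltW (wavenumber_gt0 hx).
have kR : `|k%:~R| <= n%:R :> R by rewrite -intr_norm -abszE -pmulrn ler_nat.
rewrite -[leLHS]real_normK ?num_real// lerXn2r ?nnegrE ?normr_ge0 ?(mulr_ge0 (ler0n _ _) m0)//.
by rewrite normrM (ger0_norm m0) ler_wpM2r.
Qed.

End EnergyNorm.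

(** * Fourier coefficients control a continuous periodic function *)

Section Fejer.
Variables (R : realType) (xL xR : R).
Hypothesis hx : xL < xR.

Local Notation mu := (wavenumber xL xR).
Local Notation L := (xR - xL).
Local Notation mean := (mean xL xR).
Local Notation cosk := (cosk xL xR).
Local Notation sink := (sink xL xR).
Local Notation ccoef := (ccoef xL xR).
Local Notation scoef := (scoef xL xR).

Lemma continuous_bounded (g : R -> R) : continuous g ->
  exists2 B : R, 0 < B & forall x, xL <= x <= xR -> `|g x| <= B.
Proof.
move=> cg.
have [c1 _ h1] := EVT_max (ltW hx) (continuous_subspaceT cg).
have [c2 _ h2] := EVT_min (ltW hx) (continuous_subspaceT cg).
exists (`|g c1| + `|g c2| + 1).
  by rewrite ltr_wpDl// addr_ge0.
move=> x xLR; have xI : x \in `[xL, xR]%R by rewrite in_itv.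
have := h1 _ xI; have := h2 _ xI; rewrite ler_norml.
have := ler_norm (g c1); have := ler_norm (- g c2); rewrite normrN.
have := normr_ge0 (g c1); have := normr_ge0 (g c2).
by lra.
Qed.

(** The cosine decreases on the first half of the period and is symmetric
    about [pi]. *)
Lemma cos_le_off (d z : R) : 0 < d -> d <= z <= pi *+ 2 - d -> cos z <= cos d.
Proof.
move=> d0 /andP[dz zd].
have dpi : d <= pi by rewrite mulr2n in zd; lra.
have [zpi|zpi] := leP z pi.
  have [->//|zd'] := eqVneq z d.
  apply/ltW; rewrite ltr_cos ?in_itv/= ?zpi ?dpi ?(ltW d0) ?(le_trans (ltW d0) dz)//.
  by rewrite lt_neqAle eq_sym zd' dz.
have -> : cos z = cos (pi *+ 2 - z).
  by rewrite -[RHS]cosN opprB -(cosD2pi (z - pi *+ 2)) subrK.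
have [->//|zd'] := eqVneq (pi *+ 2 - z) d.
have h1 : 0 <= pi *+ 2 - z by lra.
have h2 : pi *+ 2 - z <= pi by rewrite mulr2n; lra.
apply/ltW; rewrite ltr_cos ?in_itv/= ?h1 ?h2 ?dpi ?(ltW d0)//.
by rewrite lt_neqAle eq_sym zd'; lra.
Qed.

(** Near [x0], modulo the period, the left-hand side is small by continuity;
    elsewhere [1 - cos] is bounded away from zero. *)
Lemma periodic_modulus (g : R -> R) (x0 e : R) : continuous g -> periodic g L ->
  xL <= x0 <= xR -> 0 < e ->
  exists2 G : R, 0 <= G & forall x, xL <= x <= xR ->
    `|g x - g x0| <= e + G * (1 - cos (mu * (x - x0))).
Proof.
move=> cg pg /andP[x0L x0R] e0.
have [B B0 hB] := continuous_bounded cg.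
have L0 := period_gt0 hx.
have m0 := wavenumber_gt0 hx.
have /cvgrPdist_le /(_ e e0) := cg x0; rewrite near_simpl.
move=> /nbhs_ballP[d /= d0 hd].
have close y : `|y - x0| < d -> `|g y - g x0| <= e.
  by move=> yd; rewrite distrC; apply: hd; rewrite /ball/= distrC.
pose d' := Num.min d (L / 2).
have d'0 : 0 < d' by rewrite lt_min d0 divr_gt0.
have d'd : d' <= d by rewrite ge_min lexx.
have d'L : d' <= L / 2 by rewrite ge_min lexx orbT.
have mL := wavenumber_period hx.
have md0 : 0 < mu * d' by rewrite mulr_gt0.
have mdpi : mu * d' <= pi.
  have : mu * d' <= mu * (L / 2) by rewrite ler_pM2l.
  by rewrite mulrA mL mulr2n; lra.
have c1 : cos (mu * d') < 1.
  rewrite -[ltRHS]cos0 ltr_cos// in_itv/= ?lexx ?pi_ge0 ?(ltW md0)//.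
have s0 : 0 < 1 - cos (mu * d') by lra.
exists (2 * B / (1 - cos (mu * d'))); first by rewrite divr_ge0 ?mulr_ge0// ltW.
move=> x /andP[xl xr].
have rhs0 : 0 <= 2 * B / (1 - cos (mu * d')) * (1 - cos (mu * (x - x0))).
  apply: mulr_ge0; first by rewrite divr_ge0 ?mulr_ge0 ?(ltW s0) ?(ltW B0).
  by rewrite subr_ge0 cos_le1.
have pgN y : g (y - L) = g y by rewrite -(pg (y - L)) subrK.
have done1 y : g y = g x -> `|y - x0| < d' ->
    `|g x - g x0| <= e + 2 * B / (1 - cos (mu * d')) * (1 - cos (mu * (x - x0))).
  move=> <- yd; have := close y (lt_le_trans yd d'd); lra.
(* A point of the period is close to [x0] modulo the period in one of three
   ways. *)
have [/done1|h1] := ltP `|x - x0| d'; first exact.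
have [/done1|h2] := ltP `|x - L - x0| d'; first by apply; exact: pgN.
have [/done1|h3] := ltP `|x + L - x0| d'; first by apply; exact: pg.
have key : cos (mu * (x - x0)) <= cos (mu * d').
  have -> : cos (mu * (x - x0)) = cos (mu * `|x - x0|).
    by rewrite -[mu in RHS]gtr0_norm// -normrM cos_norm.
  apply: cos_le_off => //; rewrite ler_wpM2l ?(ltW m0)//=.
  rewrite -mL -mulrBr ler_wpM2l ?(ltW m0)//.
  have [xx|xx] := leP x0 x.
    rewrite ger0_norm ?subr_ge0//.
    by move: h2; rewrite ler0_norm; lra.
  rewrite ltr0_norm ?subr_lt0//.
  by move: h3; rewrite ger0_norm; lra.
have gB : `|g x - g x0| <= 2 * B.
  rewrite (le_trans (ler_normB _ _))//.
  have := hB x; have := hB x0; rewrite x0L x0R xl xr => /(_ isT) + /(_ isT); lra.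
have : 2 * B / (1 - cos (mu * d')) * (1 - cos (mu * d')) <=
       2 * B / (1 - cos (mu * d')) * (1 - cos (mu * (x - x0))).
  by rewrite ler_wpM2l ?divr_ge0 ?mulr_ge0 ?(ltW s0) ?(ltW B0)//; lra.
rewrite divfK ?gt_eqF//; lra.
Qed.

(** The squared modulus of the sum of [exp (i j th)], divided by [m]:
    nonnegativity is then evident. *)
Definition fejer_ker (m : nat) (th : R) : R := m%:R^-1 *
  ((\sum_(0 <= j < m) cos (j%:R * th)) ^+ 2 + (\sum_(0 <= j < m) sin (j%:R * th)) ^+ 2).

Lemma fejer_ker_ge0 m th : 0 <= fejer_ker m th.
Proof. by rewrite mulr_ge0 ?invr_ge0 ?ler0n// addr_ge0 ?sqr_ge0. Qed.

(** The telescoped sums of cosines and sines are bounded, after multiplication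
    by the sine of the half angle. *)
Lemma fejer_ker_decay m th : (1 - cos th) * fejer_ker m th <= 4 / m%:R.
Proof.
rewrite /fejer_ker mulrCA [leRHS]mulrC ler_wpM2l ?invr_ge0 ?ler0n//.
have := sum_cos_arith 0 th m; have := sum_sin_arith 0 th m.
under eq_bigr do rewrite add0r; under [X in _ -> _ * X = _ -> _]eq_bigr do rewrite add0r.
set S := \sum_(0 <= j < m) sin _; set C := \sum_(0 <= j < m) cos _ => hS hC.
have -> : 1 - cos th = 2 * sin (th / 2) ^+ 2.
  have -> : th = (th / 2) *+ 2 by rewrite mulr2n; lra.
  rewrite cos_mulr2n; have := cos2Dsin2 ((th / 2) *+ 2 / 2).
  have -> : (th / 2) *+ 2 / 2 = th / 2 by rewrite mulr2n; lra.
  by rewrite mulr2n => h; lra.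
have sq (x y : R) : `|x| <= 1 -> `|y| <= 1 -> (x - y) ^+ 2 <= 4.
  rewrite !ler_norml => /andP[x1 x2] /andP[y1 y2]; nra.
have hS2 : (2 * sin (th / 2) * S) ^+ 2 <= 4 by rewrite hS sq ?cos_max.
have hC2 : (2 * sin (th / 2) * C) ^+ 2 <= 4 by rewrite hC sq ?sin_max.
by move: hS2 hC2; rewrite !exprMn; lra.
Qed.

(** The Fejer mean, written as a double sum: frequency [k] occurs with the
    weight [1 - |k| / m]. *)
Definition fejer_mean (m : nat) (g : R -> R) (x0 : R) : R := m%:R^-1 *
  \sum_(0 <= j < m) \sum_(0 <= l < m)
    (ccoef g (j%:Z - l%:Z) * cosk (j%:Z - l%:Z) x0 +
     scoef g (j%:Z - l%:Z) * sink (j%:Z - l%:Z) x0).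

Lemma fejer_ker_double_sum m x0 x : fejer_ker m (mu * (x - x0)) = m%:R^-1 *
  \sum_(0 <= j < m) \sum_(0 <= l < m)
    (cosk (j%:Z - l%:Z) x0 * cosk (j%:Z - l%:Z) x +
     sink (j%:Z - l%:Z) x0 * sink (j%:Z - l%:Z) x).
Proof.
rewrite /fejer_ker; congr (_ * _).
rewrite !expr2 !mulr_suml -big_split/=; apply: eq_bigr => j _.
rewrite !mulr_sumr -big_split/=; apply: eq_bigr => l _.
by rewrite -cosB -cosk_sub intrB -!pmulrn; congr cos; ring.
Qed.

Lemma continuous_sum (I : Type) (s : seq I) (F : I -> R -> R) :
  (forall i, continuous (F i)) -> continuous (fun x => \sum_(i <- s) F i x).
Proof. by move=> cF; have [] := mean_sum hx s cF. Qed.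

Lemma continuous_fejer_ker m x0 : continuous (fun x => fejer_ker m (mu * (x - x0))).
Proof.
under eq_fun do rewrite fejer_ker_double_sum.
apply: continuous_scale; apply: continuous_sum => j; apply: continuous_sum => l.
apply: continuous_add; apply: continuous_scale;
  [exact: continuous_cosk|exact: continuous_sink].
Qed.

(** Convolution of [g] with the kernel multiplies the Fourier coefficients. *)
Lemma fejer_meanE m g x0 : continuous g ->
  fejer_mean m g x0 = mean (fun x => g x * fejer_ker m (mu * (x - x0))).
Proof.
move=> cg.
have c1 k : continuous (fun x => cosk k x0 * (g x * cosk k x) + sink k x0 * (g x * sink k x)).
  apply: continuous_add; apply: continuous_scale;
    [exact: continuousMcosk|exact: continuousMsink].
have -> : (fun x => g x * fejer_ker m (mu * (x - x0))) = (fun x => m%:R^-1 *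
    \sum_(0 <= j < m) \sum_(0 <= l < m)
    (cosk (j%:Z - l%:Z) x0 * (g x * cosk (j%:Z - l%:Z) x) +
     sink (j%:Z - l%:Z) x0 * (g x * sink (j%:Z - l%:Z) x))).
  apply/funext => x; rewrite fejer_ker_double_sum mulrCA; congr (_ * _).
  rewrite mulr_sumr; apply: eq_bigr => j _; rewrite mulr_sumr; apply: eq_bigr => l _.
  by ring.
have c2 j : continuous (fun x => \sum_(0 <= l < m)
    (cosk (j%:Z - l%:Z) x0 * (g x * cosk (j%:Z - l%:Z) x) +
     sink (j%:Z - l%:Z) x0 * (g x * sink (j%:Z - l%:Z) x))).
  by apply: continuous_sum => l; exact: c1.
rewrite meanZ//; last by apply: continuous_sum => j; exact: c2.
congr (_ * _).
have [_ ->] := mean_sum hx (index_iota 0 m) c2; apply: eq_bigr => j _.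
have [_ ->] := mean_sum hx (index_iota 0 m) (fun l => c1 (j%:Z - l%:Z)).
apply: eq_bigr => l _; rewrite meanD//; last 2 first.
- by apply: continuous_scale; exact: continuousMcosk.
- by apply: continuous_scale; exact: continuousMsink.
rewrite !meanZ//; [by rewrite /ccoef /scoef; ring|exact: continuousMsink|exact: continuousMcosk].
Qed.

Lemma mean_fejer_ker m x0 : (0 < m)%N ->
  mean (fun x => fejer_ker m (mu * (x - x0))) = 1.
Proof.
move=> m0.
have -> : (fun x => fejer_ker m (mu * (x - x0))) = (fun x => 1 * fejer_ker m (mu * (x - x0))).
  by apply/funext => x; rewrite mul1r.
rewrite -(@fejer_meanE m (fun=> 1)) ?/fejer_mean; last exact: cst_continuous.
have e (k : int) : ccoef (fun=> 1) k * cosk k x0 + scoef (fun=> 1) k * sink k x0 = (k == 0)%:R.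
  rewrite /ccoef /scoef.
  under eq_fun do rewrite mul1r; under [X in mean X * sink _ _]eq_fun do rewrite mul1r.
  rewrite (mean_cosk hx) (mean_sink hx) mul0r addr0.
  by case: eqVneq => [->|_]; rewrite ?mul0r// /cosk !mul0r cos0 mulr1.
under eq_bigr do under eq_bigr do rewrite e.
rewrite (@eq_big_nat _ _ _ _ _ _ (fun=> 1)).
  by rewrite big_const_nat subn0 iter_addr_0 mulVf// pnatr_eq0 -lt0n.
move=> j /andP[_ jm]; rewrite (bigD1_seq j) ?mem_index_iota ?iota_uniq//=.
rewrite subrr eqxx big1 ?addr0// => l lj.
by rewrite subr_eq0 eqz_nat eq_sym (negbTE lj).
Qed.

(** Average the bound of [periodic_modulus] against the kernel, which has mean
    one and whose product with [1 - cos] tends uniformly to zero. *)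
Lemma fejer_mean_cvg g x0 : continuous g -> periodic g L -> xL <= x0 <= xR ->
  (fun m => fejer_mean m.+1 g x0) @ \oo --> g x0.
Proof.
move=> cg pg x0I; apply/cvgrPdist_le => e e0.
have e2 : 0 < e / 2 by lra.
have [G G0 hG] := periodic_modulus cg pg x0I e2.
have [M hM] : exists M : nat, forall m, (M <= m)%N -> 4 * G / m.+1%:R <= e / 2.
  exists (Num.bound (4 * G / (e / 2))).+1 => m mM.
  rewrite ler_pdivrMr ?ltr0n// [leRHS]mulrC -ler_pdivrMr//.
  have h := archi_boundP (divr_ge0 (mulr_ge0 (ler0n R 4) G0) (ltW e2)).
  apply/ltW; apply: (lt_le_trans h); rewrite ler_nat.
  exact: leq_trans (ltnW mM) (leqnSn m).
near=> m.
have mM : (M <= m)%N by near: m; exact: nbhs_infty_ge.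
have cK := @continuous_fejer_ker m.+1 x0.
rewrite fejer_meanE// -[g x0]mulr1 -(mean_fejer_ker x0 (ltn0Sn m)) -meanZ// -meanB//; last 2 first.
- exact: continuous_scale.
- exact: continuous_mul.
have cD : continuous (fun x => g x0 * fejer_ker m.+1 (mu * (x - x0)) - g x * fejer_ker m.+1 (mu * (x - x0))).
  by apply: continuous_sub; [exact: continuous_scale|exact: continuous_mul].
have cU : continuous (fun x => e / 2 * fejer_ker m.+1 (mu * (x - x0)) + 4 * G / m.+1%:R).
  by apply: continuous_add; [exact: continuous_scale|exact: cst_continuous].
have bnd x : xL <= x <= xR ->
   `|g x0 * fejer_ker m.+1 (mu * (x - x0)) - g x * fejer_ker m.+1 (mu * (x - x0))| <=
   e / 2 * fejer_ker m.+1 (mu * (x - x0)) + 4 * G / m.+1%:R.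
  move=> xI; rewrite -mulrBl normrM distrC (ger0_norm (fejer_ker_ge0 _ _)).
  apply: (le_trans (ler_wpM2r (fejer_ker_ge0 _ _) (hG x xI))).
  rewrite mulrDl lerD2l -[leLHS]mulrA.
  apply: (le_trans (ler_wpM2l G0 (fejer_ker_decay _ _))).
  by apply: eq_ler; ring.
have mU : mean (fun x => e / 2 * fejer_ker m.+1 (mu * (x - x0)) + 4 * G / m.+1%:R) <= e.
  rewrite meanD//; [|exact: continuous_scale|exact: cst_continuous].
  rewrite (meanZ _ _ (e / 2) cK) (mean_fejer_ker x0 (ltn0Sn m)) mean_cst//.
  by rewrite mulr1 [leRHS]splitr lerD2l hM.
rewrite ler_norml; apply/andP; split.
  rewrite lerNl (le_trans _ mU)// -mulN1r -meanZ//.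
  apply: ler_mean => //; first exact: continuous_scale.
  by move=> x /bnd; rewrite ler_norml mulN1r => /andP[]; rewrite lerNl.
apply: le_trans mU; apply: ler_mean => //.
by move=> x /bnd; rewrite ler_norml => /andP[].
Unshelve. all: by end_near.
Qed.

Lemma sum_subset_le (s t : seq int) (h : int -> R) : uniq s -> uniq t ->
  {subset s <= t} -> (forall k, 0 <= h k) -> \sum_(k <- s) h k <= \sum_(k <- t) h k.
Proof.
move=> us ut st h0.
have -> : \sum_(k <- s) h k = \sum_(k <- t | k \in s) h k.
  rewrite -[RHS]big_filter; apply: perm_big; apply: uniq_perm => //.
    exact: filter_uniq.
  by move=> k; rewrite mem_filter; case: (boolP (k \in s)) => //= /st ->.
by rewrite [leRHS](bigID (mem s))/= lerDl sumr_ge0.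
Qed.

(** Uniqueness of Fourier coefficients in quantitative form, for a finite
    combination of point values: its Fejer mean averages sums of the Fourier
    series over windows of frequencies, each bounded by [B], and converges to
    it. A single point gives the embedding into the supremum; all grid points
    give, by duality, the mean square on the grid. *)
Lemma point_values_le (g : R -> R) (I : Type) (s : seq I) (lam : I -> R) (y : I -> R) (B : R) :
  continuous g -> periodic g L -> (forall i, xL <= y i <= xR) ->
  (forall m, \sum_(k <- zs m)
     `|ccoef g k * (\sum_(i <- s) lam i * cosk k (y i)) +
       scoef g k * (\sum_(i <- s) lam i * sink k (y i))| <= B) ->
  `|\sum_(i <- s) lam i * g (y i)| <= B.
Proof.
move=> cg pg yI hB.
pose h (k : int) := ccoef g k * (\sum_(i <- s) lam i * cosk k (y i)) +
       scoef g k * (\sum_(i <- s) lam i * sink k (y i)).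
have cvS : (fun m => \sum_(i <- s) lam i * fejer_mean m.+1 g (y i)) @ \oo -->
    \sum_(i <- s) lam i * g (y i).
  elim: s {hB h} => [|i s IH].
    rewrite big_nil; under eq_fun do rewrite big_nil; exact: cvg_cst.
  rewrite big_cons; under eq_fun do rewrite big_cons.
  apply: cvgD => //; apply: cvgM; first exact: cvg_cst.
  exact: fejer_mean_cvg.
apply: (cvgr_to_le (cvg_norm cvS)); near=> m.
have -> : \sum_(i <- s) lam i * fejer_mean m.+1 g (y i) = m.+1%:R^-1 *
    \sum_(0 <= j < m.+1) \sum_(0 <= l < m.+1) h (j%:Z - l%:Z).
  rewrite /fejer_mean; under eq_bigr do rewrite mulrCA.
  rewrite -mulr_sumr; congr (_ * _).
  under eq_bigr do rewrite mulr_sumr.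
  rewrite exchange_big/=; apply: eq_bigr => j _.
  under eq_bigr do rewrite mulr_sumr.
  rewrite exchange_big/=; apply: eq_bigr => l _.
  rewrite /h !mulr_sumr -big_split/=; apply: eq_bigr => i _; ring.
rewrite normrM ger0_norm ?invr_ge0 ?ler0n// mulrC ler_pdivrMr ?ltr0n//.
apply: (le_trans (ler_norm_sum _ _ _)).
apply: (@le_trans _ _ (\sum_(0 <= j < m.+1) B)); last first.
  by rewrite big_const_nat subn0 iter_addr_0 mulr_natr.
rewrite big_nat [leRHS]big_nat; apply: ler_sum => j /andP[_ jm].
apply: (le_trans (ler_norm_sum _ _ _)).
apply: le_trans (hB m.+1); rewrite -/(h _).
have -> : \sum_(0 <= i < m.+1) `|h (j%:Z - i%:Z)| =
  \sum_(k <- [seq j%:Z - i%:Z | i <- index_iota 0 m.+1]) `|h k| by rewrite big_map.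
apply: sum_subset_le => //.
- by rewrite map_inj_uniq ?iota_uniq// => a b; lia.
- exact: zs_uniq.
- by move=> k; rewrite mem_zs; case/mapP => i; rewrite mem_index_iota => ? ->; lia.
Unshelve. all: by end_near.
Qed.

End Fejer.

(** * Sobolev norms through partial sums *)

Section Sobolev.
Variables (R : realType) (xL xR : R).
Hypothesis hx : xL < xR.
Variable s : R.

Local Notation mu := (wavenumber xL xR).
Local Notation L := (xR - xL).
Local Notation mean := (mean xL xR).
Local Notation cosk := (cosk xL xR).
Local Notation sink := (sink xL xR).
Local Notation ccoef := (ccoef xL xR).
Local Notation scoef := (scoef xL xR).
Implicit Types f g : R -> R.

(** The square of the Japanese bracket of the frequency. *)
Definition jap (k : int) : R := 1 + (k%:~R * mu) ^+ 2.
Definition coef2 f (k : int) : R := ccoef f k ^+ 2 + scoef f k ^+ 2.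

Lemma japE k : jap k = 1 + (k%:~R * mu) ^+ 2.
Proof. by []. Qed.

Lemma coef2E f k : coef2 f k = ccoef f k ^+ 2 + scoef f k ^+ 2.
Proof. by []. Qed.

Lemma jap_ge1 k : 1 <= jap k.
Proof. by rewrite lerDl sqr_ge0. Qed.

Lemma jap_gt0 k : 0 < jap k.
Proof. exact: lt_le_trans ltr01 (jap_ge1 k). Qed.

Lemma coef2_ge0 f k : 0 <= coef2 f k.
Proof. by rewrite addr_ge0 ?sqr_ge0. Qed.

(** Bounding the partial sums keeps every Sobolev estimate within finite sums
    of real numbers. *)
Definition Hs_le f (B : R) : Prop :=
  forall m, \sum_(k <- zs m) jap k `^ s * coef2 f k <= B.

Lemma Hs_leW f A B : A <= B -> Hs_le f A -> Hs_le f B.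
Proof. by move=> AB h m; exact: le_trans (h m) AB. Qed.

Lemma Hs_le_ge0 f B : Hs_le f B -> 0 <= B.
Proof.
move=> /(_ 0%N); apply: le_trans; apply: sum_zs_ge0 => k.
by rewrite mulr_ge0 ?powR_ge0 ?coef2_ge0.
Qed.

Lemma Hs_le_sqnorm f B : (Hs_sqnorm xL xR s f <= B%:E)%E -> Hs_le f B.
Proof.
move=> h m; rewrite -lee_fin; apply: le_trans h; rewrite /Hs_sqnorm.
apply: esum_ge; exists [set` zs m]; first by split => //; exact: finite_seq.
rewrite -fsbig_seq ?zs_uniq//= -sumEFin le_eqVlt; apply/orP; left; apply/eqP.
apply: eq_bigr => k _; congr (_ * _)%:E.
by rewrite /coef2 /fourier_coef/= sqrrN.
Qed.

(** The constants come from [(x + y) ^ 2 <= 2 * x ^ 2 + 2 * y ^ 2]; a sharp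
    triangle inequality would bring square roots. *)
Lemma Hs_leD f g A B : continuous f -> continuous g -> Hs_le f A -> Hs_le g B ->
  Hs_le (fun x => f x + g x) (2 * A + 2 * B).
Proof.
move=> cf cg hA hB m.
apply: (@le_trans _ _ (2 * (\sum_(k <- zs m) jap k `^ s * coef2 f k) +
                       2 * (\sum_(k <- zs m) jap k `^ s * coef2 g k))); last first.
  by have := hA m; have := hB m; lra.
rewrite !mulr_sumr -big_split/=; apply: ler_sum => k _.
have p0 := powR_ge0 (jap k) s.
rewrite !(mulrCA 2) -mulrDr ler_wpM2l// /coef2 ccoefD// scoefD//.
have := sqr_ge0 (ccoef f k - ccoef g k); have := sqr_ge0 (scoef f k - scoef g k).
by lra.
Qed.

Lemma Hs_leZ c f A : continuous f -> Hs_le f A -> Hs_le (fun x => c * f x) (c ^+ 2 * A).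
Proof.
move=> cf hA m; apply: le_trans (ler_wpM2l (sqr_ge0 c) (hA m)).
rewrite mulr_sumr; apply: ler_sum => k _.
rewrite mulrCA ler_wpM2l ?powR_ge0// /coef2 ccoefZ// scoefZ//.
by apply: eq_ler; ring.
Qed.

(** ** Smooth periodic functions *)

Lemma periodic_derive1 f : periodic f L -> (forall x : R, derivable f x 1) ->
  periodic (f^`())%classic L.
Proof.
move=> pf df x.
have h1 : is_derive x 1 (f \o (fun y => y + L)) ((f^`())%classic (x + L) * 1).
  apply: is_derive1_comp.
    by apply: DeriveDef; rewrite ?derive1E.
  by apply: is_derive_eq; rewrite addr0.
have e : f \o (fun y => y + L) = f by apply/funext => y /=; exact: pf.
rewrite e in h1; rewrite [RHS]derive1E; have [_ ->] := h1; by rewrite mulr1.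
Qed.

Lemma smooth_periodic_derive1 f : smooth_periodic L f ->
  smooth_periodic L (f^`())%classic.
Proof.
move=> [pf df]; split; first by apply: periodic_derive1 => // x; exact: (df 0%N).
by move=> m x; rewrite -derive1Sn; exact: df.
Qed.

Lemma continuous_derivable f : (forall x : R, derivable f x 1) -> continuous f.
Proof. by move=> df x; apply/differentiable_continuous/derivable1_diffP. Qed.

Lemma continuous_smooth f : smooth_periodic L f -> continuous f.
Proof. by move=> [_ df]; apply: continuous_derivable => x; exact: (df 0%N). Qed.

Lemma mean_derive_periodic (F f : R -> R) : continuous f ->
  (forall x : R, is_derive x 1 F (f x)) -> periodic F L -> mean f = 0.
Proof.
move=> cf dF pF; rewrite (@mean_derive _ _ _ hx F f)//.
have -> : xR = xL + L by rewrite addrC subrK.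
by rewrite pF subrr mulr0.
Qed.

Lemma is_derive_cosk k (x : R) : is_derive x 1 (cosk k) (- (k%:~R * mu) * sink k x).
Proof.
have -> : cosk k = (fun y => cos (k%:~R * mu * y + 0)).
  by apply/funext => y; rewrite addr0.
have -> : sink k x = sin (k%:~R * mu * x + 0) by rewrite addr0.
exact: is_derive_cos_lin.
Qed.

Lemma is_derive_sink k (x : R) : is_derive x 1 (sink k) (k%:~R * mu * cosk k x).
Proof.
have -> : sink k = (fun y => sin (k%:~R * mu * y + 0)).
  by apply/funext => y; rewrite addr0.
have -> : cosk k x = cos (k%:~R * mu * x + 0) by rewrite addr0.
exact: is_derive_sin_lin.
Qed.

Lemma ccoef_derive1 f k : smooth_periodic L f ->
  ccoef (f^`())%classic k = k%:~R * mu * scoef f k.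
Proof.
move=> sf; have cf := continuous_smooth sf.
have cf' := continuous_smooth (smooth_periodic_derive1 sf).
have df (x : R) : is_derive x 1 f ((f^`())%classic x).
  by apply: DeriveDef; [exact: (sf.2 0%N)|rewrite derive1E].
have z : mean (fun x => (f^`())%classic x * cosk k x - k%:~R * mu * (f x * sink k x)) = 0.
  apply: (@mean_derive_periodic (f * cosk k)).
  - apply: continuous_sub; first exact: continuousMcosk.
    by apply: continuous_scale; exact: continuousMsink.
  - move=> x; apply: (is_derive_eq (is_deriveM (df x) (is_derive_cosk k x))).
    by rewrite /GRing.scale/=; ring.
  - by move=> x; rewrite /GRing.mul/= cosk_period// sf.1.
move: z; rewrite meanB//; last 2 first.
- exact: continuousMcosk.
- by apply: continuous_scale; exact: continuousMsink.
by rewrite meanZ; [move/eqP; rewrite subr_eq0 => /eqP|exact: continuousMsink].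
Qed.

Lemma scoef_derive1 f k : smooth_periodic L f ->
  scoef (f^`())%classic k = - (k%:~R * mu * ccoef f k).
Proof.
move=> sf; have cf := continuous_smooth sf.
have cf' := continuous_smooth (smooth_periodic_derive1 sf).
have df (x : R) : is_derive x 1 f ((f^`())%classic x).
  by apply: DeriveDef; [exact: (sf.2 0%N)|rewrite derive1E].
have z : mean (fun x => (f^`())%classic x * sink k x + k%:~R * mu * (f x * cosk k x)) = 0.
  apply: (@mean_derive_periodic (f * sink k)).
  - apply: continuous_add; first exact: continuousMsink.
    by apply: continuous_scale; exact: continuousMcosk.
  - move=> x; apply: (is_derive_eq (is_deriveM (df x) (is_derive_sink k x))).
    by rewrite /GRing.scale/=; ring.
  - by move=> x; rewrite /GRing.mul/= sink_period// sf.1.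
move: z; rewrite meanD//; last 2 first.
- exact: continuousMsink.
- by apply: continuous_scale; exact: continuousMcosk.
by rewrite meanZ; [move/eqP; rewrite addr_eq0 => /eqP|exact: continuousMcosk].
Qed.

Lemma coef2_derive1 f k : smooth_periodic L f ->
  coef2 (f^`())%classic k = (k%:~R * mu) ^+ 2 * coef2 f k.
Proof. by move=> sf; rewrite /coef2 ccoef_derive1// scoef_derive1//; ring. Qed.

Lemma coef2_bounded f : continuous f -> exists B, forall k, coef2 f k <= B.
Proof.
move=> cf; have [B B0 hB] := continuous_bounded hx cf.
exists (2 * B ^+ 2) => k.
have hc : `|ccoef f k| <= B.
  apply: (mean_norm_le hx); first exact: continuousMcosk.
  move=> x /hB fB; rewrite normrM (le_trans _ fB)// ler_piMr//; exact: cos_max.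
have hs : `|scoef f k| <= B.
  apply: (mean_norm_le hx); first exact: continuousMsink.
  move=> x /hB fB; rewrite normrM (le_trans _ fB)// ler_piMr//; exact: sin_max.
rewrite /coef2 -[ccoef f k ^+ 2]real_normK ?num_real// -[scoef f k ^+ 2]real_normK ?num_real//.
have B0' := ltW B0.
have : `|ccoef f k| ^+ 2 <= B ^+ 2 by rewrite lerXn2r ?nnegrE.
have : `|scoef f k| ^+ 2 <= B ^+ 2 by rewrite lerXn2r ?nnegrE.
by lra.
Qed.

(** Each derivative multiplies the squared coefficient by the squared
    frequency, and the coefficients of a continuous function are bounded. *)
Lemma coef2_decay m f : smooth_periodic L f ->
  exists B, forall k, jap k ^+ m * coef2 f k <= B.
Proof.
elim: m f => [|m IH] f sf.
  have [B hB] := coef2_bounded (continuous_smooth sf).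
  by exists B => k; rewrite expr0 mul1r.
have [B1 h1] := IH _ sf; have [B2 h2] := IH _ (smooth_periodic_derive1 sf).
exists (B1 + B2) => k; have := h1 k; have := h2 k; rewrite coef2_derive1//.
have -> : jap k ^+ m.+1 * coef2 f k =
    jap k ^+ m * coef2 f k + jap k ^+ m * ((k%:~R * mu) ^+ 2 * coef2 f k).
  by rewrite exprS {1}japE; ring.
by move=> ? ?; rewrite addrC; lra.
Qed.

(** Use one more integer order of decay than the order of the space, and sum
    the inverses of the weights. *)
Lemma Hs_le_smooth f : smooth_periodic L f -> exists B, Hs_le f B.
Proof.
move=> sf; pose p := Num.bound `|s|.
have sp : s <= p%:R by exact: le_trans (ler_norm s) (ltW (archi_boundP (normr_ge0 s))).
have [B hB] := coef2_decay p.+1 sf.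
have B0 : 0 <= B.
  by apply: le_trans (hB 0); rewrite mulr_ge0 ?coef2_ge0// exprn_ge0// ltW// jap_gt0.
exists (B * (1 + 4 / mu ^+ 2)) => m.
apply: le_trans (ler_wpM2l B0 (sum_zs_inv_le m (wavenumber_gt0 hx))).
rewrite mulr_sumr; apply: ler_sum => k _.
rewrite -/(jap k) ler_pdivlMr ?jap_gt0//; apply: le_trans (hB k).
rewrite exprS -[leRHS]mulrA mulrC ler_wpM2l ?(ltW (jap_gt0 k))//.
rewrite ler_wpM2r ?coef2_ge0// -powR_mulrn ?(ltW (jap_gt0 k))//.
exact: ler_powR (jap_ge1 k) _ _ sp.
Qed.

(** One smooth function at finite distance suffices, since smooth functions
    have finite norm. *)
Lemma Hs_le_Hsp f : Hsp xL xR s f -> exists B, Hs_le f B.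
Proof.
move=> [cf pf /(_ 1 ltr01)[phi sphi]] h.
have h1 : Hs_le (f \- phi)%R 1 by apply: Hs_le_sqnorm; exact: ltW.
have [B hB] := Hs_le_smooth sphi; have cphi := continuous_smooth sphi.
exists (2 * 1 + 2 * B).
have -> : f = (fun x => (f \- phi)%R x + phi x) by apply/funext => x /=; rewrite subrK.
by apply: Hs_leD => //; exact: continuous_sub.
Qed.

End Sobolev.

(** ** Truncated Fourier series *)

Section Truncation.
Variables (R : realType) (xL xR : R).
Hypothesis hx : xL < xR.
Variable r : R.
Hypothesis hr : 0 <= r.
Variables (N n M : nat).
Hypotheses (hN : N = n.*2) (hn : (0 < n)%N) (NM : (N <= 4 * M.+1)%N).

Local Notation mu := (wavenumber xL xR).
Local Notation L := (xR - xL).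
Local Notation cosk := (cosk xL xR).
Local Notation sink := (sink xL xR).
Local Notation trig := (trig xL xR).
Local Notation ccoef := (ccoef xL xR).
Local Notation scoef := (scoef xL xR).
Local Notation jap := (jap xL xR).
Local Notation coef2 := (coef2 xL xR).
Local Notation Hs_le := (Hs_le xL xR (r + 1)).
Implicit Types f g : R -> R.

Definition trunc f : R -> R := trig M (ccoef f) (scoef f).

(** This is [(mu * N / 4) ^ (- r)]: the discarded frequencies are at least [N
    / 4], and of the order [r + 1] of the solution one derivative is spent on
    the energy norm. *)
Definition rate : R := (mu / 4) `^ (- r) * N%:R `^ (- r).

Lemma rate_ge0 : 0 <= rate.
Proof. by rewrite mulr_ge0 ?powR_ge0. Qed.

Lemma jap_tail k : (M < `|k|)%N -> jap k <= rate ^+ 2 * jap k `^ (r + 1).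
Proof.
move=> Mk.
have m0 := wavenumber_gt0 hx; have N0 := natr_N_gt0 R hN hn.
have q0 : 0 < mu / 4 * N%:R by apply: mulr_gt0 => //; exact: divr_gt0.
have jk := jap_gt0 xL xR k.
have hk : (mu / 4 * N%:R) ^+ 2 <= jap k.
  have h4 : mu / 4 * N%:R <= `|k|%N%:R * mu.
    have : N%:R <= 4 * `|k|%N%:R :> R by rewrite -natrM ler_nat; lia.
    have := ler_wpM2l (ltW m0) _; rewrite -mulrA; move/(_ _ _) => h /h; lra.
  have -> : jap k = 1 + (`|k|%N%:R * mu) ^+ 2.
    rewrite japE !exprMn; congr (1 + _ * _).
    by rewrite -[LHS]real_normK ?num_real// -intr_norm -abszE -pmulrn.
  apply: (@le_trans _ _ ((`|k|%N%:R * mu) ^+ 2)); last by rewrite lerDr.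
  by rewrite lerXn2r ?nnegrE ?(ltW q0)// (le_trans (ltW q0) h4).
rewrite powRD; last by apply/implyP => _; rewrite gt_eqF.
rewrite powRr1 ?(ltW jk)// mulrA ler_peMl ?(ltW jk)//.
rewrite /rate -powRM ?(ltW N0) ?ler0n//; last by rewrite divr_ge0 ?(ltW m0).
rewrite powRN exprVn mulrC ler_pdivlMr ?exprn_gt0 ?powR_gt0// mul1r.
rewrite -powR_mulrn ?powR_ge0// -powRrM (mulrC r) powRrM powR_mulrn ?(ltW q0)//.
by apply: ge0_ler_powR => //; rewrite nnegrE ?sqr_ge0 ?(ltW jk).
Qed.

(** Beyond the truncation the weight of order one is at most the squared rate
    times the weight of order [r + 1]. *)
Lemma tail_le f B m : Hs_le f B ->
  \sum_(k <- zs m) (if (M < `|k|)%N then jap k * coef2 f k else 0) <= rate ^+ 2 * B.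
Proof.
move=> hB; apply: le_trans (ler_wpM2l (sqr_ge0 rate) (hB m)).
rewrite mulr_sumr; apply: ler_sum => k _; case: ifP => [Mk|_].
  by rewrite mulrA ler_wpM2r ?coef2_ge0// jap_tail.
by rewrite !mulr_ge0 ?sqr_ge0 ?powR_ge0 ?coef2_ge0.
Qed.

Lemma continuous_trunc f : continuous (trunc f).
Proof. exact: continuous_trig. Qed.

Lemma ccoef_trunc f k : ccoef (trunc f) k = if (`|k| <= M)%N then ccoef f k else 0.
Proof. by rewrite (ccoef_trig hx)// => j; exact: ccoefN. Qed.

Lemma scoef_trunc f k : continuous f ->
  scoef (trunc f) k = if (`|k| <= M)%N then scoef f k else 0.
Proof. by move=> cf; rewrite (scoef_trig hx)// => j; exact: scoefN. Qed.

Lemma coef2_sub_trunc f k : continuous f ->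
  coef2 (fun x => f x - trunc f x) k = if (M < `|k|)%N then coef2 f k else 0.
Proof.
move=> cf; have ct := @continuous_trunc f.
rewrite !coef2E ccoefB// scoefB// ccoef_trunc scoef_trunc// ltnNge.
by case: ifP => _ /=; rewrite ?subr0 ?subrr ?expr0n ?addr0.
Qed.

(** The embedding of the space of order one into the supremum: Cauchy-Schwarz
    on the Fourier series, which [point_values_le] makes legitimate without
    knowing that the series converges to [f]. *)
Lemma sup_le_coef2 f (B : R) : continuous f -> periodic f L -> 0 <= B ->
  (forall m, \sum_(k <- zs m) jap k * coef2 f k <= B) ->
  forall x, xL <= x <= xR -> `|f x| <= Num.sqrt ((1 + 4 / mu ^+ 2) * B).
Proof.
move=> cf pf B0 hB x xI.
have W0 : 0 <= 1 + 4 / mu ^+ 2 by rewrite addr_ge0// divr_ge0// sqr_ge0.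
have -> : f x = \sum_(i <- [:: tt]) 1 * f x by rewrite big_seq1 mul1r.
apply: (@point_values_le _ _ _ hx f unit [:: tt] (fun=> 1) (fun=> x)) => // m.
under eq_bigr do rewrite !big_seq1 !mul1r.
have -> : \sum_(k <- zs m) `|ccoef f k * cosk k x + scoef f k * sink k x| =
  \sum_(k <- zs m) jap k * ((`|ccoef f k * cosk k x + scoef f k * sink k x|) * (jap k)^-1 + 0 * 0).
  apply: eq_bigr => k _; field; rewrite gt_eqF//; exact: jap_gt0.
rewrite (le_trans (ler_norm _))//; apply: ler_of_sqr; first exact: sqrtr_ge0.
rewrite sqr_sqrtr ?mulr_ge0//.
apply: (le_trans (cauchy_schwarz_sum _ _ _ _ _ _)).
  by move=> k; exact/ltW/jap_gt0.
rewrite mulrC; apply: ler_pM.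
- by apply: sumr_ge0 => k _; rewrite mulr_ge0 ?addr_ge0 ?sqr_ge0// ltW// jap_gt0.
- by apply: sumr_ge0 => k _; rewrite mulr_ge0 ?addr_ge0 ?sqr_ge0// ltW// jap_gt0.
- apply: le_trans (sum_zs_inv_le m (wavenumber_gt0 hx)); apply: ler_sum => k _.
  rewrite -/(jap k) expr0n addr0; apply: eq_ler.
  by field; rewrite gt_eqF// jap_gt0.
- apply: le_trans (hB m); apply: ler_sum => k _.
  rewrite ler_wpM2l ?(ltW (jap_gt0 _ _ _))// expr0n addr0 real_normK ?num_real//.
  have := cosk2Dsink2 xL xR k x; rewrite coef2E.
  move: (ccoef f k) (scoef f k) (cosk k x) (sink k x) => p q c' s' e.
  have : 0 <= (p * s' - q * c') ^+ 2 by exact: sqr_ge0.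
  have -> : p ^+ 2 + q ^+ 2 = (p ^+ 2 + q ^+ 2) * (c' ^+ 2 + s' ^+ 2) by rewrite e mulr1.
  by lra.
Qed.

Lemma sup_le_Hs f B : continuous f -> periodic f L -> Hs_le f B ->
  forall x, xL <= x <= xR -> `|f x| <= Num.sqrt ((1 + 4 / mu ^+ 2) * B).
Proof.
move=> cf pf hB; apply: sup_le_coef2 => //; first exact: Hs_le_ge0 hB.
move=> m; apply: le_trans (hB m); apply: ler_sum => k _.
rewrite ler_wpM2r ?coef2_ge0// -[leLHS]powRr1 ?(ltW (jap_gt0 _ _ _))//.
by apply: ler_powR; [exact: jap_ge1|rewrite lerDr].
Qed.

Lemma periodic_sub_trunc f : periodic f L -> periodic (fun x => f x - trunc f x) L.
Proof. by move=> pf x; rewrite pf /trunc (trig_period hx). Qed.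

Lemma sum_coef2_sub_trunc f B m : continuous f -> Hs_le f B ->
  \sum_(k <- zs m) jap k * coef2 (fun x => f x - trunc f x) k <= rate ^+ 2 * B.
Proof.
move=> cf hB; apply: le_trans (tail_le m hB); apply: ler_sum => k _.
by rewrite coef2_sub_trunc//; case: ifP => _; rewrite ?mulr0.
Qed.

Lemma sup_sub_trunc f B : continuous f -> periodic f L -> Hs_le f B ->
  forall x, xL <= x <= xR ->
  `|f x - trunc f x| <= Num.sqrt ((1 + 4 / mu ^+ 2) * B) * rate.
Proof.
move=> cf pf hB x xI.
have B0 := Hs_le_ge0 hB.
have W0 : 0 <= 1 + 4 / mu ^+ 2 by rewrite addr_ge0// divr_ge0// sqr_ge0.
have -> : Num.sqrt ((1 + 4 / mu ^+ 2) * B) * rate = Num.sqrt ((1 + 4 / mu ^+ 2) * (rate ^+ 2 * B)).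
  have -> : (1 + 4 / mu ^+ 2) * (rate ^+ 2 * B) = (1 + 4 / mu ^+ 2) * B * rate ^+ 2 by ring.
  by rewrite [in RHS]sqrtrM ?mulr_ge0// sqrtr_sqr (ger0_norm rate_ge0).
apply: (@sup_le_coef2 (fun x => f x - trunc f x)) => //.
- by apply: continuous_sub => //; exact: continuous_trunc.
- exact: periodic_sub_trunc.
- by rewrite mulr_ge0 ?sqr_ge0.
- by move=> m; exact: sum_coef2_sub_trunc.
Qed.

(** The gain of a power of [N] over the rate comes from duality. The square of
    the norm of [d] is the combination of the point values of the tail with
    coefficients [d j / N]; its Fourier series pairs the coefficients of the
    tail with those of the grid vector [d], which [aliasing_le] controls. *)
Lemma l2_sub_trunc f B : continuous f -> periodic f L -> Hs_le f B ->
  l2 (gvec xL xR N (fun x => f x - trunc f x)) <=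
  10 / (mu * N%:R) * (Num.sqrt B * rate).
Proof.
move=> cf pf hB.
set g := fun x => _; set d := gvec _ _ _ _.
have B0 := Hs_le_ge0 hB.
have cg : continuous g by apply: continuous_sub => //; exact: continuous_trunc.
have m0 := wavenumber_gt0 hx; have N0 := natr_N_gt0 R hN hn.
have c0 : 0 <= 10 / (mu * N%:R) * (Num.sqrt B * rate).
  apply: mulr_ge0; first exact: divr_ge0 (mulr_ge0 (ltW m0) (ltW N0)).
  exact: mulr_ge0 (sqrtr_ge0 _) rate_ge0.
(* The functional is the pairing with [d] itself, so its bound contains a
   factor [l2 d], which is then cancelled. *)
suff h : l2 d ^+ 2 <= 10 / (mu * N%:R) * (Num.sqrt B * rate) * l2 d.
  have [->//|d0] := eqVneq (l2 d) 0.
  by move: h; rewrite expr2 ler_pM2r// lt_neqAle eq_sym d0 l2_ge0.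
rewrite l2_sq.
have -> : dot d d = \sum_(j <- enum 'I_N) (N%:R^-1 * d j 0) * g (grid xL xR N j).
  rewrite /dot mulr_sumr -big_enum/=; apply: eq_bigr => j _.
  by rewrite mulrA [X in _ * X]mxE.
rewrite (le_trans (ler_norm _))//.
apply: (point_values_le hx cg); first exact: periodic_sub_trunc.
  move=> j; rewrite /grid lerDl; apply/andP; split.
    by rewrite mulr_ge0 ?ler0n// divr_ge0 ?ler0n// ltW// period_gt0.
  rewrite -lerBrDl mulrCA ger_pMr ?period_gt0// ler_pdivrMr// mul1r ler_nat.
  exact/ltnW/ltn_ord.
move=> m.
have ec k : \sum_(j <- enum 'I_N) N%:R^-1 * d j 0 * cosk k (grid xL xR N j) = gcos xL xR d k.
  by rewrite /gcos mulr_sumr big_enum/=; apply: eq_bigr => j _; rewrite mulrA.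
have es k : \sum_(j <- enum 'I_N) N%:R^-1 * d j 0 * sink k (grid xL xR N j) = gsin xL xR d k.
  by rewrite /gsin mulr_sumr big_enum/=; apply: eq_bigr => j _; rewrite mulrA.
under eq_bigr do rewrite ec es.
pose G k := if (M < `|k|)%N then gcos xL xR d k ^+ 2 + gsin xL xR d k ^+ 2 else 0.
pose F k := if (M < `|k|)%N then coef2 f k else 0.
have G0 k : 0 <= G k by rewrite /G; case: ifP => // _; rewrite addr_ge0 ?sqr_ge0.
have F0 k : 0 <= F k by rewrite /F; case: ifP => // _; rewrite coef2_ge0.
apply: (@le_trans _ _ (\sum_(k <- zs m) jap k * (Num.sqrt (F k) * (Num.sqrt (G k) / jap k) + 0 * 0))).
  apply: ler_sum => k _.
  have -> : jap k * (Num.sqrt (F k) * (Num.sqrt (G k) / jap k) + 0 * 0) = Num.sqrt (F k) * Num.sqrt (G k).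
    by field; rewrite gt_eqF// jap_gt0.
  rewrite -sqrtrM// -[leLHS]ger0_norm// -sqrtr_sqr ler_wsqrtr//.
  rewrite real_normK ?num_real//.
  have := coef2_sub_trunc k cf; rewrite -/(F k) -/g => eF.
  case: (ltnP M `|k|) => Mk; last first.
    have : coef2 g k = 0 by rewrite eF /F ltnNge Mk.
    rewrite coef2E => /eqP; rewrite paddr_eq0 ?sqr_ge0// !sqrf_eq0 => /andP[/eqP -> /eqP ->].
    by rewrite !mul0r addr0 expr0n mulr_ge0.
  rewrite -eF coef2E /G Mk.
  move: (ccoef g k) (scoef g k) (gcos xL xR d k) (gsin xL xR d k) => p q c' s'.
  have : 0 <= (p * s' - q * c') ^+ 2 by exact: sqr_ge0.
  by lra.
rewrite (le_trans (ler_norm _))//; apply: ler_of_sqr; first by rewrite mulr_ge0 ?l2_ge0.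
apply: (le_trans (cauchy_schwarz_sum _ _ _ _ _ _)).
  by move=> k; exact/ltW/jap_gt0.
have sF : \sum_(k <- zs m) jap k * (Num.sqrt (F k) ^+ 2 + 0 ^+ 2) <= rate ^+ 2 * B.
  apply: le_trans (tail_le m hB); apply: ler_sum => k _.
  by rewrite sqr_sqrtr// expr0n addr0 /F; case: ifP => _; rewrite ?mulr0.
have sG : \sum_(k <- zs m) jap k * ((Num.sqrt (G k) / jap k) ^+ 2 + 0 ^+ 2) <=
    100 / (mu * N%:R) ^+ 2 * dot d d.
  have := aliasing_le hx hN hn d m NM; apply: le_trans; apply: ler_sum => k _.
  rewrite exprMn sqr_sqrtr// expr0n addr0 /G -/(jap k).
  case: ifP => _; apply: eq_ler;
    by field; rewrite gt_eqF// jap_gt0.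
apply: (le_trans (ler_pM _ _ sF sG)).
- by apply: sumr_ge0 => k _; rewrite mulr_ge0 ?addr_ge0 ?sqr_ge0// ltW// jap_gt0.
- by apply: sumr_ge0 => k _; rewrite mulr_ge0 ?addr_ge0 ?sqr_ge0// ltW// jap_gt0.
have x0 : mu * N%:R != 0 by rewrite gt_eqF// mulr_gt0.
rewrite -l2_sq -{1}(sqr_sqrtr B0); apply: eq_ler.
by move: (mu * N%:R) x0 => x x0; field.
Qed.

End Truncation.

(** * Scalar functions of time *)

Section ScalarTime.
Variables (R : realType) (T : R).
Hypothesis hT : 0 < T.
Implicit Types (q : R -> R) (t x y z a b c d e h l K : R).

(** One-sided at the end points, like the derivative of a function with values
    in the Sobolev space; the error is compared with [`|t' - t|], so that [t'
    = t] needs no special treatment. *)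
Definition der_in q (t l : R) : Prop := forall e : R, 0 < e -> exists2 d : R, 0 < d &
  forall t', 0 <= t' <= T -> `|t' - t| < d -> `|q t' - q t - (t' - t) * l| <= e * `|t' - t|.

Lemma der_in_unique q t l l' : 0 <= t <= T -> der_in q t l -> der_in q t l' -> l = l'.
Proof.
move=> /andP[t0 tT] h h'.
apply/eqP; rewrite -subr_eq0 -normr_eq0; apply/eqP/le_anti; rewrite normr_ge0 andbT.
apply/ler_addgt0Pl => e e0; rewrite addr0.
have e2 : 0 < e / 2 by lra.
have [d d0 hd] := h _ e2; have [d' d'0 hd'] := h' _ e2.
pose m := Num.min (Num.min d d') T / 2.
have m0 : 0 < m by rewrite divr_gt0// !lt_min d0 d'0 hT.
have md : m < d by rewrite /m ltr_pdivrMr// !gt_min; apply/orP; left; apply/orP; left; lra.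
have md' : m < d' by rewrite /m ltr_pdivrMr// !gt_min; apply/orP; left; apply/orP; right; lra.
have mT : m <= T / 2 by rewrite ler_pM2r ?invr_gt0// ge_min lexx orbT.
have [t' t'I tt'] : exists2 t', 0 <= t' <= T & `|t' - t| = m.
  have [tl|tl] := leP t (T / 2).
    exists (t + m); first by apply/andP; split; lra.
    by rewrite addrAC subrr add0r gtr0_norm.
  exists (t - m); first by apply/andP; split; lra.
  by rewrite addrAC subrr add0r normrN gtr0_norm.
have := hd t' t'I; have := hd' t' t'I; rewrite tt' => /(_ md') h1 /(_ md) h2.
have : `|(t' - t) * (l - l')| <= e * m.
  have -> : (t' - t) * (l - l') = (q t' - q t - (t' - t) * l') - (q t' - q t - (t' - t) * l) by ring.
  by rewrite (le_trans (ler_normB _ _))//; lra.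
by rewrite normrM tt' mulrC ler_pM2r.
Qed.

(** Subtracting a Taylor polynomial of degree two, so that mean value
    arguments apply to the remainder. *)
Lemma der_in_sub_quadratic q t l x c d : der_in q t l ->
  der_in (fun t => q t - (t * c + (t - x) ^+ 2 / 2 * d)) t (l - (c + (t - x) * d)).
Proof.
move=> h e e0; have e2 : 0 < e / 2 by lra.
have [b b0 hb] := h _ e2.
have D0 : 0 < 1 + `|d| by rewrite ltr_pwDl.
exists (Num.min b (e / (1 + `|d|))); first by rewrite lt_min b0 divr_gt0.
move=> t' t'I; rewrite lt_min ltr_pdivlMr// => /andP[h1 h2].
have -> : q t' - (t' * c + (t' - x) ^+ 2 / 2 * d) - (q t - (t * c + (t - x) ^+ 2 / 2 * d)) -
    (t' - t) * (l - (c + (t - x) * d)) =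
    (q t' - q t - (t' - t) * l) - (t' - t) * ((t' - t) * d) / 2 by field.
have -> : e * `|t' - t| = e / 2 * `|t' - t| + e / 2 * `|t' - t| by field.
rewrite (le_trans (ler_normB _ _))// lerD ?hb//.
rewrite !normrM [`|2^-1|]ger0_norm// -mulrA [leRHS]mulrC ler_wpM2l//.
rewrite ler_pM2r ?invr_gt0//; move: h2; rewrite mulrDr mulr1.
by have := normr_ge0 (t' - t); lra.
Qed.

Lemma is_derive_der_in q a b t l : 0 <= a -> b <= T -> a < t < b -> der_in q t l ->
  is_derive t 1 q l.
Proof.
move=> a0 bT /andP[at_ tb] h.
have cv : h^-1 *: (q (h *: 1 + t) - q t) @[h --> 0^'] --> l.
  apply/cvgrPdist_le => e e0; have [d d0 hd] := h _ e0.
  near=> z.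
  have zn0 : z != 0 by near: z; exact: nbhs_dnbhs_neq.
  have zd : `|z| < Num.min d (Num.min (t - a) (b - t)).
    near: z; apply: dnbhs0_lt; rewrite !lt_min d0 !subr_gt0 at_ tb//.
  move: zd; rewrite !lt_min => /and3P[z1 z2 z3].
  have zI : 0 <= z + t <= T.
    move: z2 z3; rewrite !ltr_norml; lra.
  have := hd _ zI; rewrite addrK => /(_ z1).
  rewrite [z *: 1]mulr1 /GRing.scale/= => hz.
  rewrite -(ler_pM2r (x := `|z|)) ?normr_gt0// -normrM.
  have -> : (l - z^-1 * (q (z + t) - q t)) * z = - (q (z + t) - q t - z * l) by field.
  by rewrite normrN.
apply: DeriveDef; first by apply/cvg_ex; exists l.
exact: cvg_lim cv.
Unshelve. all: by end_near.
Qed.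

Lemma der_in_cvg q (t l : R) (e : R) : der_in q t l -> 0 < e -> exists2 d : R, 0 < d &
  forall t', 0 <= t' <= T -> `|t' - t| < d -> `|q t - q t'| <= e.
Proof.
move=> h e0; have [d d0 hd] := h _ ltr01.
have D0 : 0 < 1 + `|l| by rewrite ltr_pwDl.
exists (Num.min d (e / (1 + `|l|))); first by rewrite lt_min d0 divr_gt0.
move=> t' t'I; rewrite lt_min ltr_pdivlMr// => /andP[h1 h2].
have := hd t' t'I h1; rewrite mul1r => h3.
have -> : q t - q t' = - ((q t' - q t - (t' - t) * l) + (t' - t) * l) by ring.
rewrite normrN (le_trans (ler_normD _ _))// normrM.
by move: h2; rewrite mulrDr mulr1; lra.
Qed.

(** The mean value inequality needs only continuity at the end points, where
    the derivative is one-sided. *)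
Lemma der_in_mvt q dq a b K : 0 <= a -> a <= b -> b <= T ->
  (forall t, a <= t <= b -> der_in q t (dq t)) ->
  (forall t, a <= t <= b -> `|dq t| <= K) -> `|q b - q a| <= K * (b - a).
Proof.
move=> a0; rewrite le_eqVlt => /orP[/eqP -> _ _ _|ab bT hd hK].
  by rewrite !subrr normr0 mulr0.
have cq : {within `[a, b], continuous q}.
  apply/continuous_within_itvP => //; split.
  - move=> t; rewrite in_itv/= => tab.
    have tI : a <= t <= b by move: tab => /andP[/ltW -> /ltW ->].
    apply/differentiable_continuous/derivable1_diffP.
    by have [] := is_derive_der_in a0 bT tab (hd t tI).
  - apply/cvgrPdist_le => e e0.
    have aI : a <= a <= b by rewrite lexx ltW.
    have [d d0 h] := der_in_cvg (hd a aI) e0.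
    near=> t; apply: h.
      have : a < t by near: t; exact: nbhs_right_gt.
      have : t < b by near: t; exact: nbhs_right_lt.
      by move=> ? ?; apply/andP; split; lra.
    have : a < t by near: t; exact: nbhs_right_gt.
    have : t < a + d by near: t; apply: nbhs_right_lt; rewrite ltrDl.
    by move=> ? ?; rewrite gtr0_norm; lra.
  - apply/cvgrPdist_le => e e0.
    have bI : a <= b <= b by rewrite lexx ltW.
    have [d d0 h] := der_in_cvg (hd b bI) e0.
    near=> t; apply: h.
      have : t < b by near: t; exact: nbhs_left_lt.
      have : a < t by near: t; exact: nbhs_left_gt.
      by move=> ? ?; apply/andP; split; lra.
    have : t < b by near: t; exact: nbhs_left_lt.
    have : b - d < t by near: t; apply: nbhs_left_gt; rewrite ltrBlDr ltrDl.
    by move=> ? ?; rewrite ltr0_norm; lra.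
have der x : x \in `]a, b[%R -> is_derive x 1 q (dq x).
  rewrite in_itv/= => xab; apply: (is_derive_der_in a0 bT xab); apply: hd.
  by move: xab => /andP[/ltW -> /ltW ->].
have [c cab ->] := MVT ab der cq.
rewrite normrM [`|b - a|]ger0_norm ?subr_ge0 ?(ltW ab)// ler_wpM2r ?subr_ge0 ?(ltW ab)// hK//.
by move: cab; rewrite in_itv/= => /andP[/ltW -> /ltW ->].
Unshelve. all: by end_near.
Qed.

(** ** Finite differences of a function with bounded third derivative *)

Variables (q0 q1 q2 q3 : R -> R) (Q : R).
Hypotheses (d0 : forall t, 0 <= t <= T -> der_in q0 t (q1 t))
           (d1 : forall t, 0 <= t <= T -> der_in q1 t (q2 t))
           (d2 : forall t, 0 <= t <= T -> der_in q2 t (q3 t)).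
Hypotheses (b1 : forall t, 0 <= t <= T -> `|q1 t| <= Q)
           (b2 : forall t, 0 <= t <= T -> `|q2 t| <= Q)
           (b3 : forall t, 0 <= t <= T -> `|q3 t| <= Q).

Let sub_itv (x y t : R) : 0 <= x -> y <= T -> x <= t <= y -> 0 <= t <= T.
Proof. by move=> x0 yT /andP[xt ty]; apply/andP; split; lra. Qed.

(** The base point [z] of the derivative may be anywhere between [x] and [y]:
    the second difference uses the right end and the left end of an interval. *)
Lemma taylor1 (f f1 f2 : R -> R) x y z : 0 <= x -> x <= y -> y <= T -> x <= z <= y ->
  (forall t, 0 <= t <= T -> der_in f t (f1 t)) ->
  (forall t, 0 <= t <= T -> der_in f1 t (f2 t)) ->
  (forall t, 0 <= t <= T -> `|f2 t| <= Q) ->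
  `|f y - f x - (y - x) * f1 z| <= Q * (y - x) ^+ 2.
Proof.
move=> x0 xy yT /andP[xz zy] hf hf1 hf2.
have Q0 : 0 <= Q by apply: le_trans (hf2 0 _); rewrite ?normr_ge0// lexx ltW.
have h := @der_in_mvt (fun t => f t - (t * f1 z + (t - x) ^+ 2 / 2 * 0))
  (fun t => f1 t - (f1 z + (t - x) * 0)) x y (Q * (y - x)) x0 xy yT.
have -> : f y - f x - (y - x) * f1 z =
  (f y - (y * f1 z + (y - x) ^+ 2 / 2 * 0)) - (f x - (x * f1 z + (x - x) ^+ 2 / 2 * 0)) by ring.
rewrite expr2 mulrA; apply: h => t tI.
  exact: der_in_sub_quadratic (hf t (sub_itv x0 yT tI)).
rewrite mulr0 addr0; move: tI => /andP[xt ty].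
have [tz|zt] := leP t z.
  rewrite distrC (le_trans (@der_in_mvt f1 f2 t z Q _ _ _ _ _))//; try lra.
  - by move=> v /andP[v1 v2]; apply: hf1; apply/andP; split; lra.
  - by move=> v /andP[v1 v2]; apply: hf2; apply/andP; split; lra.
  - by rewrite ler_wpM2l//; lra.
rewrite (le_trans (@der_in_mvt f1 f2 z t Q _ _ _ _ _))//; try lra.
- by move=> v /andP[v1 v2]; apply: hf1; apply/andP; split; lra.
- by move=> v /andP[v1 v2]; apply: hf2; apply/andP; split; lra.
- by rewrite ler_wpM2l//; lra.
Qed.

Lemma first_difference x y : 0 <= x -> x <= y -> y <= T ->
  `|q0 y - q0 x| <= Q * (y - x).
Proof.
move=> x0 xy yT; apply: (der_in_mvt x0 xy yT) => t tI.
  exact: d0 (sub_itv x0 yT tI).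
exact: b1 (sub_itv x0 yT tI).
Qed.

(** Two Taylor expansions about the middle point. *)
Lemma second_difference x h : 0 <= x -> 0 <= h -> x + h + h <= T ->
  `|q0 (x + h + h) - 2 * q0 (x + h) + q0 x| <= 2 * Q * h ^+ 2.
Proof.
move=> x0 h0 hT'.
have A := @taylor1 q0 q1 q2 (x + h) (x + h + h) (x + h) _ _ _ _ d0 d1 b2.
have B := @taylor1 q0 q1 q2 x (x + h) (x + h) _ _ _ _ d0 d1 b2.
have -> : q0 (x + h + h) - 2 * q0 (x + h) + q0 x =
  (q0 (x + h + h) - q0 (x + h) - (x + h + h - (x + h)) * q1 (x + h)) -
  (q0 (x + h) - q0 x - (x + h - x) * q1 (x + h)) by ring.
rewrite (le_trans (ler_normB _ _))//.
have -> : 2 * Q * h ^+ 2 = Q * (x + h + h - (x + h)) ^+ 2 + Q * (x + h - x) ^+ 2 by ring.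
rewrite lerD ?A ?B//; try lra; by apply/andP; split; lra.
Qed.

(** Compare the Taylor expansion of [q0] to degree two with that of [q1] to
    degree one: the terms in [q2 x] cancel. *)
Lemma trapezoid x y : 0 <= x -> x <= y -> y <= T ->
  `|q0 y - q0 x - (y - x) / 2 * (q1 x + q1 y)| <= 2 * Q * (y - x) ^+ 3.
Proof.
move=> x0 xy yT.
have Q0 : 0 <= Q by apply: le_trans (b1 _); [exact: normr_ge0 (q1 0)|rewrite lexx ltW].
have A t : x <= t <= y -> `|q1 t - q1 x - (t - x) * q2 x| <= Q * (t - x) ^+ 2.
  move=> /andP[xt ty]; apply: (@taylor1 q1 q2 q3) => //; try lra.
have h := @der_in_mvt (fun t => q0 t - (t * q1 x + (t - x) ^+ 2 / 2 * q2 x))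
  (fun t => q1 t - (q1 x + (t - x) * q2 x)) x y (Q * (y - x) ^+ 2) x0 xy yT.
have B : `|q0 y - q0 x - (y - x) * q1 x - (y - x) ^+ 2 / 2 * q2 x| <= Q * (y - x) ^+ 3.
  have -> : q0 y - q0 x - (y - x) * q1 x - (y - x) ^+ 2 / 2 * q2 x =
   (q0 y - (y * q1 x + (y - x) ^+ 2 / 2 * q2 x)) - (q0 x - (x * q1 x + (x - x) ^+ 2 / 2 * q2 x)) by ring.
  have -> : Q * (y - x) ^+ 3 = Q * (y - x) ^+ 2 * (y - x) by ring.
  apply: h => t tI; first exact: der_in_sub_quadratic (d0 (sub_itv x0 yT tI)).
  rewrite opprD addrA; apply: (le_trans (A t tI)).
  rewrite ler_wpM2l//; move: tI => /andP[xt ty]; rewrite lerXn2r ?nnegrE; lra.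
have -> : q0 y - q0 x - (y - x) / 2 * (q1 x + q1 y) =
   (q0 y - q0 x - (y - x) * q1 x - (y - x) ^+ 2 / 2 * q2 x) -
   (y - x) / 2 * (q1 y - q1 x - (y - x) * q2 x) by field.
rewrite (le_trans (ler_normB _ _))//.
have yI : x <= y <= y by rewrite xy lexx.
have c0 : 0 <= (y - x) / 2 by lra.
have := ler_wpM2l c0 (A y yI).
rewrite normrM (ger0_norm c0).
have -> : (y - x) / 2 * (Q * (y - x) ^+ 2) = Q * (y - x) ^+ 3 / 2 by field.
have : 0 <= Q * (y - x) ^+ 3 by rewrite mulr_ge0// exprn_ge0//; lra.
lra.
Qed.

End ScalarTime.

(** * Time regularity with values in a Sobolev space *)

Section TimeRegularity.
Variables (R : realType) (xL xR s T : R).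
Hypotheses (hx : xL < xR) (hT : 0 < T).

Local Notation Hs_le := (Hs_le xL xR s).
Local Notation cont w := (forall t, 0 <= t <= T -> continuous (w t)).
Implicit Types (w : R -> R -> R) (t e K B c : R).

Lemma Hs_continuous_le w t e : Hs_continuous_at xL xR s T w t -> 0 < e ->
  exists2 d : R, 0 < d & forall t', 0 <= t' <= T -> `|t' - t| < d ->
    Hs_le (fun x => w t' x - w t x) e.
Proof.
move=> h e0; have e0' : (0%E < e%:E)%E by rewrite lte_fin.
have := h _ (open_ereal_lt' e0').
move=> /nbhs_ballP[d /= d0 hd]; exists d => // t' t'I t'd.
apply: Hs_le_sqnorm; apply: ltW; apply: (hd t'); last by rewrite /= in_itv.
by rewrite /ball/= distrC.
Qed.

Lemma Hs_derive_le w t d e : is_Hs_derive xL xR s T w t d -> 0 < e ->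
  exists2 b : R, 0 < b & forall t', 0 <= t' <= T -> t' != t -> `|t' - t| < b ->
    Hs_le (fun x => (t' - t)^-1 * (w t' x - w t x) - d x) e.
Proof.
move=> h e0; have e0' : (0%E < e%:E)%E by rewrite lte_fin.
have := h _ (open_ereal_lt' e0').
move=> /nbhs_ballP[b /= b0 hb]; exists b => // t' t'I t'n t'b.
apply: Hs_le_sqnorm; apply: ltW; apply: (hb t') => //.
by rewrite /ball/= distrC.
Qed.

(** Compactness of the time interval, in the filter form: the bound is a
    natural number tending to infinity, and being bounded by it holds near
    every time. *)
Lemma Hs_le_locally_bounded w :
  (forall t, 0 <= t <= T -> exists d : R, exists B : R, 0 < d /\
    forall t', 0 <= t' <= T -> `|t' - t| < d -> Hs_le (w t') B) ->
  exists B : R, forall t, 0 <= t <= T -> Hs_le (w t) B.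
Proof.
move=> h.
have /compact_near_coveringP := @segment_compact R 0 T.
move=> /(_ nat \oo (fun i t => 0 <= t <= T -> Hs_le (w t) i%:R) _) near.
have [t|N _ hN] := near.
  rewrite /= in_itv/= => tI; have [d [B [d0 hd]]] := h t tI.
  have hB : \forall i \near \oo, B <= i%:R.
    exists (Num.bound `|B|) => // i /= Bi.
    apply: (le_trans (ler_norm B)); apply/ltW/(lt_le_trans (archi_boundP (normr_ge0 B))).
    by rewrite ler_nat.
  have ht : \forall t' \near t, `|t' - t| < d.
    by apply/nbhs_ballP; exists d => //= y; rewrite /ball/= distrC.
  near=> t' i => /= t'I.
  apply: (@Hs_leW _ _ _ _ _ B); first by near: i.
  apply: hd => //; near: t'; exact: ht.
exists N%:R => t tI; apply: (hN N) => //=; by rewrite in_itv.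
Unshelve. all: by end_near.
Qed.

(** Near a time where the derivative exists, the function is the value plus a
    bounded multiple of the difference quotient, hence locally bounded. Only
    the highest derivative needs its own continuity. *)
Lemma Hs_le_derive_bounded w d : cont w -> cont d ->
  (forall t, 0 <= t <= T -> exists B, Hs_le (w t) B) ->
  (forall t, 0 <= t <= T -> exists B, Hs_le (d t) B) ->
  (forall t, 0 <= t <= T -> is_Hs_derive xL xR s T w t (d t)) ->
  exists B : R, forall t, 0 <= t <= T -> Hs_le (w t) B.
Proof.
move=> cw cd hw hd der; apply: Hs_le_locally_bounded => t tI.
have [b b0 hb] := Hs_derive_le (der t tI) ltr01.
have [A hA] := hw t tI; have [D hD] := hd t tI.
have A0 := Hs_le_ge0 hA; have D0 := Hs_le_ge0 hD.
exists (Num.min b 1), (2 * A + 2 * (2 * 1 + 2 * D)); split.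
  by rewrite lt_min b0 ltr01.
move=> t' t'I; rewrite lt_min => /andP[t'b t'1].
have [->|t'n] := eqVneq t' t; first by apply: Hs_leW hA; lra.
have cq : continuous (fun x => (t' - t)^-1 * (w t' x - w t x) - d t x).
  apply: continuous_sub; last exact: cd.
  by apply: continuous_scale; apply: continuous_sub; exact: cw.
have cs : continuous (fun x => ((t' - t)^-1 * (w t' x - w t x) - d t x) + d t x).
  by apply: continuous_add => //; exact: cd.
have h1 := Hs_leD cq (cd t tI) (hb t' t'I t'n t'b) hD.
have h2 := Hs_leZ (t' - t) cs h1.
have := Hs_leD (cw t tI) (@continuous_scale _ (t' - t) _ cs) hA h2.
have -> : (fun x => w t x + (t' - t) * ((t' - t)^-1 * (w t' x - w t x) - d t x + d t x)) = w t'.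
  apply/funext => x; rewrite subrK mulVKf ?subr_eq0//; ring.
apply: Hs_leW; rewrite lerD2l ler_pM2l// ler_piMl//; first lra.
rewrite -[(t' - t) ^+ 2]real_normK ?num_real//.
by rewrite expr_le1// ?ltW.
Qed.

Lemma Hs_le_continuous_bounded w : cont w ->
  (forall t, 0 <= t <= T -> exists B, Hs_le (w t) B) ->
  (forall t, 0 <= t <= T -> Hs_continuous_at xL xR s T w t) ->
  exists B : R, forall t, 0 <= t <= T -> Hs_le (w t) B.
Proof.
move=> cw hw hc; apply: Hs_le_locally_bounded => t tI.
have [d d0 hd] := Hs_continuous_le (hc t tI) ltr01.
have [A hA] := hw t tI.
exists d, (2 * 1 + 2 * A); split => // t' t'I t'd.
have cq : continuous (fun x => w t' x - w t x) by apply: continuous_sub; exact: cw.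
have := Hs_leD cq (cw t tI) (hd t' t'I t'd) hA.
by congr Hs_le; apply/funext => x; rewrite subrK.
Qed.

(** Time regularity is used only through one bound on the norms of the
    solution and of its three derivatives, uniform on the time interval. *)
Lemma C3_bounds w : Cm_Hsp xL xR s T 3 w -> exists w1 w2 w3 B,
  [/\ forall t, 0 <= t <= T -> is_Hs_derive xL xR s T w t (w1 t),
      forall t, 0 <= t <= T -> is_Hs_derive xL xR s T w1 t (w2 t) &
      forall t, 0 <= t <= T -> is_Hs_derive xL xR s T w2 t (w3 t)] /\
  [/\ cont w, cont w1, cont w2 & cont w3] /\
  (forall t, 0 <= t <= T -> periodic (w t) (xR - xL) /\ Hsp xL xR s (w1 t)) /\
  forall t, 0 <= t <= T -> [/\ Hs_le (w t) B, Hs_le (w1 t) B, Hs_le (w2 t) B & Hs_le (w3 t) B].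
Proof.
move=> [h0 [w1 d0 [h1 [w2 d1 [h2 [w3 d2 [h3 c3]]]]]]].
have I t : 0 <= t <= T -> t \in `[0, T]%R by rewrite in_itv.
have fin (w' : R -> R -> R) : (forall t, t \in `[0, T]%R -> Hsp xL xR s (w' t)) ->
    forall t, 0 <= t <= T -> exists B, Hs_le (w' t) B.
  by move=> h t tI; apply: (Hs_le_Hsp hx); exact: h (I t tI).
have cts (w' : R -> R -> R) : (forall t, t \in `[0, T]%R -> Hsp xL xR s (w' t)) -> cont w'.
  by move=> h t tI; have [] := h t (I t tI).
have D0 t (tI : 0 <= t <= T) := d0 t (I t tI).
have D1 t (tI : 0 <= t <= T) := d1 t (I t tI).
have D2 t (tI : 0 <= t <= T) := d2 t (I t tI).
have C3 t (tI : 0 <= t <= T) := c3 t (I t tI).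
have [B0 hB0] := Hs_le_derive_bounded (cts _ h0) (cts _ h1) (fin _ h0) (fin _ h1) D0.
have [B1 hB1] := Hs_le_derive_bounded (cts _ h1) (cts _ h2) (fin _ h1) (fin _ h2) D1.
have [B2 hB2] := Hs_le_derive_bounded (cts _ h2) (cts _ h3) (fin _ h2) (fin _ h3) D2.
have [B3 hB3] := Hs_le_continuous_bounded (cts _ h3) (fin _ h3) C3.
exists w1, w2, w3, (`|B0| + `|B1| + `|B2| + `|B3|); split; first by [].
split; first by split; [exact: (cts _ h0)|exact: (cts _ h1)|exact: (cts _ h2)|exact: (cts _ h3)].
split; first by move=> t tI; have [] := h0 t (I t tI); split=> //; exact: h1 (I t tI).
have n0 := normr_ge0 B0; have n1 := normr_ge0 B1; have n2 := normr_ge0 B2; have n3 := normr_ge0 B3.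
move=> t tI; split; [move: (hB0 t tI)|move: (hB1 t tI)|move: (hB2 t tI)|move: (hB3 t tI)];
  apply: Hs_leW; (apply: (le_trans (ler_norm _)); lra).
Qed.

(** Bounded linear functionals turn derivatives in the Sobolev space into
    derivatives of scalar functions. All Taylor expansions in time are made
    for these scalar functions, and duality carries them back to grid vectors. *)
Lemma der_in_functional (ell : (R -> R) -> R) K w t (d : R -> R) :
  (forall f g : R -> R, continuous f -> continuous g ->
     ell (fun x => f x - g x) = ell f - ell g) ->
  (forall c (f : R -> R), continuous f -> ell (fun x => c * f x) = c * ell f) ->
  (forall (f : R -> R) B, continuous f -> Hs_le f B -> `|ell f| <= K * Num.sqrt B) ->
  0 <= t <= T -> cont w -> continuous d ->
  is_Hs_derive xL xR s T w t d -> der_in T (fun t => ell (w t)) t (ell d).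
Proof.
move=> ellB ellZ ell_le tI cw cd der e e0.
have K1 : 0 < 1 + `|K| by rewrite ltr_pwDl.
have e1 : 0 < (e / (1 + `|K|)) ^+ 2 by rewrite exprn_gt0// divr_gt0.
have [b b0 hb] := Hs_derive_le der e1.
exists b => // t' t'I t'b.
have [->|t'n] := eqVneq t' t.
  by rewrite !subrr mul0r subr0 normr0 mulr0.
have cdf : continuous (fun x => w t' x - w t x) by apply: continuous_sub; exact: cw.
have cq : continuous (fun x => (t' - t)^-1 * (w t' x - w t x) - d x).
  by apply: continuous_sub => //; exact: continuous_scale.
have := ell_le _ _ cq (hb t' t'I t'n t'b).
rewrite ellB//; last exact: continuous_scale.
rewrite ellZ// ellB; [|exact: cw|exact: cw].
rewrite sqrtr_sqr [`|e / _|]ger0_norm ?divr_ge0 ?(ltW e0) ?(ltW K1)// => h.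
have tt0 : t' - t != 0 by rewrite subr_eq0.
have -> : ell (w t') - ell (w t) - (t' - t) * ell d =
   (t' - t) * ((t' - t)^-1 * (ell (w t') - ell (w t)) - ell d) by field.
rewrite normrM mulrC ler_wpM2r//; apply: (le_trans h).
rewrite mulrCA ger_pMr// ler_pdivrMr// mul1r.
by have := ler_norm K; lra.
Qed.

End TimeRegularity.

(** * The truncated exact solution on the grid *)

Section WeakForm.
Variables (R : realType) (xL xR a sigma gamma T r : R).
Hypotheses (hx : xL < xR) (hT : 0 < T) (hr : 0 <= r).

Lemma Hs_le_coef (f : R -> R) B k : Hs_le xL xR (r + 1) f B -> coef2 xL xR f k <= B.
Proof.
move=> h; apply: le_trans (h `|k|%N).
rewrite (bigD1_seq k) ?mem_zs ?zs_uniq//=.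
apply: (@le_trans _ _ (jap xL xR k `^ (r + 1) * coef2 xL xR f k)).
  have := ler_powR (jap_ge1 xL xR k) (addr_ge0 hr ler01); rewrite powRr0 => p1.
  by rewrite ler_peMl ?coef2_ge0.
by rewrite lerDl; apply: sumr_ge0 => i _; rewrite mulr_ge0 ?powR_ge0 ?coef2_ge0.
Qed.

(** The Fourier coefficients are bounded functionals, hence both candidates
    have the same coefficients, and continuous functions with the same
    coefficients agree. *)
Lemma Hs_derive_unique (w : R -> R -> R) t (d d' : R -> R) : 0 <= t <= T ->
  (forall t, 0 <= t <= T -> continuous (w t)) ->
  Hsp xL xR (r + 1) d -> Hsp xL xR (r + 1) d' ->
  is_Hs_derive xL xR (r + 1) T w t d -> is_Hs_derive xL xR (r + 1) T w t d' ->
  forall x, xL <= x <= xR -> d x = d' x.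
Proof.
move=> tI cw [cd pd _] [cd' pd' _] h h'.
have bnd (c e B : R) : c ^+ 2 + e ^+ 2 <= B -> `|c| <= 1 * Num.sqrt B.
  by move=> cB; rewrite mul1r -sqrtr_sqr ler_wsqrtr// (le_trans _ cB)// lerDl sqr_ge0.
have ec k : ccoef xL xR d k = ccoef xL xR d' k.
  have D f : continuous f -> is_Hs_derive xL xR (r + 1) T w t f ->
      der_in T (fun t => ccoef xL xR (w t) k) t (ccoef xL xR f k).
    move=> cf; apply: (der_in_functional (ell := fun f => ccoef xL xR f k) (K := 1)) => //.
    - by move=> *; exact: ccoefB.
    - by move=> *; exact: ccoefZ.
    - by move=> g B _ hB; exact: (bnd _ _ _ (Hs_le_coef k hB)).
  exact: (der_in_unique hT tI (D d cd h) (D d' cd' h')).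
have es k : scoef xL xR d k = scoef xL xR d' k.
  have D f : continuous f -> is_Hs_derive xL xR (r + 1) T w t f ->
      der_in T (fun t => scoef xL xR (w t) k) t (scoef xL xR f k).
    move=> cf; apply: (der_in_functional (ell := fun f => scoef xL xR f k) (K := 1)) => //.
    - by move=> *; exact: scoefB.
    - by move=> *; exact: scoefZ.
    - by move=> g B _ hB; have := Hs_le_coef k hB; rewrite coef2E addrC; exact: bnd.
  exact: (der_in_unique hT tI (D d cd h) (D d' cd' h')).
move=> x xI; apply/eqP; rewrite -subr_eq0 -normr_eq0; apply/eqP/le_anti.
rewrite normr_ge0 andbT.
have := @sup_le_coef2 R xL xR hx (fun x => d x - d' x) 0 (continuous_sub cd cd') _ _ _ x xI.
rewrite mulr0 sqrtr0; apply => //.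
  by move=> y; rewrite pd pd'.
move=> m; rewrite big1// => k _.
by rewrite coef2E ccoefB// scoefB// ec es !subrr expr0n addr0 mulr0.
Qed.

(** The time derivative in the equation and the one provided by the regularity
    of the solution are two derivatives of the same function, hence equal. *)
Lemma weak_form (u : R -> R -> R) (u0 : R -> R) (w1 : R -> R -> R) t n p q :
  RLW_solution xL xR a sigma gamma T (r + 1) u0 u ->
  (forall t, 0 <= t <= T -> continuous (fun x => u x t)) ->
  Hsp xL xR (r + 1) (w1 t) -> 0 <= t <= T ->
  is_Hs_derive xL xR (r + 1) T (fun t x => u x t) t (w1 t) ->
  mean xL xR (fun x => w1 t x * trig xL xR n p q x) -
  sigma * mean xL xR (fun x => w1 t x * (trig xL xR n p q)^`(2)%classic x) =
  mean xL xR (fun x => (a * u x t + gamma / 2 * u x t ^+ 2) * (trig xL xR n p q)^`()%classic x).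
Proof.
move=> [_ _ hu] cu hw1 tI dw1.
have [|ut [hut dut wf]] := hu t; first by rewrite in_itv.
have eqd := Hs_derive_unique tI cu hut hw1 dut dw1.
have := wf _ (smooth_periodic_trig hx n p q).
rewrite derive1_trig derive2_trig.
set f := trig _ _ _ _ _; set f1 := trig _ _ _ _ _; set f2 := trig _ _ _ _ _.
have cf : continuous f by exact: continuous_trig.
have cf1 : continuous f1 by exact: continuous_trig.
have cf2 : continuous f2 by exact: continuous_trig.
have [cw1 _ _] := hw1.
have cut := cu t tI.
set I := Rintegral _ _ _ => I0.
have : mean xL xR (fun x => (w1 t x * f x - sigma * (w1 t x * f2 x)) -
    (a * u x t + gamma / 2 * u x t ^+ 2) * f1 x) = 0.
  rewrite /mean -[RHS](mulr0 (xR - xL)^-1) -I0; congr (_ * _); apply: eq_Rintegral => x.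
  rewrite inE/= in_itv/= => xI; rewrite (eqd x xI); ring.
have c1 : continuous (fun x => w1 t x * f x) by exact: continuous_mul.
have c2 : continuous (fun x => w1 t x * f2 x) by exact: continuous_mul.
have c3 : continuous (fun x => sigma * (w1 t x * f2 x)) by exact: continuous_scale.
have c4 : continuous (fun x => a * u x t + gamma / 2 * u x t ^+ 2).
  by apply: continuous_add; apply: continuous_scale => //; exact: continuous_sqr.
rewrite (meanB _ _ (continuous_sub c1 c3) (continuous_mul c4 cf1)).
rewrite (meanB _ _ c1 c3) (meanZ _ _ sigma c2) => /eqP.
by rewrite subr_eq0 => /eqP.
Qed.

End WeakForm.

Section Residual.
Variables (R : realType) (xL xR sigma r : R).
Hypotheses (hx : xL < xR) (hs : 0 < sigma) (hr : 0 <= r).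
Variables (N n M : nat).
Hypotheses (hN : N = n.*2) (hn : (0 < n)%N) (hM : (M.*2 < n)%N) (NM : (N <= 4 * M.+1)%N).

Local Notation mu := (wavenumber xL xR).
Local Notation L := (xR - xL).
Local Notation mean := (mean xL xR).
Local Notation trig := (trig xL xR).
Local Notation ccoef := (ccoef xL xR).
Local Notation scoef := (scoef xL xR).
Local Notation jap := (jap xL xR).
Local Notation Hs_le := (Hs_le xL xR (r + 1)).
Local Notation trunc := (trunc xL xR M).
Local Notation gvec := (gvec xL xR N).
Local Notation gcos := (gcos xL xR).
Local Notation gsin := (gsin xL xR).
Local Notation ip := (ip xL xR sigma).
Local Notation nrm := (nrm xL xR sigma).
Local Notation ew := (ew xL xR sigma).
Local Notation D1 := (fourier_diff xL xR N 1).
Local Notation rate := (rate xL xR r N).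
Implicit Types (f g : R -> R) (U V psi : 'cV[R]_N) (B : R).

(** The energy pairing of [psi] with the grid values of the truncation of [f],
    written as a functional of [f]: it is linear and bounded for the Sobolev
    norm. *)
Definition ell psi f : R :=
  \sum_(k <- zs M) ew k * (ccoef f k * gcos psi k + scoef f k * gsin psi k).

Lemma gvec_mean_cos (f : R -> R) d k : trigdeg xL xR d f -> (d + `|k| < N)%N ->
  gcos (gvec f) k = ccoef f k.
Proof.
move=> tf dk; have := gmean_trigdeg hx hN hn dk (trigdegM tf (trigdeg_cosk xL xR (leqnn `|k|))).
rewrite -/(ccoef f k) => <-; congr (_ * _); apply: eq_bigr => j _; by rewrite mxE.
Qed.

Lemma gvec_mean_sin (f : R -> R) d k : trigdeg xL xR d f -> (d + `|k| < N)%N ->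
  gsin (gvec f) k = scoef f k.
Proof.
move=> tf dk; have := gmean_trigdeg hx hN hn dk (trigdegM tf (trigdeg_sink xL xR (leqnn `|k|))).
rewrite -/(scoef f k) => <-; congr (_ * _); apply: eq_bigr => j _; by rewrite mxE.
Qed.

Lemma trigdeg_trunc f : trigdeg xL xR M (trunc f).
Proof. exact: trigdeg_trig. Qed.

Lemma gcos_trunc f k : (`|k| <= n)%N ->
  gcos (gvec (trunc f)) k = if (`|k| <= M)%N then ccoef f k else 0.
Proof.
move=> kn; rewrite (gvec_mean_cos (trigdeg_trunc f)) ?(ccoef_trunc hx)//.
by move: hN hM kn; clear; lia.
Qed.

Lemma gsin_trunc f k : continuous f -> (`|k| <= n)%N ->
  gsin (gvec (trunc f)) k = if (`|k| <= M)%N then scoef f k else 0.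
Proof.
move=> cf kn; rewrite (gvec_mean_sin (trigdeg_trunc f)) ?(scoef_trunc hx)//.
by move: hN hM kn; clear; lia.
Qed.

Lemma ltMn : (M < n)%N.
Proof. by move: hM; clear; lia. Qed.

(** Below the Nyquist frequency the discrete coefficients of the truncation
    are its Fourier coefficients. *)
Lemma ip_trunc f psi : continuous f -> ip (gvec (trunc f)) psi = ell psi f.
Proof.
move=> cf; rewrite (ipE hx hN hn) /ell.
pose F k := if (`|k| <= M)%N then
   ew k * (ccoef f k * gcos psi k + scoef f k * gsin psi k) else 0.
have F0 k : (M < `|k|)%N -> F k = 0 by rewrite /F ltnNge => /negbTE ->.
transitivity (\sum_(k <- zs n) F k).
  rewrite big_seq [RHS]big_seq; apply: eq_bigr => k; rewrite mem_zs => kn.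
  rewrite gcos_trunc// gsin_trunc// /F; case: ifP => kM; last by rewrite !mul0r addr0 mulr0.
  by rewrite (cw_eq1 R hN (leq_ltn_trans kM ltMn)) mul1r.
rewrite (sum_zs_restrict (ltnW ltMn) F0).
by rewrite big_seq [RHS]big_seq; apply: eq_bigr => k; rewrite mem_zs /F => ->.
Qed.

Lemma ew_le_jap k : ew k <= (1 + sigma) * jap k.
Proof.
rewrite /ew japE; have := sqr_ge0 (k%:~R * mu); set q := _ ^+ 2 => q0.
by have := hs; lra.
Qed.

Lemma jap_le_powR k : jap k <= jap k `^ (r + 1).
Proof.
rewrite -[leLHS]powRr1 ?(ltW (jap_gt0 _ _ _))//.
by apply: ler_powR; [exact: jap_ge1|rewrite lerDr].
Qed.

Lemma ell_le psi f B : Hs_le f B ->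
  `|ell psi f| <= Num.sqrt ((1 + sigma) * B) * nrm psi.
Proof.
move=> hB; have B0 := Hs_le_ge0 hB.
have s1 : 0 <= 1 + sigma by rewrite addr_ge0// ltW.
have e0 k : 0 <= ew k by exact/ltW/ew_gt0.
apply: ler_of_sqr; first by rewrite mulr_ge0 ?sqrtr_ge0.
rewrite exprMn sqr_sqrtr ?mulr_ge0// (nrm_sq hx hN hn hs).
apply: (le_trans (cauchy_schwarz_sum _ _ _ _ _ e0)).
apply: ler_pM.
- by apply: sumr_ge0 => k _; rewrite mulr_ge0// addr_ge0 ?sqr_ge0.
- by apply: sumr_ge0 => k _; rewrite mulr_ge0// addr_ge0 ?sqr_ge0.
- apply: le_trans (ler_wpM2l s1 (hB M)); rewrite mulr_sumr; apply: ler_sum => k _.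
  rewrite -coef2E mulrA ler_wpM2r ?coef2_ge0// (le_trans (ew_le_jap k))//.
  by rewrite ler_wpM2l// jap_le_powR.
- rewrite (ipE hx hN hn).
  apply: (@le_trans _ _ (\sum_(k <- zs M) cw R N k * ew k * (gcos psi k * gcos psi k + gsin psi k * gsin psi k))).
    rewrite big_seq [leRHS]big_seq; apply: ler_sum => k; rewrite mem_zs => kM.
    by rewrite (cw_eq1 R hN (leq_ltn_trans kM ltMn)) mul1r -!expr2.
  apply: sum_zs_le_mono; first exact: ltnW ltMn.
  move=> k; apply: mulr_ge0; first exact: mulr_ge0 (cw_ge0 _ _ _) (e0 k).
  by rewrite -!expr2 addr_ge0 ?sqr_ge0.
Qed.

Lemma ellB psi f g : continuous f -> continuous g ->
  ell psi (fun x => f x - g x) = ell psi f - ell psi g.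
Proof.
move=> cf cg; rewrite /ell -sumrB; apply: eq_bigr => k _.
by rewrite ccoefB// scoefB//; ring.
Qed.

Lemma ellZ psi c f : continuous f -> ell psi (fun x => c * f x) = c * ell psi f.
Proof.
move=> cf; rewrite /ell mulr_sumr; apply: eq_bigr => k _.
by rewrite ccoefZ// scoefZ//; ring.
Qed.

Lemma nrm_trunc f B : continuous f -> Hs_le f B ->
  nrm (gvec (trunc f)) <= Num.sqrt ((1 + sigma) * B).
Proof.
move=> cf hB; apply: (nrm_dual hx hN hn hs); first exact: sqrtr_ge0.
move=> V; rewrite ip_trunc//; exact: le_trans (ler_norm _) (ell_le V hB).
Qed.

(** The quadratic form [t ^ 2 * F - 2 * t * u * C + u ^ 2 * G] is nonnegative. *)
Lemma mean_cs f g : continuous f -> continuous g ->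
  mean (fun x => f x * g x) ^+ 2 <= mean (fun x => f x ^+ 2) * mean (fun x => g x ^+ 2).
Proof.
move=> cf cg.
set C := mean (fun x => f x * g x).
set F := mean (fun x => f x ^+ 2); set G := mean (fun x => g x ^+ 2).
have cff := continuous_sqr cf; have cgg := continuous_sqr cg.
have cfg := continuous_mul cf cg.
have key t u : 0 <= t ^+ 2 * F + (- (2 * t * u) * C + u ^+ 2 * G).
  have c1 : continuous (fun x => - (2 * t * u) * (f x * g x) + u ^+ 2 * g x ^+ 2).
    by apply: continuous_add; exact: continuous_scale.
  have -> : t ^+ 2 * F + (- (2 * t * u) * C + u ^+ 2 * G) =
      mean (fun x => t ^+ 2 * f x ^+ 2 + (- (2 * t * u) * (f x * g x) + u ^+ 2 * g x ^+ 2)).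
    rewrite (meanD _ _ (continuous_scale cff) c1).
    rewrite (meanD _ _ (continuous_scale cfg) (continuous_scale cgg)).
    by rewrite (meanZ _ _ (t ^+ 2) cff) (meanZ _ _ _ cfg) (meanZ _ _ _ cgg).
  rewrite -[leLHS](mean_cst hx); apply: (ler_mean hx).
  - exact: cst_continuous.
  - by apply: continuous_add => //; exact: continuous_scale.
  - move=> x _.
    have -> : t ^+ 2 * f x ^+ 2 + (- (2 * t * u) * (f x * g x) + u ^+ 2 * g x ^+ 2) =
       (t * f x - u * g x) ^+ 2 by ring.
    exact: sqr_ge0.
have G0 : 0 <= G.
  by have := key 0 1; rewrite expr0n/= !mul0r mulr0 mul0r oppr0 mul0r !add0r expr1n mul1r.
have [GE|Gneq] := eqVneq G 0.
  have [C0|Cn] := eqVneq C 0; first by rewrite C0 GE expr0n/= mulr0.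
  have := key 1 ((F + 1) / C); rewrite GE mulr0 addr0.
  have F0 : 0 <= F by have := key 1 0; rewrite expr1n mul1r expr0n/= !mulr0 oppr0 !mul0r !addr0.
  have -> : 1 ^+ 2 * F + - (2 * 1 * ((F + 1) / C)) * C = - F - 2 by field.
  by lra.
have Gp : 0 < G by rewrite lt_neqAle eq_sym Gneq.
have := key G C.
have -> : G ^+ 2 * F + (- (2 * G * C) * C + C ^+ 2 * G) = G * (F * G - C ^+ 2) by ring.
by rewrite pmulr_rge0// subr_ge0.
Qed.

(** The end frequencies count with the square of their weight in the mean, and
    with the weight itself in the energy norm. *)
Lemma mean_interp_derive_le psi :
  mean (fun x => (interp xL xR n psi)^`()%classic x ^+ 2) <= sigma^-1 * ip psi psi.
Proof.
rewrite /interp derive1_trig; set p' := fun k => _ * (_ * gsin psi k); set q' := fun k => - _.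
have pN (k : int) : p' (- k) = p' k.
  by rewrite /p' cwN gsinN mulrNz !mulNr mulrN mulrN opprK.
have qN (k : int) : q' (- k) = - q' k.
  by rewrite /q' cwN gcosN mulrNz !mulNr.
have -> : (fun x => trig n p' q' x ^+ 2) = (fun x => trig n p' q' x * trig n p' q' x).
  by apply/funext => x; rewrite expr2.
rewrite (mean_trigM hx); last exact: continuous_trig.
rewrite (ipE hx hN hn) mulr_sumr big_seq [leRHS]big_seq; apply: ler_sum => k.
rewrite mem_zs => kn; rewrite (ccoef_trig hx)// (scoef_trig hx)// kn /p' /q' /ew.
have c0 := cw_ge0 R N k; have c1 := cw_le1 R N k.
have s1 : sigma^-1 * sigma = 1 by rewrite mulVf// gt_eqF.
have si : 0 <= sigma^-1 by rewrite invr_ge0 ltW.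
move: (k%:~R * mu) (gcos psi k) (gsin psi k) (cw R N k) c0 c1 => y c' s' v c0 c1.
have -> : sigma^-1 * (v * (1 + sigma * y ^+ 2) * (c' * c' + s' * s')) =
  sigma^-1 * (v * (c' ^+ 2 + s' ^+ 2)) + sigma^-1 * sigma * (v * (y ^+ 2 * (c' ^+ 2 + s' ^+ 2))) by ring.
have z0 : 0 <= y ^+ 2 * (c' ^+ 2 + s' ^+ 2).
  by apply: mulr_ge0; rewrite ?addr_ge0 ?sqr_ge0.
have : 0 <= sigma^-1 * (v * (c' ^+ 2 + s' ^+ 2)).
  by apply: mulr_ge0 => //; apply: mulr_ge0 => //; rewrite addr_ge0 ?sqr_ge0.
have -> : y * (v * s') * (y * (v * s')) + - (y * (v * c')) * - (y * (v * c')) =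
  v * (v * (y ^+ 2 * (c' ^+ 2 + s' ^+ 2))) by ring.
have : v * (v * (y ^+ 2 * (c' ^+ 2 + s' ^+ 2))) <= v * (y ^+ 2 * (c' ^+ 2 + s' ^+ 2)).
  by rewrite ler_wpM2l// ler_piMl.
by rewrite s1; lra.
Qed.

(** The integrand has degree less than [N], so the quadrature is exact. *)
Lemma dot_D1_mean f d psi : trigdeg xL xR d f -> (d + n < N)%N ->
  dot (gvec f) (D1 *m psi) = mean (fun x => f x * (interp xL xR n psi)^`()%classic x).
Proof.
move=> tf dn; rewrite /interp derive1_trig.
rewrite -(gmean_trigdeg hx hN hn dn (trigdegM tf (trigdeg_trig xL xR n _ _))).
congr (_ * _); apply: eq_bigr => j _; rewrite (mul_D1 _ _ hN) mxE; congr (_ * _).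
by apply: eq_bigr => k _; congr (_ * _ + _ * _); ring.
Qed.

(** The product rule holds exactly on the grid, since twice the truncation
    degree stays below the Nyquist frequency. *)
Lemma D1_had_trunc f : let V := gvec (trunc f) in
  D1 *m had V V = 2 *: had V (D1 *m V).
Proof.
move=> V; pose v' := trig M (fun k => k%:~R * mu * scoef f k) (fun k => - (k%:~R * mu * ccoef f k)).
have dv (x : R) : is_derive x 1 (trunc f) (v' x) by exact: is_derive_trig.
have -> : D1 *m V = gvec v'.
  by apply: (D1_gvec hx hN hn ltMn (trigdeg_trunc f)).
have -> : had V V = gvec (fun x => trunc f x * trunc f x).
  by apply/matrixP => j l; rewrite (ord1 l) hadE !mxE.
have MM : (M + M < n)%N by rewrite addnn.
have -> : D1 *m gvec (fun x => trunc f x * trunc f x) = gvec (fun x => 2 * (trunc f x * v' x)).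
  apply: (D1_gvec hx hN hn MM (trigdegM (trigdeg_trunc f) (trigdeg_trunc f))) => x.
  apply: (is_derive_eq (is_deriveM (dv x) (dv x))).
  by rewrite /GRing.scale/=; ring.
by apply/matrixP => j l; rewrite (ord1 l) [RHS]mxE hadE !mxE.
Qed.

(** On a truncated function the skew-symmetric matrix form reproduces the weak
    form of the conservation law exactly: the product rule holds on the grid
    and the quadrature is exact for the square of the truncation, of degree [2
    * M], times the interpolant, of degree [n]. *)
Lemma dot_DU_trunc (a gamma : R) f psi : let V := gvec (trunc f) in
  dot (DU xL xR a gamma V *m V) psi =
  - mean (fun x => (a * trunc f x + gamma / 2 * trunc f x ^+ 2) * (interp xL xR n psi)^`()%classic x).
Proof.
move=> V; rewrite DU_mul dotDl !dotZl (dot_D1_skew xL xR hN) (dot_bil xL xR hN).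
have -> : dot (D1 *m V) (had V psi) = - 2^-1 * dot (had V V) (D1 *m psi).
  rewrite -dot_had -[had V (D1 *m V)](scalerK (a := 2)) ?pnatr_eq0// -D1_had_trunc.
  by rewrite dotZl (dot_D1_skew xL xR hN); ring.
have -> : had V V = gvec (fun x => trunc f x * trunc f x).
  by apply/matrixP => j l; rewrite (ord1 l) hadE !mxE.
have dn1 : (M + n < N)%N by move: hN hM; clear; lia.
have dn2 : (M + M + n < N)%N by move: hN hM; clear; lia.
rewrite (dot_D1_mean psi (trigdeg_trunc f) dn1).
rewrite (dot_D1_mean psi (trigdegM (trigdeg_trunc f) (trigdeg_trunc f)) dn2).
set f1 := (_^`())%classic.
have cf1 : continuous f1 by rewrite /f1 /interp derive1_trig; exact: continuous_trig.
have ct := @continuous_trunc R xL xR M f.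
have c1 : continuous (fun x => trunc f x * f1 x) by exact: continuous_mul.
have c2 : continuous (fun x => trunc f x * trunc f x * f1 x).
  by apply: continuous_mul => //; exact: continuous_mul.
have -> : (fun x => (a * trunc f x + gamma / 2 * trunc f x ^+ 2) * f1 x) =
   (fun x => a * (trunc f x * f1 x) + gamma / 2 * (trunc f x * trunc f x * f1 x)).
  by apply/funext => x; ring.
rewrite (meanD _ _ (continuous_scale c1) (continuous_scale c2)).
by rewrite (meanZ _ _ a c1) (meanZ _ _ (gamma / 2) c2); field.
Qed.

Lemma Hs_le_trunc f B : continuous f -> Hs_le f B -> Hs_le (trunc f) B.
Proof.
move=> cf hB m; apply: le_trans (hB m); apply: ler_sum => k _.
rewrite ler_wpM2l ?powR_ge0// !coef2E (ccoef_trunc hx) (scoef_trunc hx)//.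
by case: ifP => _; rewrite ?expr0n/= ?addr0// addr_ge0 ?sqr_ge0.
Qed.

Definition supc B : R := Num.sqrt ((1 + 4 / mu ^+ 2) * B).
(** The first term bounds the tail of the time derivative, the second one the
    tail in the nonlinear flux. *)
Definition resc (a gamma B : R) : R :=
  Num.sqrt ((1 + sigma) * B) + (a + gamma * supc B) * supc B * Num.sqrt sigma^-1.

(** Test the equation with the interpolant of [psi]: the discrete residual
    differs from it only by the tails of the time derivative and of the flux.
    The residual is a functional bounded in the energy norm, so its one
    derivative falls on the interpolant and not on the tail. *)
Lemma residual_le (a gamma : R) f f1 B psi : 0 <= a -> 0 <= gamma ->
  continuous f -> periodic f L -> continuous f1 -> Hs_le f B -> Hs_le f1 B ->
  (forall p q, mean (fun x => f1 x * trig n p q x) -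
     sigma * mean (fun x => f1 x * (trig n p q)^`(2)%classic x) =
     mean (fun x => (a * f x + gamma / 2 * f x ^+ 2) * (trig n p q)^`()%classic x)) ->
  `|ip (gvec (trunc f1)) psi + dot (DU xL xR a gamma (gvec (trunc f)) *m gvec (trunc f)) psi|
  <= resc a gamma B * rate * nrm psi.
Proof.
move=> a0 g0 cf pf cf1 hB hB1 weak; have B0 := Hs_le_ge0 hB.
have rate0 := rate_ge0 xL xR r N.
have := weak (fun k => cw R N k * gcos psi k) (fun k => cw R N k * gsin psi k).
rewrite -/(interp xL xR n psi) {2}/interp derive2_trig /interp !(mean_trigM hx)//.
rewrite -/(interp xL xR n psi) mulr_sumr -sumrB => W.
set phi := (interp xL xR n psi)^`()%classic in W *.
have cphi : continuous phi by rewrite /phi /interp derive1_trig; exact: continuous_trig.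
rewrite ip_trunc// dot_DU_trunc -/phi.
set F := \sum_(k <- zs n) _ in W.
have FE : F = \sum_(k <- zs n) cw R N k * ew k * (ccoef f1 k * gcos psi k + scoef f1 k * gsin psi k).
  by apply: eq_bigr => k _; rewrite /ew; ring.
pose Y k := if (M < `|k|)%N then 1 else 0 : R.
have split : F - ell psi f1 = \sum_(k <- zs n) cw R N k * ew k *
    ((Y k * ccoef f1 k) * gcos psi k + (Y k * scoef f1 k) * gsin psi k).
  rewrite FE -ip_trunc// (ipE hx hN hn) -sumrB big_seq [RHS]big_seq; apply: eq_bigr => k.
  rewrite mem_zs => kn; rewrite gcos_trunc// gsin_trunc// /Y ltnNge.
  by case: ifP => _ /=; ring.
have tail : `|F - ell psi f1| <= Num.sqrt ((1 + sigma) * B) * rate * nrm psi.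
  rewrite split; apply: ler_of_sqr.
    by apply: mulr_ge0 (nrm_ge0 _ _ _ _); exact: mulr_ge0 (sqrtr_ge0 _) rate0.
  have s1 : 0 <= 1 + sigma by rewrite addr_ge0// ltW.
  have ce k : 0 <= cw R N k * ew k by rewrite mulr_ge0 ?cw_ge0// ltW// ew_gt0.
  have -> : (Num.sqrt ((1 + sigma) * B) * rate * nrm psi) ^+ 2 =
      (1 + sigma) * (rate ^+ 2 * B) * ip psi psi.
    rewrite -(nrm_sq hx hN hn hs) [LHS]exprMn [X in X * _ = _]exprMn.
    by rewrite sqr_sqrtr ?mulr_ge0//; ring.
  apply: (le_trans (cauchy_schwarz_sum _ _ _ _ _ ce)).
  apply: ler_pM.
  - by apply: sumr_ge0 => k _; rewrite mulr_ge0// addr_ge0 ?sqr_ge0.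
  - by apply: sumr_ge0 => k _; rewrite mulr_ge0// addr_ge0 ?sqr_ge0.
  - apply: le_trans (ler_wpM2l s1 (tail_le hx hr hN hn NM n hB1)).
    rewrite mulr_sumr; apply: ler_sum => k _; rewrite /Y; case: ifP => _.
      rewrite !mul1r -coef2E mulrA ler_wpM2r ?coef2_ge0//.
      apply: le_trans (ew_le_jap k); rewrite ler_piMl ?cw_le1//; exact/ltW/ew_gt0.
    by rewrite !mul0r expr0n/= addr0 !mulr0.
  - by rewrite (ipE hx hN hn); under [in leRHS]eq_bigr do rewrite -!expr2.
have ct := @continuous_trunc R xL xR M f.
pose g x := (a * f x + gamma / 2 * f x ^+ 2) - (a * trunc f x + gamma / 2 * trunc f x ^+ 2).
have c1 : continuous (fun x => a * f x + gamma / 2 * f x ^+ 2).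
  by apply: continuous_add; apply: continuous_scale => //; exact: continuous_sqr.
have c2 : continuous (fun x => a * trunc f x + gamma / 2 * trunc f x ^+ 2).
  by apply: continuous_add; apply: continuous_scale => //; exact: continuous_sqr.
have cg : continuous g by exact: continuous_sub.
have S0 : 0 <= supc B by exact: sqrtr_ge0.
have gle x : xL <= x <= xR -> `|g x| <= (a + gamma * supc B) * supc B * rate.
  move=> xI.
  have h1 := sup_le_Hs hx hr cf pf hB xI; rewrite -/(supc B) in h1.
  have h2 : `|trunc f x| <= supc B.
    apply: (sup_le_Hs hx hr ct _ (Hs_le_trunc cf hB) xI).
    by move=> y; exact: trig_period.
  have h3 := sup_sub_trunc hx hr hN hn NM cf pf hB xI; rewrite -/(supc B) in h3.
  have -> : g x = (a + gamma / 2 * (f x + trunc f x)) * (f x - trunc f x) by rewrite /g; ring.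
  rewrite normrM -[leRHS]mulrA; apply: ler_pM => //.
  rewrite (le_trans (ler_normD _ _))// (ger0_norm a0) lerD2l normrM.
  rewrite ger0_norm ?divr_ge0//.
  have : `|f x + trunc f x| <= 2 * supc B by rewrite (le_trans (ler_normD _ _))//; lra.
  have g2 : 0 <= gamma / 2 by rewrite divr_ge0.
  by move/(ler_wpM2l g2); lra.
have G0 : 0 <= (a + gamma * supc B) * supc B * rate.
  by apply: mulr_ge0 => //; apply: mulr_ge0 => //; rewrite addr_ge0 ?mulr_ge0.
have mg : `|mean (fun x => g x * phi x)| <=
    (a + gamma * supc B) * supc B * rate * (Num.sqrt sigma^-1 * nrm psi).
  apply: ler_of_sqr; first by apply: mulr_ge0 => //; rewrite mulr_ge0 ?sqrtr_ge0.
  rewrite [leRHS]exprMn; apply: (le_trans (mean_cs cg cphi)).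
  have m0 (h : R -> R) : continuous h -> 0 <= mean (fun x => h x ^+ 2).
    move=> ch; rewrite -[leLHS](mean_cst hx); apply: (ler_mean hx).
    - exact: cst_continuous.
    - exact: continuous_sqr.
    - by move=> x _; exact: sqr_ge0.
  apply: ler_pM; [exact: m0|exact: m0| |].
    rewrite -[leRHS](mean_cst hx); apply: (ler_mean hx); first exact: continuous_sqr.
      exact: cst_continuous.
    by move=> x xI; rewrite -[leLHS]real_normK ?num_real// lerXn2r ?nnegrE ?gle.
  rewrite exprMn sqr_sqrtr ?invr_ge0 ?(ltW hs)// (nrm_sq hx hN hn hs).
  exact: mean_interp_derive_le.
have -> : ell psi f1 - mean (fun x => (a * trunc f x + gamma / 2 * trunc f x ^+ 2) * phi x) =
    mean (fun x => g x * phi x) - (F - ell psi f1).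
  rewrite W.
  have -> : (fun x => g x * phi x) = (fun x => (a * f x + gamma / 2 * f x ^+ 2) * phi x -
     (a * trunc f x + gamma / 2 * trunc f x ^+ 2) * phi x).
    by apply/funext => x; rewrite /g mulrBl.
  rewrite (meanB _ _ (continuous_mul c1 cphi) (continuous_mul c2 cphi)).
  by ring.
rewrite (le_trans (ler_normB _ _))// /resc.
move: mg tail; set s' := Num.sqrt sigma^-1; move: (supc B) => S.
by lra.
Qed.

End Residual.

(** * Stability and convergence of the scheme *)

Section Gronwall.
Variable R : realType.

(** The growth is bounded by the explicit sequence [c * (1 + k * tau) * eps *
    (1 + 2 * b * tau) ^ k], which is nondecreasing; the coefficients of the
    extrapolation then count for at most [3 / 2 + 1 / 2 = 2]. *)
Lemma gronwall_two_step (x : nat -> R) (b c eps tau : R) (m : nat) :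
  0 <= b -> 0 <= c -> 0 <= eps -> 0 <= tau ->
  x 0%N <= c * eps -> x 1%N <= c * eps ->
  (forall k, (1 <= k < m)%N ->
     x k.+1 <= x k + tau * (b * ((3 * x k + x k.-1) / 2) + c * eps)) ->
  forall k, (k <= m)%N ->
  x k <= c * (1 + k%:R * tau) * eps * expR (2 * b * tau * k%:R).
Proof.
move=> b0 c0 e0 t0 x0 x1 step.
pose y k := c * (1 + k%:R * tau) * eps * (1 + 2 * b * tau) ^+ k.
have g1 : 1 <= 1 + 2 * b * tau by rewrite lerDl !mulr_ge0.
have g0 : 0 <= 1 + 2 * b * tau by exact: le_trans ler01 g1.
have ce0 : 0 <= c * eps by exact: mulr_ge0.
have y_ge k : c * eps <= y k.
  rewrite /y; have -> : c * (1 + k%:R * tau) * eps = c * eps + c * eps * (k%:R * tau) by ring.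
  have h : c * eps <= c * eps + c * eps * (k%:R * tau).
    by rewrite lerDl !mulr_ge0.
  by rewrite (le_trans h)// ler_peMr ?exprn_ege1// (le_trans ce0).
have y_mono k : y k <= y k.+1.
  rewrite /y exprS mulrA; apply: ler_pM; rewrite ?exprn_ge0//.
    by rewrite !mulr_ge0// addr_ge0 ?mulr_ge0.
  rewrite -[leLHS]mulr1; apply: ler_pM => //.
    by rewrite !mulr_ge0// addr_ge0 ?mulr_ge0.
  rewrite ler_wpM2r// ler_wpM2l// lerD2l ler_wpM2r// ler_nat//.
have main k : (k < m)%N -> x k <= y k /\ x k.+1 <= y k.+1.
  elim: k => [|k IH] km; first by split; [apply: le_trans (y_ge 0%N)|apply: le_trans (y_ge 1%N)].
  have [h0 h1] := IH (ltnW km); split => //.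
  apply: (le_trans (step k.+1 km)) => /=.
  have h0' : x k <= y k.+1 by exact: le_trans h0 (y_mono k).
  apply: (@le_trans _ _ (y k.+1 * (1 + 2 * b * tau) + tau * (c * eps))).
    have : tau * (b * ((3 * x k.+1 + x k) / 2) + c * eps) <= tau * (b * (2 * y k.+1) + c * eps).
      rewrite ler_wpM2l// lerD2r ler_wpM2l//; lra.
    lra.
  set P := (1 + 2 * b * tau) ^+ k.+2.
  have -> : y k.+1 * (1 + 2 * b * tau) = c * (1 + k.+1%:R * tau) * eps * P.
    by rewrite /y /P [in RHS]exprSr mulrA.
  have -> : y k.+2 = c * (1 + k.+1%:R * tau) * eps * P + tau * (c * eps) * P.
    by rewrite /y -/P -[k.+2%:R]natr1; ring.
  by rewrite lerD2l ler_peMr ?exprn_ege1// mulr_ge0.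
move=> k km; apply: (@le_trans _ _ (y k)).
  case: k km => [|k] km; first exact: le_trans x0 (y_ge 0%N).
  by have [] := main k km.
rewrite /y ler_wpM2l//.
  by rewrite !mulr_ge0// addr_ge0 ?mulr_ge0.
rewrite [2 * b * tau * _]mulrC expRM_natl; apply: lerXn2r; rewrite ?nnegrE ?expR_ge0//.
exact: expR_ge1Dx.
Qed.

End Gronwall.

Section Scheme.
Variables (R : realType) (xL xR a sigma gamma : R).
Hypotheses (hx : xL < xR) (hs : 0 < sigma) (hg : 0 <= gamma).
Variables (N n : nat).
Hypotheses (hN : N = n.*2) (hn : (0 < n)%N).

Local Notation ip := (ip xL xR sigma).
Local Notation nrm := (nrm xL xR sigma).
Local Notation A := (en_mx xL xR N sigma).
Local Notation DU := (DU xL xR a gamma).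
Local Notation bil := (bil xL xR).
Local Notation K := (emb xL xR sigma).
Implicit Types (U V W Z : 'cV[R]_N).

(** The difference quotient and the midpoint of two vectors, so that the scheme can
    be tested on the values of the exact solution at any two times. *)
Definition dt (tau : R) U U' : 'cV[R]_N := tau^-1 *: (U' - U).
Definition mid U U' : 'cV[R]_N := 2^-1 *: (U' + U).

Lemma dot_en_mx U V : dot (A *m U) V = ip U V.
Proof. by rewrite dotC -/(ip V U) (ipC hx hN hn). Qed.

Lemma dot_DU_diag W V : dot (DU W *m V) V = 0.
Proof.
by rewrite DU_mul dotDl !dotZl (dot_D1_diag _ _ hN) (dot_bil_diag _ _ hN) !mulr0 addr0.
Qed.

Lemma ip_dt_mid tau U U' : ip (dt tau U U') (mid U U') = (nrm U' ^+ 2 - nrm U ^+ 2) / (2 * tau).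
Proof.
rewrite /dt /mid ipZl (ipZr hx hN hn) (ipBl hx hN hn) !(ipDr hx hN hn).
rewrite (ipC hx hN hn sigma U U') !(nrm_sq hx hN hn hs) invfM; ring.
Qed.

Lemma nrm_mid U U' : nrm (mid U U') <= (nrm U' + nrm U) / 2.
Proof.
rewrite /mid (nrmZ hx hN hn) ger0_norm ?invr_ge0// mulrC ler_wpM2r ?invr_ge0//.
exact: (nrmD hx hN hn hs).
Qed.

Lemma nrm_mid_le U U' c : nrm U <= c -> nrm U' <= c -> nrm (mid U U') <= c.
Proof.
move=> hU hU'; apply: (le_trans (nrm_mid U U')).
by rewrite ler_pdivrMr// mulr_natr mulr2n lerD.
Qed.

(** Testing a step against the midpoint kills the skew-symmetric terms. *)
Lemma step_conservation tau U U' W : 0 < tau ->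
  A *m dt tau U U' + DU W *m mid U U' = 0 -> nrm U' = nrm U.
Proof.
move=> t0 h; have := congr1 (fun X => dot X (mid U U')) h.
rewrite /= dotDl dot_en_mx dot_DU_diag addr0 ip_dt_mid dotC dot0r => /eqP.
rewrite mulf_eq0 invr_eq0 mulf_eq0 (gt_eqF t0) pnatr_eq0 !orbF subr_eq0.
by rewrite eqrXn2 ?nrm_ge0// => /eqP.
Qed.

(** Here [U] follows the scheme with velocity [W], and [V] follows it with
    velocity [Y] up to a residual of dual norm at most [c]. In the difference,
    transport of the error by [W] preserves the energy; what remains is the
    error [Y - W] in the velocity acting on the midpoint of [V], which is
    bounded by [P]. *)
Lemma step_error (tau c P : R) U U' W V V' Y : 0 < tau -> 0 <= c -> 0 <= P ->
  A *m dt tau U U' + DU W *m mid U U' = 0 ->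
  (forall Z, dot (A *m dt tau V V' + DU Y *m mid V V') Z <= c * nrm Z) ->
  nrm (mid V V') <= P ->
  nrm (V' - U') <= nrm (V - U) + tau * (gamma / 3 * (2 * K ^+ 3 * P) * nrm (Y - W) + c).
Proof.
move=> t0 c0 P0 hU hV hP.
set E := V - U; set E' := V' - U'.
have e1 : dt tau E E' = dt tau V V' - dt tau U U'.
  by rewrite /dt /E /E' -scalerBr; congr (_ *: _); apply/matrixP => i j; rewrite !mxE; ring.
have e2 : mid E E' = mid V V' - mid U U'.
  by rewrite /mid /E /E' -scalerBr; congr (_ *: _); apply/matrixP => i j; rewrite !mxE; ring.
have e3 : DU Y *m mid V V' - DU W *m mid U U' =
    DU W *m mid E E' + (gamma / 3) *: bil (Y - W) (mid V V').
  rewrite e2 !DU_mul mulmxBr.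
  have -> : bil (Y - W) (mid V V') = bil Y (mid V V') - bil W (mid V V').
    by rewrite bilDl -scaleN1r bilZl scaleN1r.
  have -> : bil W (mid V V' - mid U U') = bil W (mid V V') - bil W (mid U U').
    by rewrite (bilDr _ _ W (mid V V')) -(scaleN1r (mid U U')) (bilZr _ _ (-1)) scaleN1r.
  by apply/matrixP => i j; rewrite !mxE; ring.
have main : (nrm E' ^+ 2 - nrm E ^+ 2) / (2 * tau) <=
    (c + gamma / 3 * (2 * K ^+ 3 * P) * nrm (Y - W)) * nrm (mid E E').
  rewrite -ip_dt_mid -dot_en_mx e1 mulmxBr.
  have -> : A *m dt tau V V' - A *m dt tau U U' =
     (A *m dt tau V V' + DU Y *m mid V V') - (DU W *m mid E E' + (gamma / 3) *: bil (Y - W) (mid V V')).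
    rewrite -e3; have -> : A *m dt tau U U' = - (DU W *m mid U U') by apply/eqP; rewrite -addr_eq0 hU.
    by apply/matrixP => i j; rewrite !mxE; ring.
  rewrite dotBl [X in _ - X]dotDl dot_DU_diag add0r dotZl mulrDl; apply: lerD; first exact: hV.
  have n1 := nrm_ge0 xL xR sigma (Y - W); have n2 := nrm_ge0 xL xR sigma (mid E E').
  have K0 : 0 <= 2 * K ^+ 3 by rewrite mulr_ge0// exprn_ge0// emb_ge0.
  have tri := trilinear_le hx hN hn hs (Y - W) (mid V V') (mid E E').
  have -> : gamma / 3 * (2 * K ^+ 3 * P) * nrm (Y - W) * nrm (mid E E') =
    gamma / 3 * (2 * K ^+ 3 * (nrm (Y - W) * P * nrm (mid E E'))) by ring.
  rewrite -mulrN ler_wpM2l ?divr_ge0//.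
  apply: (le_trans (ler_norm _)); rewrite normrN; apply: (le_trans tri).
  by apply: ler_wpM2l => //; apply: ler_wpM2r => //; exact: ler_wpM2l.
have nm := nrm_mid E E'.
set G := c + _ in main.
have G0 : 0 <= G.
  rewrite addr_ge0// mulr_ge0 ?nrm_ge0// mulr_ge0 ?divr_ge0// mulr_ge0// mulr_ge0// exprn_ge0//.
  exact: emb_ge0.
have E0 := nrm_ge0 xL xR sigma E; have E0' := nrm_ge0 xL xR sigma E'.
rewrite addrC -lerBlDr addrC.
rewrite -[gamma / 3 * _ * _ + c]addrC -/G.
have : (nrm E' - nrm E) * (nrm E' + nrm E) <= tau * G * (nrm E' + nrm E).
  have t2 : 0 < 2 * tau by rewrite mulr_gt0.
  have h := le_trans main (ler_wpM2l G0 nm).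
  rewrite ler_pdivrMr// in h.
  by move: h; rewrite -subr_sqr; lra.
have [S0|S0] := eqVneq (nrm E' + nrm E) 0.
  move=> _; have : nrm E' = 0 by lra.
  have : nrm E = 0 by lra.
  by move=> -> ->; rewrite oppr0 addr0 mulr_ge0 ?(ltW t0).
rewrite ler_pM2r ?lt_neqAle ?[0 == _]eq_sym ?S0 ?addr_ge0//; lra.
Qed.

(** Around the midpoint, the scheme differs from the average of the equations
    at both ends by the error of the trapezoidal rule, by the error of the
    velocity [Y], and by the defect of a quadratic form from its average,
    which is a quarter of the form at the difference [q - p]. *)
Lemma defect_le (tau c Q : R) (p q p1 q1 Y Z : 'cV[R]_N) : 0 <= Q ->
  `|ip p1 Z + dot (DU p *m p) Z| <= c * nrm Z ->
  `|ip q1 Z + dot (DU q *m q) Z| <= c * nrm Z ->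
  nrm (mid p q) <= Q -> nrm (Y - mid p q) <= Q * tau ^+ 2 ->
  nrm (q - p) <= Q * tau ->
  `|ip (dt tau p q) Z - (ip p1 Z + ip q1 Z) / 2| <= 2 * Q * tau ^+ 2 * nrm Z ->
  dot (A *m dt tau p q + DU Y *m mid p q) Z <=
  (c + (2 * Q + gamma / 3 * (5 / 2 * K ^+ 3 * Q ^+ 2)) * tau ^+ 2) * nrm Z.
Proof.
move=> Q0 hp hq hm hY hd ht.
have K0 : 0 <= 2 * K ^+ 3 by rewrite mulr_ge0// exprn_ge0// emb_ge0.
have nZ := nrm_ge0 xL xR sigma Z.
have t0 : 0 <= tau ^+ 2 by exact: sqr_ge0.
pose b X W := dot (bil X W) Z.
have bDl X X' W : b (X + X') W = b X W + b X' W by rewrite /b bilDl dotDl.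
have bDr X W W' : b X (W + W') = b X W + b X W' by rewrite /b bilDr dotDl.
have bZl k X W : b (k *: X) W = k * b X W by rewrite /b bilZl dotZl.
have bZr k X W : b X (k *: W) = k * b X W by rewrite /b bilZr dotZl.
have bNl X W : b (- X) W = - b X W by rewrite -scaleN1r bZl mulN1r.
have bNr X W : b X (- W) = - b X W by rewrite -scaleN1r bZr mulN1r.
have dU X W : dot (DU X *m W) Z = a * dot (fourier_diff xL xR N 1 *m W) Z + gamma / 3 * b X W.
  by rewrite DU_mul dotDl !dotZl.
have b1 : `|b (Y - mid p q) (mid p q)| <= 2 * K ^+ 3 * (Q * tau ^+ 2 * Q * nrm Z).
  apply: (le_trans (trilinear_le hx hN hn hs _ _ _)).
  by rewrite ler_wpM2l// ler_wpM2r// ler_pM ?nrm_ge0.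
have b2 : `|b (q - p) (q - p)| <= 2 * K ^+ 3 * (Q * tau * (Q * tau) * nrm Z).
  apply: (le_trans (trilinear_le hx hN hn hs _ _ _)).
  by rewrite ler_wpM2l// ler_wpM2r// ler_pM ?nrm_ge0.
rewrite dotDl dot_en_mx.
move: hp hq; rewrite !dU.
have -> : dot (fourier_diff xL xR N 1 *m mid p q) Z =
    (dot (fourier_diff xL xR N 1 *m q) Z + dot (fourier_diff xL xR N 1 *m p) Z) / 2.
  by rewrite /mid -scalemxAr dotZl mulmxDr dotDl mulrC.
have -> : b Y (mid p q) = b (Y - mid p q) (mid p q) + (b p p + b q q) / 2 - b (q - p) (q - p) / 4.
  have -> : b Y (mid p q) = b (Y - mid p q) (mid p q) + b (mid p q) (mid p q).
    by rewrite -bDl subrK.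
  rewrite -addrA; congr (_ + _).
  by rewrite /mid bZl bZr !bDl !bDr !bNl !bNr; field.
move: b1 b2 ht; move: (b (Y - _) _) (b (q - p) _) (ip (dt _ _ _) Z) => B1 B2 I.
move: (b p p) (b q q) (dot _ _) (dot _ _) (ip p1 Z) (ip q1 Z) => bp bq Dq Dp I1 I2.
move=> /ler_normlP[b1 b1'] /ler_normlP[b2 b2'] /ler_normlP[h1 h1'] /ler_normlP[h2 h2'] /ler_normlP[h3 h3'].
have g3 : 0 <= gamma / 3 by rewrite divr_ge0.
have g1 := ler_wpM2l g3 b1'; have g2 := ler_wpM2l g3 b2.
lra.
Qed.

End Scheme.

Section Convergence.
Variables (R : realType) (xL xR a sigma gamma T r : R).
Hypotheses (hx : xL < xR) (ha : 0 <= a) (hs : 0 < sigma) (hg : 0 <= gamma).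
Hypotheses (hT : 0 < T) (hr : 0 <= r).
Variables (u : R -> R -> R) (u0 : R -> R) (w1 w2 w3 : R -> R -> R) (B : R).
Local Notation w := (fun t x => u x t).
Local Notation tI t := (0 <= t <= T) (only parsing).
Hypothesis sol : RLW_solution xL xR a sigma gamma T (r + 1) u0 u.
Hypothesis dw : forall t, tI t -> is_Hs_derive xL xR (r + 1) T w t (w1 t).
Hypothesis dw1 : forall t, tI t -> is_Hs_derive xL xR (r + 1) T w1 t (w2 t).
Hypothesis dw2 : forall t, tI t -> is_Hs_derive xL xR (r + 1) T w2 t (w3 t).
Hypothesis cw : forall t, tI t -> continuous (w t).
Hypothesis cw1 : forall t, tI t -> continuous (w1 t).
Hypothesis cw2 : forall t, tI t -> continuous (w2 t).
Hypothesis cw3 : forall t, tI t -> continuous (w3 t).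
Hypothesis pw : forall t, tI t -> periodic (w t) (xR - xL).
Hypothesis sw1 : forall t, tI t -> Hsp xL xR (r + 1) (w1 t).
Hypothesis hB : forall t, tI t ->
  [/\ Hs_le xL xR (r + 1) (w t) B, Hs_le xL xR (r + 1) (w1 t) B,
      Hs_le xL xR (r + 1) (w2 t) B & Hs_le xL xR (r + 1) (w3 t) B].

Variables (N n M : nat).
Hypotheses (hN : N = n.*2) (hn : (0 < n)%N) (hM : (M.*2 < n)%N) (NM : (N <= 4 * M.+1)%N).

Local Notation mu := (wavenumber xL xR).
Local Notation ip := (ip xL xR sigma).
Local Notation nrm := (nrm xL xR sigma).
Local Notation A := (en_mx xL xR N sigma).
Local Notation DU := (DU xL xR a gamma).
Local Notation K := (emb xL xR sigma).
Local Notation rate := (rate xL xR r N).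
Local Notation gv f := (gvec xL xR N (trunc xL xR M f)).
Local Notation V t := (gv (w t)).
Local Notation ell := (ell xL xR sigma M).

(** Bounds the energy norm of the grid values of the solution and of its three
    time derivatives. *)
Definition solc : R := Num.sqrt ((1 + sigma) * B).
Local Notation Q := solc.

Lemma solc_ge0 : 0 <= Q. Proof. exact: sqrtr_ge0. Qed.

(** Boundedness of the functional, in the form that [der_in_functional] asks
    for. *)
Lemma ell_der (f f1 : R -> R -> R) (psi : 'cV[R]_N) : (forall t, tI t -> continuous (f t)) ->
  (forall t, tI t -> continuous (f1 t)) ->
  (forall t, tI t -> is_Hs_derive xL xR (r + 1) T f t (f1 t)) ->
  forall t, tI t -> der_in T (fun t => ell psi (f t)) t (ell psi (f1 t)).
Proof.
move=> cf cf1 df t ht.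
apply: (der_in_functional (ell := ell psi) (K := Num.sqrt (1 + sigma) * nrm psi)) => //.
- by move=> *; exact: ellB.
- by move=> *; exact: ellZ.
- move=> g D _ hD; apply: (le_trans (ell_le hx hs hr hN hn hM psi hD)).
  by rewrite sqrtrM ?addr_ge0 ?(ltW hs)// mulrAC.
- exact: cf1.
- exact: df.
Qed.

Lemma nrm_sol t : tI t -> nrm (V t) <= Q.
Proof. by move=> ht; have [h _ _ _] := hB ht; apply: (nrm_trunc hx hs hr hN hn hM (cw ht) h). Qed.

Lemma sol_first_difference x y : 0 <= x -> x <= y -> y <= T ->
  nrm (V y - V x) <= Q * (y - x).
Proof.
move=> x0 xy yT.
have yI : tI y by rewrite yT (le_trans x0).
have xI : tI x by rewrite x0 (le_trans xy).
apply: (nrm_dual hx hN hn hs); first by rewrite mulr_ge0 ?solc_ge0// subr_ge0.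
move=> psi; rewrite (ipBl hx hN hn) !(ip_trunc _ hx hN hn hM); [|exact: cw|exact: cw].
apply: (le_trans (ler_norm _)); rewrite mulrAC.
apply: (first_difference (ell_der psi cw cw1 dw)) => // t ht.
by have [_ h _ _] := hB ht; exact: (ell_le hx hs hr hN hn hM psi h).
Qed.

Lemma sol_second_difference x h : 0 <= x -> 0 <= h -> x + h + h <= T ->
  nrm (V (x + h + h) - 2 *: V (x + h) + V x) <= 2 * Q * h ^+ 2.
Proof.
move=> x0 h0 hT'.
have I0 : tI x by lra.
have I1 : tI (x + h) by lra.
have I2 : tI (x + h + h) by lra.
apply: (nrm_dual hx hN hn hs); first by rewrite !mulr_ge0 ?solc_ge0 ?sqr_ge0.
move=> psi; rewrite ipDl (ipBl hx hN hn) ipZl !(ip_trunc _ hx hN hn hM); [|exact: cw|exact: cw|exact: cw].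
apply: (le_trans (ler_norm _)).
have -> : 2 * Q * h ^+ 2 * nrm psi = 2 * (Q * nrm psi) * h ^+ 2 by ring.
apply: (second_difference hT (ell_der psi cw cw1 dw) (ell_der psi cw1 cw2 dw1)) => // t ht.
by have [_ _ h' _] := hB ht; exact: (ell_le hx hs hr hN hn hM psi h').
Qed.

Lemma sol_trapezoid t tau psi : 0 <= t -> 0 < tau -> t + tau <= T ->
  `|ip (dt tau (V t) (V (t + tau))) psi - (ip (gv (w1 t)) psi + ip (gv (w1 (t + tau))) psi) / 2|
  <= 2 * Q * tau ^+ 2 * nrm psi.
Proof.
move=> t0 tau0 tT.
have I0 : tI t by lra.
have I1 : tI (t + tau) by lra.
rewrite /dt ipZl (ipBl hx hN hn) !(ip_trunc _ hx hN hn hM); [|exact: cw1|exact: cw1|exact: cw|exact: cw].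
have tt : t <= t + tau by lra.
have b1 s : tI s -> `|ell psi (w1 s)| <= Q * nrm psi.
  by move=> ht; have [_ h' _ _] := hB ht; exact: (ell_le hx hs hr hN hn hM psi h').
have b3 s : tI s -> `|ell psi (w3 s)| <= Q * nrm psi.
  by move=> ht; have [_ _ _ h'] := hB ht; exact: (ell_le hx hs hr hN hn hM psi h').
have := trapezoid hT (ell_der psi cw cw1 dw) (ell_der psi cw1 cw2 dw1)
  (ell_der psi cw2 cw3 dw2) b1 b3 t0 tt tT.
have -> : t + tau - t = tau by ring.
move: (ell psi _) (ell psi _) (ell psi _) (ell psi _) (nrm psi) => e4 e3 e2 e1 m.
have -> : e1 - e2 - tau / 2 * (e3 + e4) = tau * (tau^-1 * (e1 - e2) - (e3 + e4) / 2).
  by field; rewrite gt_eqF.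
have -> : 2 * (Q * m) * tau ^+ 3 = tau * (2 * Q * tau ^+ 2 * m) by ring.
by rewrite normrM (gtr0_norm tau0) ler_pM2l.
Qed.

Definition consc : R :=
  resc xL xR sigma a gamma B + (2 * Q + gamma / 3 * (5 / 2 * K ^+ 3 * Q ^+ 2)).

Lemma resc_ge0 : 0 <= resc xL xR sigma a gamma B.
Proof.
have s0 : 0 <= supc xL xR B by exact: sqrtr_ge0.
rewrite /resc addr_ge0 ?sqrtr_ge0// !mulr_ge0 ?sqrtr_ge0//.
by rewrite addr_ge0// mulr_ge0.
Qed.

Lemma quad_ge0 : 0 <= 2 * Q + gamma / 3 * (5 / 2 * K ^+ 3 * Q ^+ 2).
Proof.
have K0 := emb_ge0 xL xR sigma; have Q0 := solc_ge0.
by rewrite addr_ge0 ?mulr_ge0 ?divr_ge0 ?exprn_ge0.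
Qed.

Lemma consc_ge0 : 0 <= consc.
Proof. exact: addr_ge0 resc_ge0 quad_ge0. Qed.

(** The average of the residuals at both ends gives the rate in space, and the
    differences in time give the second order. *)
Lemma consistency t tau Y Z : 0 <= t -> 0 < tau -> t + tau <= T ->
  nrm (Y - mid (V t) (V (t + tau))) <= Q * tau ^+ 2 ->
  dot (A *m dt tau (V t) (V (t + tau)) + DU Y *m mid (V t) (V (t + tau))) Z <=
  consc * (tau ^+ 2 + rate) * nrm Z.
Proof.
move=> t0 tau0 tT hY.
have I0 : tI t by lra.
have I1 : tI (t + tau) by lra.
have tt : t <= t + tau by lra.
have res s : tI s -> `|ip (gv (w1 s)) Z + dot (DU (V s) *m V s) Z| <=
    resc xL xR sigma a gamma B * rate * nrm Z.
  move=> Is; have [h h1 _ _] := hB Is.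
  apply: (residual_le hx hs hr hN hn hM NM Z ha hg (cw Is) (pw Is) (cw1 Is) h h1) => p q.
  exact: (weak_form hx hT hr n p q sol cw (sw1 Is) Is (dw Is)).
have nm := nrm_mid_le hx hs hN hn (nrm_sol I0) (nrm_sol I1).
have nd : nrm (V (t + tau) - V t) <= Q * tau.
  by have := sol_first_difference t0 tt tT; rewrite [t + tau - t]addrAC subrr add0r.
apply: (le_trans (defect_le hx hs hg hN hn solc_ge0 (res t I0) (res _ I1) nm hY nd
  (sol_trapezoid Z t0 tau0 tT))).
rewrite ler_wpM2r ?nrm_ge0// /consc.
have := mulr_ge0 resc_ge0 (sqr_ge0 tau); have := mulr_ge0 quad_ge0 (rate_ge0 xL xR r N).
lra.
Qed.

Definition initc : R := Num.sqrt ((25 / mu ^+ 2 + 25 * sigma) * B).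

(** The inverse inequality loses one power of [N], which the mean square of
    the truncation error on the grid gains. So the initial error has the rate
    of the truncation, although the initial values are not truncated. *)
Lemma initial_error : nrm (V 0 - gvec xL xR N (w 0)) <= initc * rate.
Proof.
have I0 : tI (0 : R) by rewrite lexx ltW.
have [h _ _ _] := hB I0.
have B0 : 0 <= B := Hs_le_ge0 h.
have mu0 : 0 < mu := wavenumber_gt0 hx.
have r0 := rate_ge0 xL xR r N.
have -> : V 0 - gvec xL xR N (w 0) = - gvec xL xR N (fun x => w 0 x - trunc xL xR M (w 0) x).
  by apply/matrixP => i j; rewrite !mxE opprB.
rewrite (nrmN hx hN hn); set d := gvec _ _ _ _.
have hl : l2 d <= 10 / (mu * N%:R) * (Num.sqrt B * rate).
  exact: (l2_sub_trunc hx hr hN hn NM (cw I0) (pw I0) h).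
have hq0 : 0 <= 25 / mu ^+ 2 + 25 * sigma.
  by rewrite addr_ge0 ?divr_ge0 ?sqr_ge0// mulr_ge0// ltW.
have n0 : 1 <= n%:R :> R by rewrite ler1n.
have nn0 : n%:R != 0 :> R by rewrite pnatr_eq0 -lt0n.
have NE : N%:R = 2 * n%:R :> R by rewrite hN -muln2 natrM mulrC.
have dd : dot d d <= 100 / (mu ^+ 2 * (2 * n%:R) ^+ 2) * (B * rate ^+ 2).
  have h1 : l2 d ^+ 2 <= (10 / (mu * N%:R) * (Num.sqrt B * rate)) ^+ 2.
    by rewrite lerXn2r ?nnegrE ?l2_ge0// (le_trans (l2_ge0 d)).
  rewrite l2_sq in h1; apply: (le_trans h1).
  rewrite [leLHS]exprMn [X in _ * X]exprMn sqr_sqrtr// NE.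
  apply: ler_wpM2r; first by rewrite mulr_ge0 ?sqr_ge0.
  by apply: eq_ler; field; rewrite nn0 (gt_eqF mu0).
rewrite /initc; apply: (le_trans (ler_norm _)); apply: ler_of_sqr; first by rewrite mulr_ge0 ?sqrtr_ge0.
rewrite (nrm_sq hx hN hn hs) [leRHS]exprMn sqr_sqrtr ?mulr_ge0//.
apply: (le_trans (inverse_ineq hx hN hn hs d)).
have s0 : 0 <= 1 + sigma * (n%:R * mu) ^+ 2.
  by rewrite addr_ge0// mulr_ge0 ?sqr_ge0// ltW.
apply: (le_trans (ler_wpM2l s0 dd)).
rewrite mulrA -[leRHS]mulrA; apply: ler_wpM2r; first by rewrite mulr_ge0 ?sqr_ge0.
have -> : (1 + sigma * (n%:R * mu) ^+ 2) * (100 / (mu ^+ 2 * (2 * n%:R) ^+ 2)) =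
   25 / mu ^+ 2 * (n%:R ^- 2) + 25 * sigma.
  by field; rewrite nn0 (gt_eqF mu0).
rewrite lerD2r ler_piMr ?divr_ge0 ?sqr_ge0//.
by rewrite invf_le1 ?exprn_gt0// ?ltr0n// exprn_ege1.
Qed.

Definition transc : R := gamma / 3 * (2 * K ^+ 3 * Q).
Definition firstc : R := 3 * initc + 2 * T * consc + 2 * Q * transc ^+ 2.

Lemma transc_ge0 : 0 <= transc.
Proof.
have K0 := emb_ge0 xL xR sigma; have Q0 := solc_ge0.
by rewrite !mulr_ge0 ?divr_ge0 ?exprn_ge0.
Qed.

Lemma initc_ge0 : 0 <= initc.
Proof. exact: sqrtr_ge0. Qed.

Lemma firstc_ge0 : 0 <= firstc.
Proof.
have := initc_ge0; have := consc_ge0; have := solc_ge0; have := hT => T0 q c i.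
have : 0 <= 2 * T * consc by rewrite !mulr_ge0// ltW.
have : 0 <= 2 * Q * transc ^+ 2 by apply: mulr_ge0 (sqr_ge0 _); exact: mulr_ge0.
by rewrite /firstc; lra.
Qed.

Variables (Nt : nat) (U : nat -> 'cV[R]_N).
Hypotheses (hNt : (0 < Nt)%N) (hU : LCN_MP xL xR a sigma gamma T Nt u0 U).
Local Notation tau := (T / Nt%:R).
Local Notation x k := (nrm (V (k%:R * tau) - U k)).
Local Notation eps := (tau ^+ 2 + rate).

Lemma tau_gt0 : 0 < tau.
Proof. by rewrite divr_gt0 ?ltr0n. Qed.

Lemma time_le k : (k <= Nt)%N -> k%:R * tau <= T.
Proof.
move=> kN; rewrite mulrCA -[leRHS]mulr1 ler_wpM2l ?(ltW hT)//.
by rewrite ler_pdivrMr ?ltr0n// mul1r ler_nat.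
Qed.

Lemma time_ge0 k : 0 <= k%:R * tau.
Proof. by rewrite mulr_ge0// ltW// tau_gt0. Qed.

Lemma timeS k : k.+1%:R * tau = k%:R * tau + tau.
Proof. by rewrite -natr1 mulrDl mul1r. Qed.

Lemma tau_leT : tau <= T.
Proof. by have := time_le hNt; rewrite mul1r. Qed.

Lemma eps_ge0 : 0 <= eps.
Proof. by rewrite addr_ge0 ?sqr_ge0// rate_ge0. Qed.

Lemma error0 : x 0%N <= initc * rate.
Proof.
have [U0 _ _] := hU; have [w0 _ _] := sol; rewrite mul0r U0.
have -> : \col_(j < N) u0 (grid xL xR N j) = gvec xL xR N (w 0).
  by apply/matrixP => i j; rewrite !mxE w0.
exact: initial_error.
Qed.

(** The first step is implicit in the transported velocity: its error is
    absorbed when the step is short. A long step, with [transc * tau > 1], is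
    of no concern because the conservation of the discrete energy bounds the
    error, and this bound is of order [tau ^ 2] for such [tau]; hence no
    restriction on the step. *)
Lemma error1 : x 1%N <= firstc * eps.
Proof.
have absorb (X Y m1 m0 c1 c2 c3 c4 : R) : X <= (m1 + m0) / 2 -> Y <= c1 ->
  m0 <= c2 -> c2 <= c3 -> 0 <= c1 -> 0 <= c4 -> m1 <= m0 + (X + Y) ->
  m1 <= 3 * c3 + 2 * c1 + c4 by lra.
have crude (m1 v1 z v0 m0 q c1 c2 c3 c4 : R) : m1 <= v1 + z -> z <= v0 + m0 ->
  v1 <= q -> v0 <= q -> m0 <= c2 -> c2 <= c3 -> 0 <= c3 -> 0 <= c1 ->
  2 * q <= c4 -> m1 <= 3 * c3 + 2 * c1 + c4 by lra.
have t0 := tau_gt0; have tT := tau_leT; have [_ st _] := hU.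
have Q0 := solc_ge0; have c0 := consc_ge0; have i0 := initc_ge0; have e0 := eps_ge0.
have x00 := error0; have C0 := transc_ge0; have r0 := rate_ge0 xL xR r N.
have tt : 0 + tau <= T by rewrite add0r.
have I0 : tI (0 : R) by rewrite lexx ltW.
have I1 : tI tau by rewrite ltW.
have e1 : nrm (V 0 - U 0%N) <= initc * rate by move: x00; rewrite mul0r.
rewrite mul1r.
have ir : initc * rate <= initc * eps by rewrite ler_wpM2l// lerDr sqr_ge0.
have ieps : 0 <= initc * eps by exact: mulr_ge0.
have ceps : 0 <= consc * eps by exact: mulr_ge0.
have tce : 0 <= T * (consc * eps) by rewrite mulr_ge0// ltW.
have qe : 0 <= 2 * Q * transc ^+ 2 * eps.
  by apply: mulr_ge0 => //; apply: mulr_ge0 (sqr_ge0 _); exact: mulr_ge0.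
have fE : firstc * eps = 3 * (initc * eps) + 2 * (T * (consc * eps)) + 2 * Q * transc ^+ 2 * eps.
  by rewrite /firstc; ring.
have st' : A *m dt tau (U 0%N) (U 1%N) + DU (mid (U 0%N) (U 1%N)) *m mid (U 0%N) (U 1%N) = 0.
  exact: st.
have [short|long] := leP (transc * tau) 1.
- have hm := nrm_mid_le hx hs hN hn (nrm_sol I0) (nrm_sol I1).
  have cons Z : dot (A *m dt tau (V 0) (V tau) + DU (mid (V 0) (V tau)) *m mid (V 0) (V tau)) Z <=
      consc * eps * nrm Z.
    have := @consistency 0 tau (mid (V 0) (V tau)) Z (lexx _) t0 tt; rewrite add0r; apply.
    by rewrite subrr -(scale0r (0 : 'cV[R]_N)) (nrmZ hx hN hn) normr0 mul0r mulr_ge0 ?sqr_ge0.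
  have := step_error hx hs hg hN hn t0 ceps Q0 st' cons hm; rewrite -/transc.
  set W := mid (V 0) _ - _.
  have hW : nrm W <= (nrm (V tau - U 1%N) + nrm (V 0 - U 0%N)) / 2.
    have -> : W = mid (V 0 - U 0%N) (V tau - U 1%N).
      by rewrite /W /mid -scalerBr; congr (_ *: _); apply/matrixP => i j; rewrite !mxE; ring.
    exact: (nrm_mid hx hs hN hn (V 0 - U 0%N) (V tau - U 1%N)).
  have n1 := nrm_ge0 xL xR sigma (V tau - U 1%N); have n0 := nrm_ge0 xL xR sigma (V 0 - U 0%N).
  have W0 := nrm_ge0 xL xR sigma W.
  have h1 : tau * (transc * nrm W) <= (nrm (V tau - U 1%N) + nrm (V 0 - U 0%N)) / 2.
    rewrite mulrA [tau * _]mulrC; apply: le_trans hW; by rewrite ler_piMl.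
  have h2 : tau * (consc * eps) <= T * (consc * eps) by rewrite ler_wpM2r.
  rewrite mulrDr fE; move: h1 h2 e1 ir tce qe.
  move: (tau * (transc * nrm W)) (tau * (consc * eps)) (nrm (V tau - U 1%N)) (nrm (V 0 - U 0%N)) => X Y m1 m0.
  move: (T * _) (initc * rate) (initc * eps) (2 * Q * _ * _) => c1 c2 c3 c4.
  by exact: absorb.
- have cons := step_conservation hx hs hN hn t0 st'.
  have h1 := nrmB hx hN hn hs (V tau) (U 1%N); rewrite cons in h1.
  have h2 : nrm (U 0%N) <= nrm (V 0) + nrm (V 0 - U 0%N).
    have -> : U 0%N = V 0 - (V 0 - U 0%N) by rewrite subKr.
    by rewrite {2}subKr; exact: (nrmB hx hN hn hs).
  have h3 : 2 * Q <= 2 * Q * transc ^+ 2 * eps.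
    rewrite -[leLHS]mulr1 -[leRHS]mulrA; apply: ler_wpM2l; first exact: mulr_ge0.
    apply: (@le_trans _ _ (transc ^+ 2 * tau ^+ 2)); last by rewrite ler_wpM2l ?sqr_ge0// lerDl.
    by rewrite -exprMn exprn_ege1// ltW.
  by rewrite fE; apply: (crude _ _ _ _ _ _ _ _ _ _ h1 h2 (nrm_sol I1) (nrm_sol I0) e1).
Qed.

(** The extrapolated velocity differs from the midpoint by half a second
    difference, so that [consistency] applies; its error is at most the
    extrapolation of the errors. *)
Lemma error_step k : (1 <= k < Nt)%N ->
  x k.+1 <= x k + tau * (transc * ((3 * x k + x k.-1) / 2) + (firstc + consc) * eps).
Proof.
move=> /andP[k1 kNt]; have [_ _ st] := hU.
have t0 := tau_gt0; have c0 := consc_ge0; have e0 := eps_ge0; have Q0 := solc_ge0.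
have ceps : 0 <= consc * eps by exact: mulr_ge0.
case: k k1 kNt => // k _ kNt.
have st' : A *m dt tau (U k.+1) (U k.+2) +
    DU (2^-1 *: (3 *: U k.+1 - U k)) *m mid (U k.+1) (U k.+2) = 0.
  by apply: st.
rewrite (timeS k.+1).
have T1 := time_ge0 k.+1; have T2 := time_le kNt; have T0 := time_ge0 k.
rewrite (timeS k.+1) in T2.
set t := k.+1%:R * tau in T1 T2 *.
have tE : t = k%:R * tau + tau by exact: timeS.
have I1 : tI t by lra.
have I2 : tI (t + tau) by lra.
have hm := nrm_mid_le hx hs hN hn (nrm_sol I1) (nrm_sol I2).
set Y := 2^-1 *: (3 *: V t - V (k%:R * tau)).
have hY : nrm (Y - mid (V t) (V (t + tau))) <= Q * tau ^+ 2.
  have -> : Y - mid (V t) (V (t + tau)) =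
      - 2^-1 *: (V (k%:R * tau + tau + tau) - 2 *: V (k%:R * tau + tau) + V (k%:R * tau)).
    rewrite /Y /mid -tE scaleNr -scalerBr -scalerN; congr (_ *: _).
    by apply/matrixP => i j; rewrite !mxE; ring.
  rewrite (nrmZ hx hN hn) normrN ger0_norm ?invr_ge0//.
  have h : k%:R * tau + tau + tau <= T by rewrite -tE.
  by have := sol_second_difference T0 (ltW t0) h; lra.
have cons Z := consistency Z T1 t0 T2 hY.
have := step_error hx hs hg hN hn t0 ceps Q0 st' cons hm; rewrite -/transc => h.
apply: (le_trans h); rewrite lerD2l ler_wpM2l ?(ltW t0)//; apply: lerD.
  rewrite ler_wpM2l ?transc_ge0//.
  have -> : Y - 2^-1 *: (3 *: U k.+1 - U k) = 2^-1 *: (3 *: (V t - U k.+1) - (V (k%:R * tau) - U k)).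
    by rewrite /Y -scalerBr; congr (_ *: _); apply/matrixP => i j; rewrite !mxE; ring.
  rewrite (nrmZ hx hN hn) ger0_norm ?invr_ge0// mulrC ler_wpM2r ?invr_ge0//.
  apply: (le_trans (nrmB hx hN hn hs _ _)).
  by rewrite (nrmZ hx hN hn) ger0_norm.
by rewrite ler_wpM2r// lerDr firstc_ge0.
Qed.

Definition errc : R := (firstc + consc) * (1 + T) * expR (2 * transc * T).

Lemma error_le k : (k <= Nt)%N -> x k <= errc * eps.
Proof.
move=> kNt.
have f0 := firstc_ge0; have c0 := consc_ge0; have e0 := eps_ge0; have i0 := initc_ge0.
have fc : 0 <= firstc + consc by exact: addr_ge0.
have ce : 0 <= consc * eps by exact: mulr_ge0.
have h0 : x 0%N <= (firstc + consc) * eps.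
  apply: (le_trans error0); apply: (@le_trans _ _ (firstc * eps)); last by rewrite [leRHS]mulrDl lerDl.
  apply: ler_pM => //; first exact: rate_ge0; last by rewrite lerDr sqr_ge0.
  have : 0 <= 2 * T * consc by rewrite !mulr_ge0// ltW.
  have : 0 <= 2 * Q * transc ^+ 2 by apply: mulr_ge0 (sqr_ge0 _); exact: mulr_ge0 solc_ge0.
  by rewrite /firstc; lra.
have h1 : x 1%N <= (firstc + consc) * eps.
  by apply: (le_trans error1); rewrite [leRHS]mulrDl lerDl.
apply: (le_trans (gronwall_two_step transc_ge0 fc e0 (ltW tau_gt0) h0 h1 error_step kNt)).
rewrite /errc -[leRHS]mulrAC; apply: ler_pM.
- by rewrite !mulr_ge0// addr_ge0 ?time_ge0.
- exact: expR_ge0.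
- by rewrite ler_wpM2r// ler_wpM2l// lerD2l time_le.
- rewrite ler_expR -mulrA; apply: ler_wpM2l; first exact: mulr_ge0 transc_ge0.
  by rewrite [tau * _]mulrC; exact: time_le.
Qed.

(** The truncation error in the supremum, and the embedding of the energy
    norm. *)
Lemma pointwise_error k (j : 'I_N) : (k <= Nt)%N ->
  `|u (grid xL xR N j) (k%:R * tau) - U k j 0| <= supc xL xR B * rate + K * errc * eps.
Proof.
move=> kNt; set t := k%:R * tau.
have It : tI t by rewrite /t time_ge0 time_le.
have [h _ _ _] := hB It.
have gI : xL <= grid xL xR N j <= xR.
  have N0 : 0 < N%:R :> R by rewrite ltr0n (leq_ltn_trans _ (ltn_ord j)).
  have j1 : j%:R / N%:R <= 1 :> R by rewrite ler_pdivrMr// mul1r ler_nat ltnW.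
  have j0 : 0 <= j%:R / N%:R :> R by rewrite divr_ge0.
  have L0 : 0 <= xR - xL by rewrite subr_ge0 ltW.
  have -> : grid xL xR N j = xL + j%:R / N%:R * (xR - xL) by rewrite /grid; ring.
  have := ler_wpM2r L0 j1; have := mulr_ge0 j0 L0; lra.
have h1 := sup_sub_trunc hx hr hN hn NM (cw It) (pw It) h gI; rewrite -/(supc xL xR B) in h1.
have h2 := sup_emb hx hN hn hs (V t - U k) j.
have h3 : K * x k <= K * errc * eps.
  by rewrite -mulrA ler_wpM2l ?emb_ge0// error_le.
have -> : u (grid xL xR N j) t - U k j 0 =
   (u (grid xL xR N j) t - trunc xL xR M (w t) (grid xL xR N j)) + (V t - U k) j 0.
  by rewrite !mxE; ring.
apply: (le_trans (ler_normD _ _)); apply: lerD => //.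
exact: le_trans h2 h3.
Qed.

End Convergence.

Theorem theorem4p2 (R : realType) (xL xR a sigma gamma T r : R)
    (u0 : R -> R) (u : R -> R -> R)
    (hx : xL < xR) (ha : 0 < a) (hsigma : 0 < sigma) (hgamma : 0 < gamma)
    (hT : 0 < T) (hr : 2^-1 < r)
    (hu : RLW_solution xL xR a sigma gamma T (r + 1) u0 u)
    (hreg : Cm_Hsp xL xR (r + 1) T 3 (fun t x => u x t)) :
  exists2 C : R, 0 < C &
    forall (N Nt : nat) (U : nat -> 'cV[R]_N),
      (0 < N)%N -> ~~ odd N -> (0 < Nt)%N ->
      LCN_MP xL xR a sigma gamma T Nt u0 U ->
      forall n : nat, (n <= Nt)%N ->
        norm_inf_h (\col_(j < N) u (grid xL xR N j) (n%:R * (T / Nt%:R)) - U n)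
        <= C * ((T / Nt%:R) ^+ 2 + N%:R `^ (- r)).
Proof.
have r0 : 0 <= r by apply: le_trans (ltW hr); rewrite invr_ge0.
have a0 := ltW ha; have g0 := ltW hgamma.
have [w1 [w2 [w3 [B [[dw dw1 dw2] [[cw cw1 cw2 cw3] [pw hB]]]]]]] := C3_bounds hx hreg.
have pw' t (tI : 0 <= t <= T) := (pw t tI).1.
have sw1 t (tI : 0 <= t <= T) := (pw t tI).2.
set k := (wavenumber xL xR / 4) `^ (- r).
have k0 : 0 <= k by exact: powR_ge0.
set S := supc xL xR B.
have S0 : 0 <= S by exact: sqrtr_ge0.
set E := emb xL xR sigma * errc xL xR a sigma gamma T B.
have E0 : 0 <= E.
  rewrite mulr_ge0 ?emb_ge0// mulr_ge0 ?expR_ge0// mulr_ge0//; last by rewrite addr_ge0// ltW.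
  by apply: addr_ge0; [exact: firstc_ge0|exact: consc_ge0].
have CP : 0 < S * k + E * (1 + k) + 1.
  by apply: ltr_wpDl => //; apply: addr_ge0; apply: mulr_ge0 => //; exact: addr_ge0.
exists (S * k + E * (1 + k) + 1) => // N Nt U N0 Ne Nt0 hU m mNt.
have hN : N = (N./2).*2 by rewrite -[LHS]odd_double_half (negbTE Ne).
set n := N./2 in hN.
have hn : (0 < n)%N by move: N0 hN; clear; lia.
set p := N%:R `^ (- r); have p0 : 0 <= p by exact: powR_ge0.
set q := (T / Nt%:R) ^+ 2; have q0 : 0 <= q by exact: sqr_ge0.
have C0 : 0 <= (S * k + E * (1 + k) + 1) * (q + p).
  by apply: mulr_ge0; [exact: ltW|exact: addr_ge0].
apply/bigmax_leP; split => // j _; rewrite !mxE.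
(* Twice the truncation degree must stay below [n], and the degree must be
   comparable to [N] to keep the rate. *)
pose M := (n.-1)./2.
have hM : (M.*2 < n)%N by rewrite /M; move: hn; clear; lia.
have NM : (N <= 4 * M.+1)%N by rewrite /M; move: hn hN; clear; lia.
have := pointwise_error hx a0 hsigma g0 hT r0 hu dw dw1 dw2 cw cw1 cw2 cw3 pw' sw1 hB
  hN hn hM NM Nt0 hU j mNt.
rewrite -/S -/E -/q /rate -/k -/p => h; apply: (le_trans h).
have := mulr_ge0 (mulr_ge0 S0 k0) q0; have := mulr_ge0 E0 p0; have := mulr_ge0 (mulr_ge0 E0 k0) q0.
lra.
Qed.
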